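(* Assume the setting below and let $\lambda\in\mathbb C\setminus\sigma_{\mathrm{ess}}(\mathcal L)$. Then $\lambda\in\sigma_{\mathrm{pt}}(\mathcal L)$ if and only if $\mathcal I+\mathcal K(\lambda)$ is not invertible on $L^2(\mathbb R,\mathbb C^4)$.
   Context: Setting. Fix real parameters $D,\beta,\delta,\alpha,\epsilon,\gamma,\mu,\nu$ with $\beta\ge 0$ and $(D,\beta)\neq(0,0)$. Let $\mathbf B=\begin{bmatrix}\beta&-D/2\\ D/2&\beta\end{bmatrix}$, $\mathbf N_0=\begin{bmatrix}\delta&-\alpha\\ \alpha&\delta\end{bmatrix}$, $\mathbf N_1=\begin{bmatrix}\epsilon&-\gamma\\ \gamma&\epsilon\end{bmatrix}$, $\mathbf N_2=\begin{bmatrix}\mu&-\nu\\ \nu&\mu\end{bmatrix}$. Let $\psi:\mathbb R\to\mathbb C$ be a stationary pulse of the cubic–quintic complex Ginzburg–Landau equation $i\Psi_t+\frac D2\Psi_{xx}+\gamma|\Psi|^2\Psi+\nu|\Psi|^4\Psi=i\delta\Psi+i\epsilon|\Psi|^2\Psi+i\beta\Psi_{xx}+i\mu|\Psi|^4\Psi$ (i.e. $\Psi(t,x)=e^{-i\alpha t}\psi(x)$ solves it), write $\boldsymbol\psi=[\operatorname{Re}\psi\ \operatorname{Im}\psi]^T$, $|\boldsymbol\psi|=\|\boldsymbol\psi(x)\|_2$, and assume $|\boldsymbol\psi(x)|\to0$ as $|x|\to\infty$. Let $\mathbf M(x)=\mathbf N_1|\boldsymbol\psi|^2+\mathbf N_2|\boldsymbol\psi|^4+(2\mathbf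 N_1+4\mathbf N_2|\boldsymbol\psi|^2)\boldsymbol\psi\boldsymbol\psi^T$ and $\mathcal L=\mathbf B\partial_x^2+\mathbf N_0+\mathbf M(x)$ on $H^2(\mathbb R,\mathbb C^2)\subset L^2(\mathbb R,\mathbb C^2)$ (the linearization about $\psi$). $\sigma_{\mathrm{pt}}(\mathcal L)=\{\lambda:\ker(\mathcal L-\lambda)\ne\{0\}\}$, and $\sigma_{\mathrm{ess}}(\mathcal L)=\{(\delta\pm i\alpha)-s^2(\beta\pm iD/2):s\in\mathbb R\}$. For $\lambda\notin\sigma_{\mathrm{ess}}(\mathcal L)$ let $\mathbf A_\infty(\lambda)=\begin{bmatrix}\mathbf 0&\mathbf I\\ \mathbf B^{-1}(\lambda\mathbf I-\mathbf N_0)&\mathbf 0\end{bmatrix}$ (which then has no purely imaginary eigenvalues) and $\mathbf Q(\lambda)$ the spectral projection onto its stable subspace (generalized eigenvectors for eigenvalues with negative real part). Let $\mathbf M(x)=\mathbf V(x)|\mathbf M(x)|$ be a polar decomposition ($|\mathbf M|=(\mathbf M^*\mathbf M)^{1/2}$, $\mathbf V$ unitary), and set $\mathbf R_\ell(x)=\begin{bmatrix}\mathbf 0&\mathbf 0\\ -\mathbf B^{-1}\mathbf V(x)|\mathbf M(x)|^{1/2}&\mathbf 0\end{bmatrix}$ (which equals $-\mathbf B^{-1}\mathbf M|\mathbf M|^{-1/2}$ in the lower-left block when $\mathbf M$ is invertible) and $\mathbf R_r(x)=\begin{bmatrix}|\mathbf M(x)|^{1/2}&\mathbf 0\\ \mathbf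 0&\mathbf 0\end{bmatrix}$. The (symmetrized) Birman–Schwinger operator is $\mathcal K(\lambda)=\mathbf R_r\,\mathcal G_A(\lambda)\,\mathbf R_\ell$, where $\mathcal G_A(\lambda)=(-\partial_x+\mathbf A_\infty(\lambda))^{-1}$ is the integral operator on $L^2(\mathbb R,\mathbb C^4)$ with kernel $\mathbf G_A(x-y)$, $\mathbf G_A(x)=-e^{\mathbf A_\infty x}\mathbf Q$ for $x\ge0$ and $\mathbf G_A(x)=e^{\mathbf A_\infty x}(\mathbf I-\mathbf Q)$ for $x<0$. *)

(* Defs.v *)
From HB Require Import structures.
From mathcomp Require Import all_boot all_order all_algebra.
From mathcomp Require Import all_classical all_reals all_analysis.
From mathcomp Require Import complex.
Set Implicit Arguments. Unset Strict Implicit. Unset Printing Implicit Defensive.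
Import Order.TTheory GRing.Theory Num.Theory.
Import numFieldNormedType.Exports.
Local Open Scope classical_set_scope.
Local Open Scope ring_scope.

Section CGLDefs.
Variable R : realType.
Local Notation C := (R[i]).
Local Notation leb := (@lebesgue_measure R).

Definition toC (r : R) : C := Complex r 0.
Definition mxC m n (A : 'M[R]_(m, n)) : 'M[C]_(m, n) := map_mx toC A.

Definition adjmx m n (A : 'M[C]_(m, n)) : 'M[C]_(n, m) := (map_mx (@conjc R) A)^T.
Definition unitary_mx n (V : 'M[C]_n) := adjmx V *m V = 1%:M.
Definition psd_mx n (P : 'M[C]_n) :=
  adjmx P = P /\ forall v : 'cV[C]_n, 0 <= complex.Re ((adjmx v *m P *m v) 0 0).

Definition mx2 (a b c d : R) : 'M[R]_2 :=
  \matrix_(i < 2, j < 2)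
    (if val i == 0%N then (if val j == 0%N then a else b)
     else (if val j == 0%N then c else d)).
Definition vec2 (a b : R) : 'cV[R]_2 :=
  \col_(i < 2) (if val i == 0%N then a else b).

Definition L2 n (f : R -> 'cV[C]_n) : Prop :=
  (forall i, measurable_fun setT (fun x => complex.Re (f x i 0)) /\
             measurable_fun setT (fun x => complex.Im (f x i 0))) /\
  leb.-integrable setT
    (fun x => (\sum_i (complex.Re (f x i 0) ^+ 2 + complex.Im (f x i 0) ^+ 2))%:E).

Definition cint (D : set R) (g : R -> C) : C :=
  Complex (\int[leb]_(x in D) complex.Re (g x)) (\int[leb]_(x in D) complex.Im (g x)).
Definition cvint n (D : set R) (F : R -> 'cV[C]_n) : 'cV[C]_n :=
  \col_i cint D (fun x => F x i 0).

Definition ae_eq n (f g : R -> 'cV[C]_n) : Prop := {ae leb, forall x, f x = g x}.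

Definition expmx n (A : 'M[C]_n) : 'M[C]_n :=
  \matrix_(i, j)
    Complex (limn (fun k => complex.Re ((\sum_(l < k) (l`!%:R)^-1 *: A ^+ l) i j)))
            (limn (fun k => complex.Im ((\sum_(l < k) (l`!%:R)^-1 *: A ^+ l) i j))).

Definition gen_eigvec n (A : 'M[C]_n) (z : C) (w : 'cV[C]_n) : Prop :=
  exists m : nat, (A - z%:M) ^+ m *m w = 0.
Definition in_gen_span n (A : 'M[C]_n) (P : C -> Prop) (v : 'cV[C]_n) : Prop :=
  exists (k : nat) (z : 'I_k -> C) (w : 'I_k -> 'cV[C]_n),
    (forall j, P (z j) /\ gen_eigvec A (z j) (w j)) /\ v = \sum_j w j.
Definition stable_proj n (A : 'M[C]_n) (Q : 'M[C]_n) : Prop :=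
  forall v : 'cV[C]_n,
    in_gen_span A (fun z => complex.Re z < 0) (Q *m v) /\
    in_gen_span A (fun z => 0 < complex.Re z) (v - Q *m v).

Variables (D beta delta alpha eps gam mu nu : R).

Definition Bmx : 'M[R]_2 := mx2 beta (- (D / 2)) (D / 2) beta.
Definition N0mx : 'M[R]_2 := mx2 delta (- alpha) alpha delta.
Definition N1mx : 'M[R]_2 := mx2 eps (- gam) gam eps.
Definition N2mx : 'M[R]_2 := mx2 mu (- nu) nu mu.

Definition in_ess_spec (lam : C) : Prop :=
  exists s : R,
    lam = Complex (delta - s ^+ 2 * beta) (alpha - s ^+ 2 * (D / 2)) \/
    lam = Complex (delta - s ^+ 2 * beta) (- alpha + s ^+ 2 * (D / 2)).

(* the pulse psi = p + i q is a stationary pulse: Psi(t,x) = e^{-i alpha t} psi(x)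
   solves the cubic-quintic CGL equation, i.e. (after dividing by e^{-i alpha t})
   alpha psi + D/2 psi'' + gam|psi|^2 psi + nu|psi|^4 psi
     = i delta psi + i eps |psi|^2 psi + i beta psi'' + i mu |psi|^4 psi *)
Definition stationary_pulse (p q : R -> R) : Prop :=
  (forall x, derivable p x 1 /\ derivable (derive1 p) x 1 /\
             derivable q x 1 /\ derivable (derive1 q) x 1) /\
  forall x,
    let psi := Complex (p x) (q x) in
    let psi2 := Complex (derive1n 2 p x) (derive1n 2 q x) in
    let n2 := p x ^+ 2 + q x ^+ 2 in
    toC alpha * psi + toC (D / 2) * psi2 + toC (gam * n2) * psi
      + toC (nu * n2 ^+ 2) * psi
    = 'i * (toC delta * psi + toC (eps * n2) * psi + toC beta * psi2
            + toC (mu * n2 ^+ 2) * psi).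

Definition Mmx (p q : R -> R) (x : R) : 'M[R]_2 :=
  let v := vec2 (p x) (q x) in
  let n2 := p x ^+ 2 + q x ^+ 2 in
  N1mx * (n2%:M) + N2mx * ((n2 ^+ 2)%:M)
  + (N1mx *+ 2 + N2mx * ((4 * n2)%:M)) *m (v *m v^T).

Definition Ainf (lam : C) : 'M[C]_(2 + 2) :=
  block_mx 0 1%:M (invmx (mxC Bmx) *m (lam%:M - mxC N0mx)) 0.

Definition GA (lam : C) (Q : 'M[C]_(2 + 2)) (x : R) : 'M[C]_(2 + 2) :=
  if 0 <= x then - (expmx (toC x *: Ainf lam) *m Q)
  else expmx (toC x *: Ainf lam) *m (1%:M - Q).

(* R_l(x), R_r(x) built from the polar decomposition M = V |M|, Mh = |M|^{1/2} *)
Definition Rl (V Mh : R -> 'M[C]_2) (x : R) : 'M[C]_(2 + 2) :=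
  block_mx 0 0 (- (invmx (mxC Bmx) *m V x *m Mh x)) 0.
Definition Rr (Mh : R -> 'M[C]_2) (x : R) : 'M[C]_(2 + 2) :=
  block_mx (Mh x) 0 0 0.

Definition Kop (lam : C) (Q : 'M[C]_(2 + 2)) (V Mh : R -> 'M[C]_2)
    (f : R -> 'cV[C]_(2 + 2)) (x : R) : 'cV[C]_(2 + 2) :=
  Rr Mh x *m cvint setT (fun y => GA lam Q (x - y) *m Rl V Mh y *m f y).

(* I + K(lambda) is invertible on L^2(R, C^4) (bijective on a.e.-classes;
   K is bounded, so the inverse is automatically bounded) *)
Definition IpK_invertible (lam : C) Q V Mh : Prop :=
  (forall f, L2 f -> ae_eq (fun x => f x + Kop lam Q V Mh f x) (fun _ => 0) ->
             ae_eq f (fun _ => 0)) /\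
  (forall g, L2 g -> exists f, L2 f /\
             ae_eq (fun x => f x + Kop lam Q V Mh f x) g).

(* u in H^2(R, C^2): u and its weak derivatives u1, u2 are in L^2, with u, u1
   the (locally absolutely continuous) representatives *)
Definition H2 (u u1 u2 : R -> 'cV[C]_2) : Prop :=
  L2 u /\ L2 u1 /\ L2 u2 /\
  (forall a b, a <= b -> u b - u a = cvint `[a, b] u1) /\
  (forall a b, a <= b -> u1 b - u1 a = cvint `[a, b] u2).

Definition in_point_spec (p q : R -> R) (lam : C) : Prop :=
  exists u u1 u2 : R -> 'cV[C]_2,
    H2 u u1 u2 /\ ~ ae_eq u (fun _ => 0) /\
    ae_eq (fun x => mxC Bmx *m u2 x + (mxC N0mx + mxC (Mmx p q x)) *m u x)
          (fun x => lam *: u x).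

End CGLDefs.

(* Main.v *)
(* [A_oo] is diagonalizable with eigenvalues off the imaginary axis, so [G_A] is, in
   diagonal coordinates, the convolution with decaying one-sided exponentials, and
   [w = G_A r] is the unique L^2 solution of [w' = A_oo w - r]. With
   [u] the upper half of [G_A R_l f], the equation [f + K f = 0] says [f = -R_r u] and
   [B u'' + (N0 + M) u = lam u]; this matches the kernels of [1 + K] and [L - lam].
   Surjectivity of [1 + K] without a kernel is the Fredholm alternative for
   [w + G_A N w = G_A r], [N = R_l R_r]. Since [M] vanishes at infinity, the kernel is, up
   to a term of rank [n], a Volterra kernel on a bounded interval plus a small
   exponentially decaying one; that part is a contraction in a weighted sup norm, with an
   L^2 weight satisfying a Harnack inequality, and a Neumann series
   reduces the equation to an [n x n] linear system. *)
Require Import Defs.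
From HB Require Import structures.
From mathcomp Require Import all_boot all_order all_algebra.
From mathcomp Require Import all_classical all_reals all_analysis.
From mathcomp Require Import measurable_realfun complex.
From mathcomp Require Import ring lra.
Set Implicit Arguments. Unset Strict Implicit. Unset Printing Implicit Defensive.
Import Order.TTheory GRing.Theory Num.Theory.
Import numFieldNormedType.Exports.
Local Open Scope classical_set_scope.
Local Open Scope ring_scope.

(** * Complex-valued measurable and integrable functions *)

(** Elements of L^2 are plain functions here, compared up to null sets. Convolution with [G_A]
    supplies preferred representatives: it is defined at every point, satisfies its differential
    equation in integrated form, and does not change when its argument is altered on a null set.
    Equations for [w] can therefore be solved pointwise, while those for [f] are only known almost
    everywhere. A weighted sup norm fits this setting: Neumann iterates converge at each point, the
    limit is measurable as a pointwise limit, and it lies in L^2 because the weight does. The weight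
    has to dominate the datum [G_A r], so it is built anew from each [r]; the contraction factor
    does not depend on it, since only the decay rate and the Harnack inequality enter the estimate.
    The factors of the polar decomposition are arbitrary pointwise choices, so measurability of |M|,
    |M|^(1/2) and V|M|^(1/2) must be extracted from their algebra before any integral involving them
    can be handled. *)

Section ComplexBasics.
Variable R : realType.
Local Notation C := (R[i]).
Local Notation ReC := (@complex.Re R).
Local Notation ImC := (@complex.Im R).

Lemma complex_ext (x y : C) : ReC x = ReC y -> ImC x = ImC y -> x = y.
Proof. by case: x y => [a b] [c d] /= -> ->. Qed.

Lemma cReD (x y : C) : ReC (x + y) = ReC x + ReC y.
Proof. by case: x y => [a b] [c d]. Qed.

Lemma cImD (x y : C) : ImC (x + y) = ImC x + ImC y.
Proof. by case: x y => [a b] [c d]. Qed.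

Lemma cReN (x : C) : ReC (- x) = - ReC x.
Proof. by case: x => [a b]. Qed.

Lemma cImN (x : C) : ImC (- x) = - ImC x.
Proof. by case: x => [a b]. Qed.

Lemma cReM (x y : C) : ReC (x * y) = ReC x * ReC y - ImC x * ImC y.
Proof. by case: x y => [a b] [c d]. Qed.

Lemma cImM (x y : C) : ImC (x * y) = ReC x * ImC y + ImC x * ReC y.
Proof. by case: x y => [a b] [c d]. Qed.

Lemma cRe_sum I (r : seq I) (P : pred I) (F : I -> C) :
  ReC (\sum_(i <- r | P i) F i) = \sum_(i <- r | P i) ReC (F i).
Proof. exact: (big_morph ReC cReD erefl). Qed.

(** Real-valued, submultiplicative, and equivalent to the modulus by [cnorm1_sqr] and [sqr_cnorm1].
    As a sum of two absolute values it splits estimates of an integral into its components. *)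
Definition cnorm1 (z : C) : R := `|ReC z| + `|ImC z|.

Lemma cnorm1_ge0 z : 0 <= cnorm1 z. Proof. exact: addr_ge0. Qed.

Lemma cnorm10 : cnorm1 0 = 0. Proof. by rewrite /cnorm1 /= !normr0 addr0. Qed.

Lemma cnorm1_eq0 z : cnorm1 z <= 0 -> z = 0.
Proof.
rewrite /cnorm1 => h; have := normr_ge0 (ReC z); have := normr_ge0 (ImC z).
by move=> h1 h2; apply: complex_ext; apply/normr0_eq0 => /=; lra.
Qed.

Lemma cnorm1D x y : cnorm1 (x + y) <= cnorm1 x + cnorm1 y.
Proof.
rewrite /cnorm1 cReD cImD.
have := ler_normD (ReC x) (ReC y); have := ler_normD (ImC x) (ImC y).
by move=> h1 h2; lra.
Qed.

Lemma cnorm1N x : cnorm1 (- x) = cnorm1 x.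
Proof. by rewrite /cnorm1 cReN cImN !normrN. Qed.

Lemma cnorm1M x y : cnorm1 (x * y) <= cnorm1 x * cnorm1 y.
Proof.
rewrite /cnorm1 cReM cImM mulrDl !mulrDr -!normrM.
have := ler_normB (ReC x * ReC y) (ImC x * ImC y).
have := ler_normD (ReC x * ImC y) (ImC x * ReC y).
by move=> h1 h2; lra.
Qed.

Lemma cnorm1_sum I (r : seq I) (P : pred I) (F : I -> C) :
  cnorm1 (\sum_(i <- r | P i) F i) <= \sum_(i <- r | P i) cnorm1 (F i).
Proof.
elim/big_rec2: _ => [|i y x _ h]; first by rewrite cnorm10.
by apply: (le_trans (cnorm1D _ _)); rewrite lerD2l.
Qed.

Lemma cnorm1_sqr z : cnorm1 z ^+ 2 <= 2 * (ReC z ^+ 2 + ImC z ^+ 2).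
Proof.
rewrite /cnorm1 -[ReC z ^+ 2]real_normK ?num_real//.
rewrite -[ImC z ^+ 2]real_normK ?num_real//.
by have := sqr_ge0 (`|ReC z| - `|ImC z|); rewrite !expr2; nra.
Qed.

Lemma sqr_cnorm1 z : ReC z ^+ 2 + ImC z ^+ 2 <= cnorm1 z ^+ 2.
Proof.
rewrite /cnorm1 -[ReC z ^+ 2]real_normK ?num_real//.
rewrite -[ImC z ^+ 2]real_normK ?num_real//.
have := normr_ge0 (ReC z); have := normr_ge0 (ImC z).
by rewrite !expr2; nra.
Qed.

Lemma Re_cnorm1 z : `|ReC z| <= cnorm1 z. Proof. by rewrite lerDl. Qed.

Lemma Im_cnorm1 z : `|ImC z| <= cnorm1 z. Proof. by rewrite lerDr. Qed.

Section CMeas.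
Context d (T : measurableType d).
Implicit Types f g : T -> C.

Definition cmeas f := measurable_fun setT (fun x => ReC (f x)) /\
                      measurable_fun setT (fun x => ImC (f x)).

Lemma cmeas_cst (z : C) : cmeas (fun=> z).
Proof. by split; exact: measurable_cst. Qed.

Lemma cmeasD f g : cmeas f -> cmeas g -> cmeas (fun x => f x + g x).
Proof.
move=> [f1 f2] [g1 g2]; split.
  by under eq_fun do rewrite cReD; exact: measurable_funD.
by under eq_fun do rewrite cImD; exact: measurable_funD.
Qed.

Lemma cmeasN f : cmeas f -> cmeas (fun x => - f x).
Proof.
move=> [f1 f2]; split.
  by under eq_fun do rewrite cReN; exact: measurableT_comp.
by under eq_fun do rewrite cImN; exact: measurableT_comp.
Qed.

Lemma cmeasB f g : cmeas f -> cmeas g -> cmeas (fun x => f x - g x).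
Proof. by move=> hf hg; apply: cmeasD => //; exact: cmeasN. Qed.

Lemma cmeasM f g : cmeas f -> cmeas g -> cmeas (fun x => f x * g x).
Proof.
move=> [f1 f2] [g1 g2]; split.
  by under eq_fun do rewrite cReM; apply: measurable_funB; exact: measurable_funM.
by under eq_fun do rewrite cImM; apply: measurable_funD; exact: measurable_funM.
Qed.

Lemma cmeas_sum I (r : seq I) (F : I -> T -> C) :
  (forall i, cmeas (F i)) -> cmeas (fun x => \sum_(i <- r) F i x).
Proof.
move=> h; elim: r => [|i r ih].
  by under eq_fun do rewrite big_nil; exact: cmeas_cst.
by under eq_fun do rewrite big_cons; exact: cmeasD.
Qed.

Lemma cmeas_toC (f : T -> R) : measurable_fun setT f -> cmeas (fun x => toC (f x)).
Proof. by move=> mf; split => //=; exact: measurable_cst. Qed.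

Lemma cmeas_cnorm1 f : cmeas f -> measurable_fun setT (fun x => cnorm1 (f x)).
Proof.
by move=> [f1 f2]; apply: measurable_funD; exact: measurableT_comp.
Qed.

Lemma cmeas_if (b : T -> bool) f g : measurable_fun setT b ->
  cmeas f -> cmeas g -> cmeas (fun x => if b x then f x else g x).
Proof.
move=> mb [f1 f2] [g1 g2]; split.
  by under eq_fun do rewrite fun_if; exact: measurable_fun_ifT.
by under eq_fun do rewrite fun_if; exact: measurable_fun_ifT.
Qed.
End CMeas.

Lemma cmeas_comp d1 d2 (T1 : measurableType d1) (T2 : measurableType d2)
  (f : T2 -> C) (g : T1 -> T2) : cmeas f -> measurable_fun setT g ->
  cmeas (fun x => f (g x)).
Proof. by move=> [f1 f2] mg; split; [exact: measurableT_comp f1 mg|exact: measurableT_comp f2 mg]. Qed.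

Local Notation leb := (@lebesgue_measure R).
Implicit Types D : set R.

Definition cinteg D (f : R -> C) :=
  leb.-integrable D (fun x => (ReC (f x))%:E) /\ leb.-integrable D (fun x => (ImC (f x))%:E).

Lemma cinteg_le D (f : R -> C) (g : R -> R) : measurable D -> cmeas f ->
  leb.-integrable D (fun x => (g x)%:E) -> (forall x, D x -> cnorm1 (f x) <= g x) ->
  cinteg D f.
Proof.
move=> mD [f1 f2] ig fg; split; (apply: le_integrable ig => //;
 [by apply/measurable_EFinP; exact: measurable_funTS |]) => x Dx /=; rewrite lee_fin.
  by rewrite (le_trans (Re_cnorm1 _))// (le_trans (fg _ Dx))// ler_norm.
by rewrite (le_trans (Im_cnorm1 _))// (le_trans (fg _ Dx))// ler_norm.
Qed.

Lemma cinteg_cnorm1 D f : measurable D -> cinteg D f ->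
  leb.-integrable D (fun x => (cnorm1 (f x))%:E).
Proof.
move=> mD [f1 f2]; apply: (@eq_integrable _ _ _ leb D mD (fun x => `|(ReC (f x))%:E| + `|(ImC (f x))%:E|)%E) => //.
by apply: integrableD => //; exact: integrable_abse.
Qed.

Lemma cintegD D f g : measurable D -> cinteg D f -> cinteg D g -> cinteg D (fun x => f x + g x).
Proof.
move=> mD [f1 f2] [g1 g2]; split.
  by under eq_fun do rewrite cReD EFinD; exact: integrableD.
by under eq_fun do rewrite cImD EFinD; exact: integrableD.
Qed.

Lemma cintegZ D f z : measurable D -> cinteg D f -> cinteg D (fun x => z * f x).
Proof.
move=> mD [f1 f2]; split.
  under eq_fun do rewrite cReM EFinB !EFinM.
  by apply: integrableB => //; exact: integrableZl.
under eq_fun do rewrite cImM EFinD !EFinM.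
by apply: integrableD => //; exact: integrableZl.
Qed.

Lemma cintegB D f g : measurable D -> cinteg D f -> cinteg D g -> cinteg D (fun x => f x - g x).
Proof.
move=> mD hf hg; apply: cintegD => //.
by under eq_fun do rewrite -mulN1r; exact: cintegZ.
Qed.

Lemma cinteg0 D : cinteg D (fun=> 0).
Proof. by split; exact: integrable0. Qed.

Lemma cinteg_sum D I (r : seq I) (F : I -> R -> C) : measurable D ->
  (forall i, cinteg D (F i)) -> cinteg D (fun x => \sum_(i <- r) F i x).
Proof.
move=> mD h; elim: r => [|i r ih].
  by under eq_fun do rewrite big_nil; exact: cinteg0.
by under eq_fun do rewrite big_cons; exact: cintegD.
Qed.

Lemma cintegS (E D : set R) f : measurable E -> measurable D -> D `<=` E ->
  cinteg E f -> cinteg D f.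
Proof. by move=> mE mD DE [h1 h2]; split; exact: (@integrableS _ _ _ leb _ _ _ mE mD DE). Qed.

Lemma eq_cint D (f g : R -> C) : (forall x, D x -> f x = g x) -> cint D f = cint D g.
Proof.
move=> fg; rewrite /cint; congr Complex; apply: eq_Rintegral => x.
  by rewrite inE => /fg ->.
by rewrite inE => /fg ->.
Qed.

Lemma cint0 D : cint D (fun=> 0 : C) = 0.
Proof.
by rewrite /cint /Rintegral /= integral0.
Qed.

Lemma cintD D f g : measurable D -> cinteg D f -> cinteg D g ->
  cint D (fun x => f x + g x) = cint D f + cint D g.
Proof.
move=> mD [f1 f2] [g1 g2]; apply: complex_ext => /=.
  rewrite -RintegralD//; apply: eq_Rintegral => x _; exact: cReD.
rewrite -RintegralD//; apply: eq_Rintegral => x _; exact: cImD.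
Qed.

Lemma cintZ D f z : measurable D -> cinteg D f ->
  cint D (fun x => z * f x) = z * cint D f.
Proof.
move=> mD [f1 f2].
have i1 r : leb.-integrable D (EFin \o (fun x => r * ReC (f x))).
  by rewrite /comp; under eq_fun do rewrite EFinM; exact: integrableZl.
have i2 r : leb.-integrable D (EFin \o (fun x => r * ImC (f x))).
  by rewrite /comp; under eq_fun do rewrite EFinM; exact: integrableZl.
apply: complex_ext; rewrite ?cReM ?cImM /=.
  rewrite -!RintegralZl// -RintegralB//; apply: eq_Rintegral => x _; exact: cReM.
rewrite -!RintegralZl// -RintegralD//; apply: eq_Rintegral => x _; exact: cImM.
Qed.

Lemma cintN D f : measurable D -> cinteg D f -> cint D (fun x => - f x) = - cint D f.
Proof.
move=> mD hf; rewrite -mulN1r -cintZ//; apply: eq_cint => x _.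
by rewrite mulN1r.
Qed.

Lemma cintB D f g : measurable D -> cinteg D f -> cinteg D g ->
  cint D (fun x => f x - g x) = cint D f - cint D g.
Proof.
move=> mD hf hg; rewrite -cintN// -cintD//.
by under eq_fun do rewrite -mulN1r; exact: cintegZ.
Qed.

Lemma cint_sum D I (r : seq I) (F : I -> R -> C) : measurable D ->
  (forall i, cinteg D (F i)) ->
  cint D (fun x => \sum_(i <- r) F i x) = \sum_(i <- r) cint D (F i).
Proof.
move=> mD h; elim: r => [|i r ih].
  by under eq_fun do rewrite big_nil; rewrite big_nil cint0.
under eq_fun do rewrite big_cons.
by rewrite big_cons cintD// ?ih//; exact: cinteg_sum.
Qed.

Lemma cnorm1_cint D f (g : R -> R) : measurable D -> cinteg D f ->
  leb.-integrable D (fun x => (g x)%:E) -> (forall x, D x -> cnorm1 (f x) <= g x) ->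
  cnorm1 (cint D f) <= \int[leb]_(x in D) g x.
Proof.
move=> mD hf ig fg; rewrite /cnorm1 /=.
have [f1 f2] := hf.
apply: (@le_trans _ _ (\int[leb]_(x in D) `|ReC (f x)| + \int[leb]_(x in D) `|ImC (f x)|)).
  by apply: lerD; exact: le_normr_Rintegral.
rewrite -RintegralD//; last 2 first.
  exact: (integrable_norm f1).
  exact: (integrable_norm f2).
apply: le_Rintegral => //.
exact: (cinteg_cnorm1 mD hf).
Qed.

(** Moves a variable domain of integration into the integrand, where Fubini on the whole plane can
    reach it. *)
Lemma cint_mkcond D (f : R -> C) : cint D f = cint setT (fun x => if `[<D x>] then f x else 0).
Proof.
rewrite /cint; congr Complex; rewrite Rintegral_mkcond; apply: eq_Rintegral => x _;
by rewrite patchE; have [h|h] := asboolP (D x); [rewrite mem_set|rewrite memNset].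
Qed.

Lemma cint_ae D (f g : R -> C) : measurable D -> cmeas f -> cmeas g ->
  {ae leb, forall x, f x = g x} -> cint D f = cint D g.
Proof.
move=> mD [f1 f2] [g1 g2] fg; rewrite /cint /Rintegral; congr (Complex (fine _) (fine _));
  (apply: ae_eq_integral => //;
    [by apply/measurable_EFinP; exact: measurable_funTS
    |by apply/measurable_EFinP; exact: measurable_funTS |]);
  by apply: (@filterS _ _ (ae_filter_ringOfSetsType leb) _ _ _ fg) => x /= -> _.
Qed.
End ComplexBasics.

(** * Exponential kernels and majorants *)

Section ExpIntegrals.
Variable R : realType.
Local Notation leb := (@lebesgue_measure R).
Implicit Types (f F : R -> R) (a b x y : R).

Lemma is_derive_continuous f F : (forall x, is_derive x 1 F (f x)) -> continuous F.
Proof.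
move=> dF x; apply/differentiable_continuous/derivable1_diffP.
by have [] := dF x.
Qed.

Lemma continuous_integrable_itv f a b : continuous f ->
  leb.-integrable `[a, b] (EFin \o f).
Proof.
move=> cf; apply: continuous_compact_integrable; first exact: segment_compact.
exact: continuous_subspaceT.
Qed.

Lemma Rintegral_FTC2 f F a b : a <= b -> (forall x, is_derive x 1 F (f x)) ->
  continuous f -> \int[leb]_(x in `[a, b]) f x = F b - F a.
Proof.
rewrite le_eqVlt => /predU1P[<- _ _|ab dF cf].
  by rewrite set_itv1 Rintegral_set1 subrr.
have cF := is_derive_continuous dF.
rewrite /Rintegral (@continuous_FTC2 _ f F)//.
- exact: continuous_subspaceT.
- split; first by move=> x _; have [] := dF x.
    exact/cvg_at_right_filter/cF.
  exact/cvg_at_left_filter/cF.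
- by move=> x _; rewrite derive1E; exact: derive_val.
Qed.

Lemma integral_expR_half a x : 0 < a ->
  (\int[leb]_(y in `[x, +oo[) (expR (- a * (y - x)))%:E = (a^-1)%:E)%E.
Proof.
move=> a0.
have dF (y : R) : is_derive y 1 (fun y => - a^-1 * expR (- a * (y - x))) (expR (- a * (y - x))).
  apply: is_derive_eq; rewrite /GRing.scale/=.
  by field; rewrite gt_eqF.
have cF := is_derive_continuous dF.
have cf : continuous (fun y => expR (- a * (y - x))).
  apply: (@is_derive_continuous (fun y => - a * expR (- a * (y - x)))) => y.
  by apply: is_derive_eq; rewrite /GRing.scale/=; ring.
rewrite (@ge0_continuous_FTC2y _ _ (fun y => - a^-1 * expR (- a * (y - x))) x 0).
- by rewrite subrr mulr0 expR0 mulr1 -EFinB sub0r opprK.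
- by move=> *; exact: expR_ge0.
- exact: continuous_subspaceT.
- rewrite -[X in _ --> X](mulr0 (- a^-1)); apply: cvgMr.
  under eq_fun do rewrite mulNr.
  apply: (@cvg_comp _ _ _ (fun y => a * (y - x)) (fun z => expR (- z)) _ (pinfty_nbhs R)); last exact: cvgr_expR.
  apply/cvgryPge => A; near=> y.
  by rewrite mulrC -ler_pdivrMr// lerBrDr; near: y; apply: nbhs_pinfty_ge; exact: num_real.
- by move=> y _; have [] := dF y.
- exact/cvg_at_right_filter/cF.
- by move=> y _; rewrite derive1E; exact: derive_val.
Unshelve. all: by end_near. Qed.

Lemma measurable_expR_dist a x : measurable_fun setT (fun y : R => expR (- a * `|x - y|)).
Proof.
apply: measurableT_comp => //; apply: measurable_funM => //.
by apply: measurableT_comp => //; exact: measurable_funB.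
Qed.

Lemma integral_expR_dist a x : 0 < a ->
  (\int[leb]_y (expR (- a * `|x - y|))%:E <= (2 / a)%:E)%E.
Proof.
move=> a0.
have mf : measurable_fun setT (fun y : R => (expR (- a * `|x - y|))%:E).
  by apply/measurable_EFinP; exact: measurable_expR_dist.
have g0 y : (0 <= (expR (- a * `|x - y|))%:E)%E by rewrite lee_fin expR_ge0.
rewrite -(setUv `]-oo, x]%classic) ge0_integral_setU//=; last 3 first.
- exact: measurableC.
- by rewrite setUv.
- exact/disj_setPCl.
rewrite setCitvl/= -[X in (2 / X)]mulr1 (_ : (2 / (a * 1)) = a^-1 + a^-1); last by field; rewrite gt_eqF.
rewrite EFinD; apply: leeD.
  rewrite -{1}(opprK x) ge0_integration_by_substitutionNy; last 2 first.
  - rewrite opprK; apply: continuous_subspaceT => y.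
    apply: continuous_comp; last exact: continuous_expR.
    by apply: cvgMr; apply: cvg_norm; apply: cvgB; [exact: cvg_cst|exact: cvg_id].
  - by move=> y _; rewrite expR_ge0.
  rewrite -(integral_expR_half (- x) a0) le_eqVlt; apply/orP; left; apply/eqP.
  apply: eq_integral => y; rewrite inE/= in_itv/= andbT => xy.
  by rewrite ger0_norm ?opprK; [congr (expR _)%:E; ring|lra].
rewrite -(integral_expR_half x a0) integral_itv_obnd_cbnd; last exact: measurable_funTS.
rewrite le_eqVlt; apply/orP; left; apply/eqP.
apply: eq_integral => y; rewrite inE/= in_itv/= andbT => xy.
by rewrite distrC ger0_norm// subr_ge0.
Qed.

Lemma integrable_expR_dist a x : 0 < a ->
  leb.-integrable setT (fun y => (expR (- a * `|x - y|))%:E).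
Proof.
move=> a0; apply/integrableP; split.
  by apply/measurable_EFinP; exact: measurable_expR_dist.
rewrite (le_lt_trans _ (ltry (2 / a)))//.
under eq_integral do rewrite gee0_abs ?lee_fin ?expR_ge0//.
exact: integral_expR_dist.
Qed.

Lemma Rintegral_expR_dist a x : 0 < a ->
  \int[leb]_y (expR (- a * `|x - y|)) <= 2 / a.
Proof.
move=> a0; rewrite -lee_fin fineK; first exact: integral_expR_dist.
apply: integrable_fin_num => //; exact: integrable_expR_dist.
Qed.

End ExpIntegrals.

(** * Square-integrable weights with a Harnack inequality *)

Section Majorant.
Variable R : realType.
Local Notation leb := (@lebesgue_measure R).

(** Tonelli measurability is applied to the positive and negative parts separately; sections with a
    non-finite integral receive the default value of [fine], which keeps measurability. *)
Lemma measurable_Rintegral_snd (k : R * R -> R) : measurable_fun setT k ->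
  measurable_fun setT (fun x => \int[leb]_y k (x, y)).
Proof.
move=> mk; rewrite /Rintegral; apply: measurableT_comp => //.
rewrite (_ : (fun x => _) = (fun x => \int[leb]_y ((EFin \o k)^\+ (x, y))%E -
   \int[leb]_y ((EFin \o k)^\- (x, y)))%E); last first.
  apply/funext => x; rewrite integralE.
  by congr (_ - _)%E; apply: eq_integral => y _; rewrite !unlock.
have mk' : measurable_fun setT (EFin \o k) by apply/measurable_EFinP.
apply: emeasurable_funB.
  apply: (measurable_fun_fubini_tonelli_F (m2 := leb) ((EFin \o k)^\+)%E) => //.
  exact: measurable_funepos.
apply: (measurable_fun_fubini_tonelli_F (m2 := leb) ((EFin \o k)^\-)%E) => //.
exact: measurable_funeneg.
Qed.

Variables (c : R) (rho : R -> R).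
Hypotheses (c0 : 0 < c) (mrho : measurable_fun setT rho) (rho0 : forall x, 0 <= rho x).
Hypothesis irho : leb.-integrable setT (fun x => (rho x ^+ 2)%:E).

Let ker (x y : R) := expR (- c * `|x - y|).

Let ker_le1 x y : ker x y <= 1.
Proof. by rewrite -expR0 ler_expR mulNr oppr_le0 mulr_ge0// ltW. Qed.

Let mker2 : measurable_fun setT (fun p : R * R => ker p.1 p.2).
Proof.
apply: measurableT_comp => //; apply: measurable_funM => //.
apply: measurableT_comp => //; apply: measurable_funB.
  exact: measurable_fst.
exact: measurable_snd.
Qed.

Let iker_rho2 x : leb.-integrable setT (fun y => (ker x y * rho y ^+ 2)%:E).
Proof.
apply: (le_integrable _ _ _ irho) => //.
  apply/measurable_EFinP; apply: measurable_funM; first exact: measurable_expR_dist.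
  exact: measurable_funX.
move=> y _; rewrite lee_fin !ger0_norm ?mulr_ge0 ?sqr_ge0 ?expR_ge0//.
by rewrite ler_piMl ?sqr_ge0.
Qed.

Let iker_rho x : leb.-integrable setT (fun y => (ker x y * rho y)%:E).
Proof.
apply: (le_integrable _ _ _ (integrableD _ (integrable_expR_dist x c0) irho)) => //.
  apply/measurable_EFinP; apply: measurable_funM => //; exact: measurable_expR_dist.
move=> y _; rewrite -EFinD !abse_EFin lee_fin (ger0_norm (mulr_ge0 (expR_ge0 _) (rho0 y))).
rewrite (ger0_norm (addr_ge0 (expR_ge0 _) (sqr_ge0 _))) -/(ker x y); have := ker_le1 x y; have : 0 <= ker x y by exact: expR_ge0.
by have := rho0 y; move: (ker x y) (rho y) => e r; rewrite expr2; nra.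
Qed.

Let H0 x := \int[leb]_y (ker x y * rho y).

Let H0_ge0 x : 0 <= H0 x.
Proof. by apply: Rintegral_ge0 => y _; rewrite mulr_ge0// expR_ge0. Qed.

Let mH0 : measurable_fun setT H0.
Proof.
apply: (@measurable_Rintegral_snd (fun p => ker p.1 p.2 * rho p.2)).
apply: measurable_funM => //; apply: measurableT_comp => //; exact: measurable_snd.
Qed.

(** Cauchy-Schwarz in quadratic form: integrate [ker x y * (t - rho y) ^+ 2 >= 0] in [y]. The value
    of [t] maximizes [2 * t * H0 x - t ^+ 2 * (2 / c)]. *)
Let H0_sqr x : H0 x ^+ 2 <= 2 / c * \int[leb]_y (ker x y * rho y ^+ 2).
Proof.
set J := \int[leb]_y _.
pose t := H0 x * c / 2.
have iker := integrable_expR_dist x c0.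
have h : 2 * t * H0 x <= t ^+ 2 * (2 / c) + J.
  apply: (@le_trans _ _ (t ^+ 2 * \int[leb]_y ker x y + J)); last first.
    by rewrite lerD2r ler_wpM2l ?sqr_ge0//; exact: Rintegral_expR_dist.
  have -> : 2 * t * H0 x = \int[leb]_y (2 * t * (ker x y * rho y)) by rewrite RintegralZl//; exact: iker_rho.
  have -> : t ^+ 2 * \int[leb]_y ker x y = \int[leb]_y (t ^+ 2 * ker x y) by rewrite RintegralZl//; exact: iker.
  rewrite /J -RintegralD//; last 2 first.
  - exact: (integrableZl measurableT (t ^+ 2) iker).
  - exact: iker_rho2.
  apply: le_Rintegral => //; first exact: (integrableZl measurableT (2 * t) (iker_rho x)).
    exact: (integrableD measurableT (integrableZl measurableT (t ^+ 2) iker) (iker_rho2 x)).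
  move=> y _; have : 0 <= ker x y by exact: expR_ge0.
  move=> k0; rewrite -subr_ge0 (_ : _ - _ = ker x y * (t - rho y) ^+ 2); last by ring.
  by rewrite mulr_ge0// sqr_ge0.
have e1 : 2 * t * H0 x = c * H0 x ^+ 2 by rewrite /t; field.
have e2 : t ^+ 2 * (2 / c) = c / 2 * H0 x ^+ 2 by rewrite /t; field; rewrite gt_eqF.
rewrite e1 e2 in h.
rewrite mulrAC ler_pdivlMr// mulrC; lra.
Qed.

(** Schur's test: after [H0_sqr], Tonelli exchanges the integrals, and the kernel has mass at most
    [2 / c] in either variable. *)
Let iH0 : leb.-integrable setT (fun x => (H0 x ^+ 2)%:E).
Proof.
apply/integrableP; split; first by apply/measurable_EFinP; exact: measurable_funX.
have c20 : 0 <= 2 / c by rewrite divr_ge0// ltW.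
have mf : measurable_fun setT (fun p : R * R => (ker p.1 p.2 * rho p.2 ^+ 2)%:E).
  apply/measurable_EFinP; apply: measurable_funM => //.
  by apply: measurable_funX; apply: measurableT_comp => //; exact: measurable_snd.
have f0 (p : R * R) : (0 <= (ker p.1 p.2 * rho p.2 ^+ 2)%:E)%E.
  by rewrite lee_fin mulr_ge0 ?sqr_ge0 ?expR_ge0.
apply: (@le_lt_trans _ _ (\int[leb]_x ((2 / c)%:E * \int[leb]_y (ker x y * rho y ^+ 2)%:E))%E).
  apply: ge0_le_integral => //.
  - apply: measurableT_comp => //; apply/measurable_EFinP; exact: measurable_funX.
  - apply: measurable_funeM; exact: (measurable_fun_fubini_tonelli_F (m2 := leb) _ mf f0).
  - move=> x _; rewrite gee0_abs ?lee_fin ?sqr_ge0//.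
    by rewrite -[X in (_ * X)%E]fineK ?integrable_fin_num// -EFinM lee_fin; exact: H0_sqr.
rewrite ge0_integralZl//; last 2 first.
- exact: (measurable_fun_fubini_tonelli_F (m2 := leb) _ mf f0).
- by move=> x _; apply: integral_ge0 => y _; exact: (f0 (x, y)).
apply: lte_mul_pinfty => //.
rewrite (fubini_tonelli (m1 := leb) (m2 := leb) _ mf f0)/=.
apply: (@le_lt_trans _ _ (\int[leb]_y ((2 / c)%:E * (rho y ^+ 2)%:E))%E).
  apply: ge0_le_integral => //.
  - by move=> y _; apply: integral_ge0 => x _; exact: (f0 (x, y)).
  - exact: (measurable_fun_fubini_tonelli_G (m1 := leb) _ mf f0).
  - by apply: measurable_funeM; apply/measurable_EFinP; exact: measurable_funX.
  - move=> y _.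
    under eq_integral do rewrite mulrC EFinM /ker distrC.
    rewrite ge0_integralZl//; last 2 first.
    + by apply/measurable_EFinP; exact: measurable_expR_dist.
    + by rewrite lee_fin sqr_ge0.
    by rewrite muleC; apply: lee_wpmul2r; rewrite ?lee_fin ?sqr_ge0//; exact: integral_expR_dist.
rewrite integralZl//; apply: lte_mul_pinfty => //.
exact: integrable_lty.
Qed.

(* [H] is the convolution of [rho] with the exponential, made positive; its Harnack
   inequality [H y <= e^(c|x-y|) H x] makes it a weight for exponentially decaying kernels. *)
Lemma exp_majorant : exists H : R -> R,
  [/\ measurable_fun setT H,
      leb.-integrable setT (fun x => (H x ^+ 2)%:E),
      forall x, expR (- c * `|x|) <= H x,
      forall x y, H y <= expR (c * `|x - y|) * H x &
      forall x, leb.-integrable setT (fun y => (expR (- c * `|x - y|) * rho y)%:E) /\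
        \int[leb]_y (expR (- c * `|x - y|) * rho y) <= H x].
Proof.
have mE : measurable_fun setT (fun x : R => expR (- c * `|x|)).
  by apply: measurableT_comp => //; apply: measurable_funM => //; exact: measurableT_comp.
have tri x y z : ker y z <= expR (c * `|x - y|) * ker x z.
  rewrite -expRD ler_expR.
  by have := ler_wpM2l (ltW c0) (ler_distD y x z); lra.
(* The second summand also dominates Green functions centred at a fixed point, which are the data of
   the finite-rank correction in the Fredholm argument. *)
exists (fun x => H0 x + expR (- c * `|x|)); split.
- exact: measurable_funD.
- have ic2 : 0 < c * 2 by rewrite mulr_gt0.
  have ie : leb.-integrable setT (fun x => (expR (- (c * 2) * `|0 - x|))%:E) := integrable_expR_dist 0 ic2.
  apply: (le_integrable _ _ _ (integrableD _ (integrableZl _ 2 iH0) (integrableZl _ 2 ie))) => //.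
    by apply/measurable_EFinP; apply: measurable_funX; exact: measurable_funD.
  move=> x _; rewrite -!EFinM -EFinD !abse_EFin lee_fin.
  rewrite (ger0_norm (sqr_ge0 _)) [X in _ <= X]ger0_norm; last first.
    by rewrite addr_ge0 ?mulr_ge0 ?sqr_ge0 ?expR_ge0.
  rewrite sub0r normrN (_ : expR (- (c * 2) * _) = expR (- c * `|x|) ^+ 2); last first.
    by rewrite -expRM_natl; congr expR; ring.
  by have := sqr_ge0 (H0 x - expR (- c * `|x|)); rewrite !expr2; lra.
- by move=> x; rewrite lerDr.
- move=> x y; rewrite mulrDr; apply: lerD.
    rewrite /H0 -RintegralZl//; last exact: iker_rho.
    apply: le_Rintegral => //; first exact: iker_rho.
      exact: (integrableZl measurableT _ (iker_rho x)).
    by move=> z _; rewrite mulrA ler_wpM2r.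
  by have := tri x y 0; rewrite /ker !subr0.
- move=> x; split; first exact: iker_rho.
  by rewrite lerDl expR_ge0.
Qed.
End Majorant.

(** * The complex exponential and the scalar Green function *)

Section CExp.
Variable R : realType.
Local Notation C := (R[i]).
Local Notation ReC := (@complex.Re R).
Local Notation ImC := (@complex.Im R).
Local Notation leb := (@lebesgue_measure R).
Implicit Types (m : C) (s t : R).

Lemma cRe_toCM (r : R) (z : C) : ReC (toC r * z) = r * ReC z.
Proof. by rewrite cReM /= mul0r subr0. Qed.

Definition cexp m t : C :=
  Complex (expR (ReC m * t) * cos (ImC m * t)) (expR (ReC m * t) * sin (ImC m * t)).

Lemma cexp0 m : cexp m 0 = 1.
Proof. by rewrite /cexp !mulr0 expR0 cos0 sin0 mulr1 mulr0. Qed.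

Lemma cexpD m s t : cexp m (s + t) = cexp m s * cexp m t.
Proof.
rewrite /cexp !mulrDr expRD cosD sinD.
by apply: complex_ext; rewrite ?cReM ?cImM /=; ring.
Qed.

(** Bridges two conventions: [expmx] exponentiates the matrix scaled by the time, the Green function
    evaluates at that time. *)
Lemma cexpZ m s : cexp (toC s * m) 1 = cexp m s.
Proof.
case: m => a b; rewrite /cexp /toC !mulr1 cReM cImM /= !mul0r subr0 addr0.
by rewrite (mulrC s a) (mulrC s b).
Qed.

Lemma cnorm1_cexp m t : cnorm1 (cexp m t) <= 2 * expR (ReC m * t).
Proof.
rewrite /cnorm1 /= !normrM (ger0_norm (expR_ge0 _)).
have := cos_max (ImC m * t); have := sin_max (ImC m * t).
by have := expR_ge0 (ReC m * t); nra.
Qed.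

Lemma is_derive_Re_cexp m t : is_derive t 1 (fun t => ReC (cexp m t)) (ReC (m * cexp m t)).
Proof.
rewrite cReM /=; apply: is_derive_eq; rewrite /GRing.scale /=; ring.
Qed.

Lemma is_derive_Im_cexp m t : is_derive t 1 (fun t => ImC (cexp m t)) (ImC (m * cexp m t)).
Proof.
rewrite cImM /=; apply: is_derive_eq; rewrite /GRing.scale /=; ring.
Qed.

Lemma continuous_Re_cexp m : continuous (fun t => ReC (cexp m t)).
Proof. exact: (is_derive_continuous (is_derive_Re_cexp m)). Qed.

Lemma continuous_Im_cexp m : continuous (fun t => ImC (cexp m t)).
Proof. exact: (is_derive_continuous (is_derive_Im_cexp m)). Qed.

Lemma cmeas_cexp m : cmeas (cexp m).
Proof.
by split; apply: continuous_measurable_fun; [exact: continuous_Re_cexp|exact: continuous_Im_cexp].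
Qed.

Lemma cinteg_cexp m a b : cinteg `[a, b] (cexp m).
Proof.
by split; apply: continuous_integrable_itv; [exact: continuous_Re_cexp|exact: continuous_Im_cexp].
Qed.

Lemma cint_cexp m a b : a <= b -> cint `[a, b] (fun t => m * cexp m t) = cexp m b - cexp m a.
Proof.
move=> ab; apply: complex_ext; rewrite ?cReD ?cImD ?cReN ?cImN {1}/cint.
  rewrite [LHS](_ : _ = \int[leb]_(x in `[a, b]) ReC (m * cexp m x))//.
  apply: (Rintegral_FTC2 (F := fun t => ReC (cexp m t))) => //.
    exact: is_derive_Re_cexp.
  move=> t; under eq_fun do rewrite cReM.
  by apply: cvgB; apply: cvgMr; [exact: continuous_Re_cexp|exact: continuous_Im_cexp].
rewrite [LHS](_ : _ = \int[leb]_(x in `[a, b]) ImC (m * cexp m x))//.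
apply: (Rintegral_FTC2 (F := fun t => ImC (cexp m t))) => //.
  exact: is_derive_Im_cexp.
move=> t; under eq_fun do rewrite cImM.
by apply: cvgD; apply: cvgMr; [exact: continuous_Im_cexp|exact: continuous_Re_cexp].
Qed.

Definition cexp_sum m n t : C := \sum_(l < n) toC (t ^+ l / l`!%:R) * m ^+ l.

Lemma is_derive_powM n (k s : R) :
  is_derive s 1 (fun s : R => s ^+ n.+1 * k) (n.+1%:R * s ^+ n * k).
Proof.
have h := is_deriveZ k (is_deriveX n.+1 (is_derive_id s (1 : R))).
rewrite (_ : (fun s : R => _) = k \*: (id ^+ n.+1)); last first.
  by apply/funext => u; rewrite /= mulrC; congr (_ * _); rewrite exprfctE.
by move: h; congr is_derive; rewrite /GRing.scale /=; ring.
Qed.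

(** The factor [w] lets real-valued calculus handle both components: [w = 1] reads off the real part
    and [w = -i] the imaginary part. Differentiation replaces [w] by [w * m] and drops one term of
    the sum, so the family is closed. *)
Lemma is_derive_cexp_sum w m n t :
  is_derive t 1 (fun t => ReC (w * cexp_sum m n.+1 t)) (ReC (w * (m * cexp_sum m n t))).
Proof.
have -> : (fun t => ReC (w * cexp_sum m n.+1 t)) =
    (fun t => ReC w + \sum_(l < n) (t ^+ l.+1 * (l.+1`!%:R^-1 * ReC (w * m ^+ l.+1)))).
  apply/funext => s; rewrite /cexp_sum mulr_sumr cRe_sum big_ord_recl; congr (_ + _).
    by rewrite mulrCA cRe_toCM !expr0 fact0 divr1 mulr1 mul1r.
  by apply: eq_bigr => l _; rewrite mulrCA cRe_toCM mulrA.
have -> : ReC (w * (m * cexp_sum m n t)) =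
    \sum_(l < n) (l.+1%:R * t ^+ l) * (l.+1`!%:R^-1 * ReC (w * m ^+ l.+1)).
  rewrite !mulr_sumr cRe_sum; apply: eq_bigr => l _.
  rewrite (mulrCA m) -exprS mulrCA cRe_toCM factS natrM.
  have h1 : (l`!%:R : R) != 0 by rewrite pnatr_eq0 -lt0n fact_gt0.
  have h2 : (l.+1%:R : R) != 0 by rewrite pnatr_eq0.
  by rewrite invfM mulrA (mulrACA l.+1%:R) divff// mul1r.
have h (l : 'I_n) : is_derive t 1 (fun t : R => t ^+ l.+1 * (l.+1`!%:R^-1 * ReC (w * m ^+ l.+1)))
    (l.+1%:R * t ^+ l * (l.+1`!%:R^-1 * ReC (w * m ^+ l.+1))).
  exact: is_derive_powM.
rewrite -[X in is_derive _ _ _ X]add0r.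
apply: is_deriveD.
rewrite (_ : (fun t => _) = \sum_(l < n) (fun t : R => t ^+ l.+1 * (l.+1`!%:R^-1 * ReC (w * m ^+ l.+1)))); last first.
  by apply/funext => s; rewrite fct_sumE.
exact: is_derive_sum.
Qed.

Lemma continuous_cexp_sum w m n : continuous (fun t => ReC (w * cexp_sum m n t)).
Proof.
case: n => [|n]; last exact: (is_derive_continuous (is_derive_cexp_sum w m n)).
by under eq_fun do rewrite /cexp_sum big_ord0; exact: cst_continuous.
Qed.

Lemma is_derive_Re_mul_cexp w m t :
  is_derive t 1 (fun t => ReC (w * cexp m t)) (ReC (w * (m * cexp m t))).
Proof.
rewrite (_ : (fun t => _) = (fun t => ReC w * ReC (cexp m t) - ImC w * ImC (cexp m t))); last first.
  by apply/funext => s; rewrite cReM.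
rewrite cReM; have h1 := is_derive_Re_cexp m t; have h2 := is_derive_Im_cexp m t.
by apply: is_derive_eq; rewrite /GRing.scale /=; ring.
Qed.

Definition cexp_rem m n t := cexp m t - cexp_sum m n t.

Lemma is_derive_cexp_rem w m n t :
  is_derive t 1 (fun t => ReC (w * cexp_rem m n.+1 t)) (ReC (w * (m * cexp_rem m n t))).
Proof.
rewrite (_ : (fun t => _) = (fun t => ReC (w * cexp m t) - ReC (w * cexp_sum m n.+1 t))); last first.
  by apply/funext => s; rewrite mulrBr cReD cReN.
rewrite mulrBr mulrBr cReD cReN; have h1 := is_derive_Re_mul_cexp w m t; have h2 := is_derive_cexp_sum w m n t.
exact: is_deriveB.
Qed.

(** Integrating once from 0 raises the order of vanishing there by one; this is the inductive step
    of Taylor's estimate. *)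
Lemma le_Rintegral_pow (f g : R -> R) (K : R) n t : 0 <= t ->
  (forall s, is_derive s 1 f (g s)) -> continuous g -> f 0 = 0 ->
  (forall s, 0 <= s <= t -> `|g s| <= K * (s ^+ n / n`!%:R)) ->
  `|f t| <= K * (t ^+ n.+1 / n.+1`!%:R).
Proof.
move=> t0 df cg f0 gK.
pose G (s : R) := s ^+ n.+1 * (n.+1`!%:R^-1 * K).
have dG (s : R) : is_derive s 1 G (K * (s ^+ n / n`!%:R)).
  have := is_derive_powM n (n.+1`!%:R^-1 * K) s; congr is_derive; rewrite factS natrM.
  have h1 : (n`!%:R : R) != 0 by rewrite pnatr_eq0 -lt0n fact_gt0.
  have h2 : (n.+1%:R : R) != 0 by rewrite pnatr_eq0.
  by field; apply/andP.
have cG : continuous (fun s : R => K * (s ^+ n / n`!%:R)).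
  move=> s; apply: cvgMr; apply: cvgMl; exact: exprn_continuous.
have -> : f t = \int[leb]_(s in `[0, t]) g s by rewrite (Rintegral_FTC2 t0 df cg) f0 subr0.
have -> : K * (t ^+ n.+1 / n.+1`!%:R) = \int[leb]_(s in `[0, t]) (K * (s ^+ n / n`!%:R)).
  by rewrite (Rintegral_FTC2 t0 dG cG) /G expr0n mul0r subr0; ring.
have ig := continuous_integrable_itv 0 t cg.
apply: (le_trans (le_normr_Rintegral _ ig)) => //.
apply: le_Rintegral => //; first exact: (integrable_norm ig).
  exact: continuous_integrable_itv.
Qed.

Lemma cexp_sum0 m n : cexp_sum m n.+1 0 = 1.
Proof.
rewrite /cexp_sum big_ord_recl big1 => [|l _]; last first.
  by rewrite /= expr0n /= mul0r; exact: mul0r.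
by rewrite addr0 !expr0 fact0 divr1 mulr1.
Qed.

Lemma ReC_le_cnorm1 w z : cnorm1 w <= 1 -> `|ReC (w * z)| <= cnorm1 z.
Proof.
move=> w1; apply: (le_trans (Re_cnorm1 _)); apply: (le_trans (cnorm1M _ _)).
by rewrite ler_piMl ?cnorm1_ge0.
Qed.

(** Induction on the number of terms, since the derivative of a remainder is [m] times the preceding
    one. Real and imaginary parts each contribute one copy of the bound at every step, hence the 2
    in [2 * cnorm1 m]. *)
Lemma cexp_rem_bound m n t w : 0 <= t <= 1 -> cnorm1 w <= 1 ->
  `|ReC (w * cexp_rem m n t)| <= 2 * expR `|ReC m| * (2 * cnorm1 m) ^+ n * (t ^+ n / n`!%:R).
Proof.
elim: n t w => [t w /andP[t0 t1] w1|n ih t w /andP[t0 t1] w1].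
  rewrite expr0 fact0 !divr1 !mulr1 (le_trans (ReC_le_cnorm1 _ w1))//.
  rewrite /cexp_rem /cexp_sum big_ord0 subr0 (le_trans (cnorm1_cexp _ _))//.
  rewrite ler_wpM2l// ler_expR (le_trans (ler_norm _))// normrM (ger0_norm t0).
  by rewrite ler_piMr.
apply: (@le_Rintegral_pow (fun s => ReC (w * cexp_rem m n.+1 s)) (fun s => ReC (w * (m * cexp_rem m n s)))) => //.
- exact: is_derive_cexp_rem.
- move=> s; rewrite (_ : (fun s => _) =
    (fun s => ReC ((w * m) * cexp m s) - ReC ((w * m) * cexp_sum m n s))); last first.
    by apply/funext => u; rewrite mulrA mulrBr cReD cReN.
  have c1 := is_derive_continuous (is_derive_Re_mul_cexp (w * m) m).
  exact: (cvgB (c1 s) (@continuous_cexp_sum (w * m) m n s)).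
- by rewrite /cexp_rem cexp0 cexp_sum0 subrr mulr0.
- move=> s /andP[s0 st]; have s1 : 0 <= s <= 1 by rewrite s0 (le_trans st).
  rewrite (le_trans (ReC_le_cnorm1 _ w1))// (le_trans (cnorm1M _ _))//.
  have h1 : `|ReC (cexp_rem m n s)| <= 2 * expR `|ReC m| * (2 * cnorm1 m) ^+ n * (s ^+ n / n`!%:R).
    rewrite -[X in ReC X]mul1r; apply: ih => //.
    by rewrite /cnorm1 /= normr1 normr0 addr0.
  have h2 : `|ImC (cexp_rem m n s)| <= 2 * expR `|ReC m| * (2 * cnorm1 m) ^+ n * (s ^+ n / n`!%:R).
    have -> : ImC (cexp_rem m n s) = ReC (Complex 0 (-1) * cexp_rem m n s).
      by rewrite cReM /= mul0r sub0r mulN1r opprK.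
    by apply: ih => //; rewrite /cnorm1 /= normrN normr1 normr0 add0r.
  rewrite exprS; have := cnorm1_ge0 m; rewrite [X in _ * X <= _]/cnorm1.
  move: (2 * expR `|ReC m|) (s ^+ n / n`!%:R) (cnorm1 m) h1 h2 => A D c h1 h2 c0.
  move: ((2 * c) ^+ n) h1 h2 => B h1 h2.
  rewrite (_ : A * (2 * c * B) * D = c * (A * B * D + A * B * D)); last by ring.
  by rewrite ler_wpM2l// lerD.
Qed.

(** The remainder bound at [t = 1] is a multiple of a term of a convergent real exponential series.
    [expmx] is a limit of partial sums, so this is how it becomes computable. *)
Lemma cvg_cexp_sum_Re w m : cnorm1 w <= 1 ->
  ReC (w * cexp_sum m n 1) @[n --> \oo] --> ReC (w * cexp m 1).
Proof.
move=> w1; set K := 2 * expR `|ReC m|; set c := 2 * cnorm1 m.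
have h : K * (c ^+ n / n`!%:R) @[n --> \oo] --> (0 : R).
  rewrite -[X in _ --> X](mulr0 K); apply: cvgMr.
  exact: (cvg_series_cvg_0 (is_cvg_series_exp_coeff c)).
apply/cvgrPdist_le => e e0.
move/cvgrPdist_le : h => /(_ e e0); apply: filterS => n.
rewrite sub0r normrN => h; rewrite -cReN -cReD -mulrN -mulrDr.
apply: (le_trans _ (le_trans (ler_norm _) h)).
have := @cexp_rem_bound m n 1 w _ w1; rewrite ler01 lexx expr1n mul1r -/K -/c mulrA.
exact.
Qed.
End CExp.

(** * The scalar Green function and its jump *)

Section Kernel.
Variable R : realType.
Local Notation C := (R[i]).
Local Notation ReC := (@complex.Re R).
Local Notation ImC := (@complex.Im R).
Local Notation leb := (@lebesgue_measure R).
Implicit Types (m : C) (s t : R).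

(* The kernel of [(m - d/dt)^-1] on L^2, written so that it visibly differs from the
   Volterra kernel [-1_(t >= 0) e^(mt)] by a multiple of [e^(mt)]. *)
Definition green m t : C :=
  (if 0 < ReC m then cexp m t else 0) - (if 0 <= t then cexp m t else 0).

Lemma greenE m t : ReC m != 0 -> green m t =
  if 0 <= t then (if ReC m < 0 then - cexp m t else 0)
  else (if ReC m < 0 then 0 else cexp m t).
Proof.
move=> m0; rewrite /green; case: (ltrgtP (ReC m) 0) m0 => // hm _;
  by case: ifP => _; rewrite ?sub0r ?subr0 ?subrr// oppr0.
Qed.

Lemma cnorm1_green m c t : 0 < c <= `|ReC m| -> cnorm1 (green m t) <= 2 * expR (- c * `|t|).
Proof.
move=> /andP[c0 cm]; have m0 : ReC m != 0 by rewrite -normr_gt0 (lt_le_trans c0).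
have e0 (r : R) : 0 <= 2 * expR r by rewrite mulr_ge0 ?expR_ge0.
have mono r s : r <= s -> 2 * expR r <= 2 * expR s by move=> rs; rewrite ler_wpM2l// ler_expR.
rewrite greenE//; case: ifPn => [t0|]; last rewrite -ltNge => t0.
  case: ifPn => [hm|_]; last by rewrite cnorm10.
  rewrite cnorm1N (le_trans (cnorm1_cexp _ _))// mono// ger0_norm//.
  by rewrite ltr0_norm// in cm; nra.
case: ifPn => [_|]; first by rewrite cnorm10.
rewrite -leNgt => hm; rewrite (le_trans (cnorm1_cexp _ _))// mono// ltr0_norm//.
by rewrite ger0_norm// in cm; nra.
Qed.

Lemma cmeas_green m : cmeas (green m).
Proof.
apply: cmeasB; first by case: (0 < ReC m); [exact: cmeas_cexp|exact: cmeas_cst].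
apply: cmeas_if; [exact: measurable_fun_ler|exact: cmeas_cexp|exact: cmeas_cst].
Qed.

Lemma cint_cexp_shift m y a b : a <= b ->
  cint `[a, b] (fun x => m * cexp m (x - y)) = cexp m (b - y) - cexp m (a - y).
Proof.
move=> ab; under eq_cint => x _ do rewrite cexpD (mulrC (cexp m _)) mulrCA.
rewrite cintZ//; last by apply: cintegZ => //; exact: cinteg_cexp.
by rewrite cint_cexp// mulrBr !(mulrC (cexp m (- y))) -!cexpD.
Qed.

Lemma cmeas_shift (f : R -> C) (y : R) : cmeas f -> cmeas (fun x : R => f (x - y)).
Proof. by move=> mf; apply: (cmeas_comp mf); exact: measurable_funB. Qed.

Lemma cinteg_cexp_shift m y a b : cinteg `[a, b] (fun x => cexp m (x - y)).
Proof.
rewrite (_ : (fun x => _) = (fun x => cexp m (- y) * cexp m x)); last first.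
  by apply/funext => x; rewrite cexpD mulrC.
by apply: cintegZ => //; exact: cinteg_cexp.
Qed.

Let hstep m t : C := if 0 <= t then cexp m t else 0.

Let cmeas_hstep m : cmeas (hstep m).
Proof. apply: cmeas_if; [exact: measurable_fun_ler|exact: cmeas_cexp|exact: cmeas_cst]. Qed.

Let cinteg_hstep m y a b : cinteg `[a, b] (fun x => hstep m (x - y)).
Proof.
have := cinteg_cnorm1 _ (cinteg_cexp_shift m y a b) => /(_ (measurable_itv _)) h.
apply: (cinteg_le _ _ h) => //; first exact: cmeas_shift.
by move=> x _; rewrite /hstep; case: ifP => // _; rewrite cnorm10 cnorm1_ge0.
Qed.

(** Integrated form of the derivative of a truncated exponential: it is [m] times the function plus
    a unit mass at [y]. As the step includes its endpoint, the mass is seen exactly when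
    [a < y <= b]. *)
Let cint_hstep m y a b : a <= b ->
  cint `[a, b] (fun x => m * hstep m (x - y)) =
  hstep m (b - y) - hstep m (a - y) - (if a < y <= b then 1 else 0).
Proof.
move=> ab; rewrite {2 3}/hstep !subr_ge0.
have [ya|ay] := leP y a.
  rewrite (le_trans ya ab) /= subr0 -cint_cexp_shift//.
  apply: eq_cint => x /=; rewrite in_itv/= => /andP[ax _].
  by rewrite /hstep subr_ge0 (le_trans ya).
have [yb|yb] := leP y b; last first.
  rewrite /= !subr0 -[RHS](@cint0 R `[a, b]); apply: eq_cint => x /=.
  rewrite in_itv/= => /andP[_ xb]; rewrite /hstep subr_ge0 leNgt (le_lt_trans xb)//.
  by rewrite mulr0.
transitivity (cint `[y, b] (fun x => m * cexp m (x - y))); last first.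
  by rewrite cint_cexp_shift// subrr cexp0 /= subr0.
rewrite cint_mkcond [RHS]cint_mkcond; apply: eq_cint => x _.
rewrite /= !in_itv /= /hstep subr_ge0.
case: asboolP => [/andP[ax xb]|xab]; case: asboolP => [/andP[yx xb']|yxb] //.
- by rewrite yx.
- case: ifPn => yx; last by rewrite mulr0.
  by exfalso; apply: yxb; rewrite yx xb.
- by exfalso; apply: xab; rewrite xb' (le_trans (ltW ay)).
Qed.

Lemma cinteg_green m y a b : cinteg `[a, b] (fun x => green m (x - y)).
Proof.
rewrite /green; apply: cintegB => //; last exact: cinteg_hstep.
by case: (0 < ReC m); [exact: cinteg_cexp_shift|exact: cinteg0].
Qed.

(** Integrated form of [green' = m * green - delta]; the purely exponential part of [green] is
    smooth, so the jump comes from the step alone. *)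
Lemma cint_green m y a b : a <= b ->
  cint `[a, b] (fun x => m * green m (x - y)) =
  green m (b - y) - green m (a - y) + (if a < y <= b then 1 else 0).
Proof.
move=> ab; under eq_cint => x _ do rewrite mulrBr.
rewrite cintB//; last 2 first.
- apply: cintegZ => //.
  by case: (0 < ReC m); [exact: cinteg_cexp_shift|exact: cinteg0].
- by apply: cintegZ => //; exact: cinteg_hstep.
rewrite cint_hstep// /green -/(hstep m (b - y)) -/(hstep m (a - y)).
move: (cint_cexp_shift m y ab).
move: (hstep m (b - y)) (hstep m (a - y)) (if a < y <= b then 1 else 0) => u v w.
case: (0 < ReC m) => [->|_]; first by move: (cexp m _) (cexp m _) => s t; ring.
by under eq_cint do rewrite mulr0; rewrite cint0; ring.
Qed.

Lemma Rintegral_Fubini (k : R * R -> R) : measurable_fun setT k ->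
  (\int[leb]_x \int[leb]_y `|(k (x, y))%:E| < +oo)%E ->
  (forall x, leb.-integrable setT (fun y => (k (x, y))%:E)) ->
  (forall y, leb.-integrable setT (fun x => (k (x, y))%:E)) ->
  \int[leb]_x \int[leb]_y k (x, y) = \int[leb]_y \int[leb]_x k (x, y).
Proof.
move=> mk fk i1 i2.
have mk' : measurable_fun setT (EFin \o k) by apply/measurable_EFinP.
have ik := (integrable12ltyP leb leb mk').2 fk.
have := Fubini ik => /= h.
rewrite /Rintegral.
under eq_integral do rewrite fineK ?integrable_fin_num//.
under [in RHS]eq_integral do rewrite fineK ?integrable_fin_num//.
by congr fine.
Qed.

Lemma cint_Fubini (k : R * R -> C) (g : R * R -> R) : cmeas k -> measurable_fun setT g ->
  (forall p, cnorm1 (k p) <= g p) ->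
  (\int[leb]_x \int[leb]_y (g (x, y))%:E < +oo)%E ->
  (forall x, cinteg setT (fun y => k (x, y))) ->
  (forall y, cinteg setT (fun x => k (x, y))) ->
  cint setT (fun x => cint setT (fun y => k (x, y))) =
  cint setT (fun y => cint setT (fun x => k (x, y))).
Proof.
move=> [mk1 mk2] mg kg fg i1 i2.
have fin (h : R * R -> R) : measurable_fun setT h -> (forall p, `|h p| <= g p) ->
    (\int[leb]_x \int[leb]_y `|(h (x, y))%:E| < +oo)%E.
  move=> mh hg; apply: le_lt_trans fg.
  have mh' : measurable_fun setT (fun p => `|(h p)%:E|%E).
    by apply: measurableT_comp => //; exact/measurable_EFinP.
  have mg' : measurable_fun setT (fun p => (g p)%:E) by exact/measurable_EFinP.
  have g0 (p : R * R) : (0 <= (g p)%:E)%E by rewrite lee_fin (le_trans _ (hg p)).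
  apply: ge0_le_integral => //.
  - by move=> x _; exact: integral_ge0.
  - exact: (measurable_fun_fubini_tonelli_F (m2 := leb) _ mh').
  - exact: (measurable_fun_fubini_tonelli_F (m2 := leb) _ mg' g0).
  - move=> x _; apply: ge0_le_integral => //.
    + exact: (measurableT_comp mh' (measurable_pair1 x)).
    + exact: (measurableT_comp mg' (measurable_pair1 x)).
    + by move=> y _; rewrite lee_fin.
have h1 p : `|ReC (k p)| <= g p := le_trans (Re_cnorm1 _) (kg p).
have h2 p : `|ImC (k p)| <= g p := le_trans (Im_cnorm1 _) (kg p).
have e1 := Rintegral_Fubini mk1 (fin _ mk1 h1) (fun x => (i1 x).1) (fun y => (i2 y).1).
have e2 := Rintegral_Fubini mk2 (fin _ mk2 h2) (fun x => (i1 x).2) (fun y => (i2 y).2).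
apply: complex_ext.
  exact: e1.
exact: e2.
Qed.
End Kernel.

(** * Convolution with the scalar Green function *)

Section Conv.
Variable R : realType.
Local Notation C := (R[i]).
Local Notation ReC := (@complex.Re R).
Local Notation ImC := (@complex.Im R).
Local Notation leb := (@lebesgue_measure R).

Lemma asbool_itvcc (a b x : R) : `[< [set` `[a, b]] x >] = (a <= x <= b).
Proof. by apply/asboolP/idP; rewrite /= in_itv. Qed.

Lemma cinteg_mkcond (D : set R) (f : R -> C) : measurable D -> cinteg D f ->
  cinteg setT (fun x => if `[< D x >] then f x else 0).
Proof.
move=> mD [f1 f2]; split.
  have := (integrable_mkcond (mu := leb) _ mD).1 f1; congr (leb.-integrable _ _).
  by apply/funext => x; rewrite patchE; case: (asboolP (D x)) => h; [rewrite mem_set|rewrite memNset].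
have := (integrable_mkcond (mu := leb) _ mD).1 f2; congr (leb.-integrable _ _).
by apply/funext => x; rewrite patchE; case: (asboolP (D x)) => h; [rewrite mem_set|rewrite memNset].
Qed.

Definition sconv (m : C) (r : R -> C) (x : R) : C :=
  cint setT (fun y => green m (x - y) * r y).

Lemma cmeas_cint_snd (k : R * R -> C) : cmeas k ->
  cmeas (fun x => cint setT (fun y => k (x, y))).
Proof.
move=> [k1 k2]; split.
  exact: (measurable_Rintegral_snd k1).
exact: (measurable_Rintegral_snd k2).
Qed.

Lemma cmeas_green_dist m : cmeas (fun p : R * R => green m (p.1 - p.2)).
Proof.
apply: (cmeas_comp (cmeas_green m)); apply: measurable_funB.
  exact: measurable_fst.
exact: measurable_snd.
Qed.

Lemma cmeas_snd (r : R -> C) : cmeas r -> cmeas (fun p : R * R => r p.2).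
Proof. by move=> mr; apply: (cmeas_comp mr); exact: measurable_snd. Qed.

Lemma cmeas_fst (r : R -> C) : cmeas r -> cmeas (fun p : R * R => r p.1).
Proof. by move=> mr; apply: (cmeas_comp mr); exact: measurable_fst. Qed.

Lemma cmeas_sconv m r : cmeas r -> cmeas (sconv m r).
Proof.
move=> mr; apply: (@cmeas_cint_snd (fun p => green m (p.1 - p.2) * r p.2)).
by apply: cmeasM; [exact: cmeas_green_dist|exact: cmeas_snd].
Qed.

Section Dominated.
Variables (m : C) (c : R) (r : R -> C) (rho H : R -> R).
Hypotheses (hc : 0 < c <= `|ReC m|) (mr : cmeas r).
Hypothesis (r_rho : forall x, cnorm1 (r x) <= rho x).
Hypothesis (mrho : measurable_fun setT rho).
Hypothesis (Hharnack : forall x y, H y <= expR (c * `|x - y|) * H x).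
Hypothesis (irho : forall x,
  leb.-integrable setT (fun y => (expR (- c * `|x - y|) * rho y)%:E) /\
  \int[leb]_y (expR (- c * `|x - y|) * rho y) <= H x).

Let rho0 x : 0 <= rho x. Proof. exact: le_trans (cnorm1_ge0 _) (r_rho x). Qed.

Let c0 : 0 < c. Proof. by case/andP: hc. Qed.

Let mgreen_r (x : R) : cmeas (fun y : R => green m (x - y) * r y).
Proof.
by apply: cmeasM => //; apply: (cmeas_comp (cmeas_green m)); exact: measurable_funB.
Qed.

Let green_r_le x y : cnorm1 (green m (x - y) * r y) <= 2 * (expR (- c * `|x - y|) * rho y).
Proof.
rewrite (le_trans (cnorm1M _ _))// mulrA ler_pM ?cnorm1_ge0//.
exact: cnorm1_green.
Qed.

Lemma cinteg_sconv x : cinteg setT (fun y => green m (x - y) * r y).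
Proof.
apply: (cinteg_le _ (mgreen_r x) (g := fun y => 2 * (expR (- c * `|x - y|) * rho y))) => //.
exact: (integrableZl measurableT 2 (irho x).1).
Qed.

Lemma cnorm1_sconv x : cnorm1 (sconv m r x) <= 2 * H x.
Proof.
have i2 := integrableZl measurableT 2 (irho x).1.
apply: (le_trans (cnorm1_cint measurableT (cinteg_sconv x) i2 _)).
  by move=> y _; exact: green_r_le.
by rewrite RintegralZl ?ler_wpM2l//; case: (irho x).
Qed.

Let H0 x : 0 <= H x.
Proof.
apply: le_trans (irho x).2; apply: Rintegral_ge0 => y _.
by rewrite mulr_ge0 ?expR_ge0.
Qed.

(** On a bounded interval the exponential weight centred at [a] is bounded below, so weighted
    integrability gives local integrability. *)
Lemma cinteg_itv_dominated a b : cinteg `[a, b] r.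
Proof.
have i1 : leb.-integrable `[a, b] (fun y => (expR (- c * `|a - y|) * rho y)%:E).
  by apply: (@integrableS _ _ _ leb setT) => //; case: (irho a).
apply: (cinteg_le _ mr (integrableZl _ (expR (c * (b - a))) i1)) => // y /=.
rewrite in_itv/= => /andP[ay yb]; rewrite (le_trans (r_rho y))// mulrA -expRD.
by rewrite ler_peMl// -expR0 ler_expR distrC ger0_norm ?subr_ge0//; have := c0; nra.
Qed.

(** The equation [w' = m w - r] for [w = green * r]. It is stated in integrated form because [r]
    need not be continuous; Fubini moves the integration in [x] onto the kernel, where [cint_green]
    applies. *)
Lemma sconv_sub a b : a <= b ->
  sconv m r b - sconv m r a = cint `[a, b] (fun x => m * sconv m r x - r x).
Proof.
move=> ab.
pose k (p : R * R) : C := if a <= p.1 <= b then m * (green m (p.1 - p.2) * r p.2) else 0.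
pose g (p : R * R) : R :=
  if a <= p.1 <= b then cnorm1 m * (2 * (expR (- c * `|p.1 - p.2|) * rho p.2)) else 0.
have mb : measurable_fun setT (fun p : R * R => a <= p.1 <= b).
  by apply: measurable_and; apply: measurable_fun_ler => //; exact: measurable_fst.
have mk : cmeas k.
  apply: (cmeas_if mb _ (@cmeas_cst R _ _ 0)).
  by apply: (cmeasM (@cmeas_cst R _ _ m)); apply: cmeasM; [exact: cmeas_green_dist|exact: cmeas_snd].
have mg : measurable_fun setT g.
  apply: measurable_fun_ifT => //.
  apply: measurable_funM => //; apply: measurable_funM => //; apply: measurable_funM.
    apply: measurableT_comp => //; apply: measurable_funM => //.
    apply: measurableT_comp => //; apply: measurable_funB; [exact: measurable_fst|exact: measurable_snd].
  by apply: measurableT_comp => //; exact: measurable_snd.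
have kg p : cnorm1 (k p) <= g p.
  rewrite /k /g; case: ifP => _; last by rewrite cnorm10.
  by rewrite (le_trans (cnorm1M _ _))// ler_wpM2l// cnorm1_ge0.
have g0 p : 0 <= g p by exact: le_trans (cnorm1_ge0 _) (kg p).
(* Uniform bound of the inner integral for [x] in [a, b]: Harnack gives
   [H x <= expR (c * (b - a)) * H a]. *)
pose K0 := cnorm1 m * (2 * (expR (c * (b - a)) * H a)).
have gfin : (\int[leb]_x \int[leb]_y (g (x, y))%:E < +oo)%E.
  have i0 := integrableZl measurableT K0 (@integrable_indic_itv R a b true false).
  apply: le_lt_trans (integrable_lty measurableT i0).
  apply: ge0_le_integral => //.
  - by move=> x _; apply: integral_ge0 => y _; rewrite lee_fin.
  - by apply: (measurable_fun_fubini_tonelli_F (m2 := leb) (fun p => (g p)%:E)) => //; exact/measurable_EFinP.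
  - exact: measurable_int i0.
  - move=> x _ /=; rewrite /g /= indicE.
    case: (boolP (a <= x <= b)) => xab; last first.
      by rewrite integral0 memNset ?mule0//= in_itv/=; exact/negP.
    rewrite mem_set ?mule1//=.
    have i2 := integrableZl measurableT (cnorm1 m * 2) (irho x).1.
    under eq_integral do rewrite mulrA EFinM.
    rewrite integralZl//; last by case: (irho x).
    rewrite -[X in (_ * X)%E]fineK; last by apply: integrable_fin_num => //; case: (irho x).
    rewrite -EFinM lee_fin /K0 mulrA ler_wpM2l// ?mulr_ge0 ?cnorm1_ge0//.
    apply: (le_trans (irho x).2); apply: (le_trans (Hharnack a x)).
    rewrite ler_wpM2r// ler_expR; case/andP: xab => ax xb.
    by rewrite ler_wpM2l ?(ltW c0)// distrC ger0_norm ?subr_ge0// lerB.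
have i1 x : cinteg setT (fun y => k (x, y)).
  rewrite /k /=; case: (a <= x <= b); last exact: cinteg0.
  by apply: cintegZ => //; exact: cinteg_sconv.
have i2 y : cinteg setT (fun x => k (x, y)).
  have h : cinteg `[a, b] (fun x => m * (green m (x - y) * r y)).
    apply: cintegZ => //.
    rewrite (_ : (fun x => _) = (fun x => r y * green m (x - y))); last first.
      by apply/funext => x; rewrite mulrC.
    by apply: cintegZ => //; exact: cinteg_green.
  have := cinteg_mkcond (measurable_itv _) h; congr (cinteg _ _).
  by apply/funext => x; rewrite asbool_itvcc.
have isconv : cinteg `[a, b] (sconv m r).
  apply: (@cinteg_le _ _ _ (fun=> 2 * (expR (c * (b - a)) * H a))) => //.
  - exact: cmeas_sconv.
  - exact: (continuous_integrable_itv a b (@cst_continuous _ _ (2 * (expR (c * (b - a)) * H a)))).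
  - move=> x /=; rewrite in_itv/= => /andP[ax xb].
    rewrite (le_trans (cnorm1_sconv x))// ler_wpM2l// (le_trans (Hharnack a x))//.
    rewrite ler_wpM2r// ler_expR.
    by rewrite ler_wpM2l ?(ltW c0)// distrC ger0_norm ?subr_ge0// lerB.
have ir := cinteg_itv_dominated a b.
rewrite cintB//; last exact: cintegZ.
have -> : cint `[a, b] (fun x => m * sconv m r x) =
    cint setT (fun x => cint setT (fun y => k (x, y))).
  rewrite cint_mkcond; apply: eq_cint => x _; rewrite asbool_itvcc /k /=.
  case: (a <= x <= b); last by rewrite cint0.
  by rewrite cintZ//; exact: cinteg_sconv.
rewrite (cint_Fubini mk mg kg gfin i1 i2).
(* The first two terms integrate to the increment of [sconv]; the jump term integrates to the
   integral of [r] over ]a, b], which cancels against the one subtracted. *)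
have e y : cint setT (fun x => k (x, y)) =
    green m (b - y) * r y - green m (a - y) * r y + (if a < y <= b then r y else 0).
  rewrite -mulrBl.
  transitivity (cint `[a, b] (fun x => r y * (m * green m (x - y)))).
    rewrite [RHS]cint_mkcond; apply: eq_cint => x _; rewrite asbool_itvcc /k /=.
    by case: (a <= x <= b) => //; rewrite mulrA mulrC.
  rewrite cintZ//; last by apply: cintegZ => //; exact: cinteg_green.
  rewrite cint_green// mulrDr mulrC; congr (_ + _).
  by case: ifP => _; rewrite ?mulr1 ?mulr0.
under [X in _ = X - _]eq_cint => y _ do rewrite e.
have oc y : `[< [set` `]a, b]] y >] = (a < y <= b) by apply/asboolP/idP; rewrite /= in_itv.
have ioc : cinteg setT (fun y => if a < y <= b then r y else 0).
  have h : cinteg `]a, b] r.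
    apply: cintegS ir => // y /=; rewrite !in_itv/= => /andP[ay ->].
    by rewrite (ltW ay).
  have := cinteg_mkcond (measurable_itv _) h; congr (cinteg _ _).
  by apply/funext => x; rewrite oc.
rewrite cintD//; last by apply: cintegB => //; exact: cinteg_sconv.
rewrite cintB//; try exact: cinteg_sconv.
rewrite (_ : cint setT (fun y => if a < y <= b then r y else 0) = cint `[a, b] r) ?addrK//.
transitivity (cint `]a, b] r).
  by rewrite [RHS]cint_mkcond; apply: eq_cint => y _; rewrite oc.
have [r1 r2] := ir.
by rewrite /cint !Rintegral_itv_obnd_cbnd//; apply: (@integrableS _ _ _ leb `[a, b]) => //;
  move=> y /=; rewrite !in_itv/= => /andP[ay ->]; rewrite (ltW ay).
Qed.
End Dominated.

(** * No nonzero L^2 solution of the homogeneous equation *)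

Section Uniqueness.
Variables (m : C) (z : R -> C).
Hypothesis (mz : cmeas z).
Hypothesis (iz : leb.-integrable setT (fun x => (cnorm1 (z x) ^+ 2)%:E)).
Hypothesis (zE : forall a b, a <= b -> z b - z a = cint `[a, b] (fun x => m * z x)).

Let iz_itv a b : cinteg `[a, b] z.
Proof.
have i1 : leb.-integrable `[a, b] (fun x : R => (1 : R)%:E).
  exact: (continuous_integrable_itv a b (@cst_continuous _ _ (1 : R))).
have i2 : leb.-integrable `[a, b] (fun x => (cnorm1 (z x) ^+ 2)%:E).
  exact: (@integrableS _ _ _ leb setT).
apply: (cinteg_le _ mz (integrableD _ i1 i2)) => // x _.
by have := sqr_ge0 (cnorm1 (z x) - 1); have := cnorm1_ge0 (z x); rewrite !expr2; lra.
Qed.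

Let e (t : R) := cexp (- m) t.

Let eE a b : a <= b -> cint `[a, b] (fun t => m * e t) = e a - e b.
Proof.
move=> ab; rewrite -opprB -(cint_cexp (- m) ab) -cintN//; last first.
  by apply: cintegZ => //; exact: cinteg_cexp.
by apply: eq_cint => t _; rewrite mulNr opprK.
Qed.

Let e_bound a b t : a <= t <= b -> cnorm1 (e t) <= 2 * expR (`|ReC m| * (`|a| + `|b|)).
Proof.
move=> /andP[at_ tb]; rewrite (le_trans (cnorm1_cexp _ _))// ler_wpM2l// ler_expR.
rewrite (le_trans (ler_norm _))// normrM cReN normrN ler_wpM2l//.
have [t0|t0] := leP 0 t.
  have := ler_norm b; have := normr_ge0 a; rewrite ger0_norm//; lra.
have := ler_norm (- a); rewrite normrN; have := normr_ge0 b; rewrite ltr0_norm//; lra.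
Qed.

(** Only an integral equation is known for [z], so Fubini replaces the product rule. Integrating
    [(m * e t) * (m * z x)] over the triangle [a <= x <= t <= b] in both orders produces the same
    integral of [m * e * z] twice; what remains after cancelling it is the claim. *)
Let ez_const a b : a <= b -> e b * z b = e a * z a.
Proof.
move=> ab.
pose K := 2 * expR (`|ReC m| * (`|a| + `|b|)).
pose k (p : R * R) : C := if a <= p.1 <= p.2 then
  (if p.2 <= b then (m * e p.2) * (m * z p.1) else 0) else 0.
pose g (p : R * R) : R := if a <= p.1 <= b then
  (if a <= p.2 <= b then (cnorm1 m * K) * (cnorm1 m * cnorm1 (z p.1)) else 0) else 0.
have K0 : 0 <= K by rewrite mulr_ge0 ?expR_ge0.
have m1 : measurable_fun setT (@fst R R) by exact: measurable_fst.
have m2 : measurable_fun setT (@snd R R) by exact: measurable_snd.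
have mk : cmeas k.
  apply: (cmeas_if _ _ (@cmeas_cst R _ _ 0)).
    by apply: measurable_and; exact: measurable_fun_ler.
  apply: (cmeas_if _ _ (@cmeas_cst R _ _ 0)); first exact: measurable_fun_ler.
  apply: cmeasM; apply: (cmeasM (@cmeas_cst R _ _ m)).
    exact: (cmeas_comp (cmeas_cexp (- m))).
  exact: cmeas_fst.
have mzn : measurable_fun setT (fun p : R * R => cnorm1 (z p.1)).
  exact: (cmeas_cnorm1 (cmeas_fst mz)).
have mg : measurable_fun setT g.
  apply: measurable_fun_ifT => //; first by apply: measurable_and; exact: measurable_fun_ler.
  apply: measurable_fun_ifT => //; first by apply: measurable_and; exact: measurable_fun_ler.
  by apply: measurable_funM => //; apply: measurable_funM.
have kg p : cnorm1 (k p) <= g p.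
  rewrite /k /g; case: p => x t /=.
  have [ax|xa] := leP a x => /=; last by rewrite cnorm10.
  have [xt|tx] := leP x t => /=; last first.
    rewrite cnorm10; case: ifP => // _; case: ifP => // _.
    by rewrite !mulr_ge0 ?cnorm1_ge0.
  have [tb|bt] := leP t b; last first.
    rewrite cnorm10; case: ifP => // _; case: ifP => // _.
    by rewrite !mulr_ge0 ?cnorm1_ge0.
  rewrite (le_trans xt tb) (le_trans ax xt) /=.
  rewrite (le_trans (cnorm1M _ _))// ler_pM ?cnorm1_ge0// ?cnorm1M//.
  rewrite (le_trans (cnorm1M _ _))// ler_wpM2l ?cnorm1_ge0//.
  by apply: e_bound; rewrite tb (le_trans ax xt).
have izn := cinteg_cnorm1 (measurable_itv _) (iz_itv a b).
have gfin : (\int[leb]_x \int[leb]_y (g (x, y))%:E < +oo)%E.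
  have i0 : leb.-integrable setT (fun x => (if a <= x <= b then cnorm1 m * K * (cnorm1 m * cnorm1 (z x)) * (b - a) else 0)%:E).
    have h : leb.-integrable `[a, b] (fun x => (cnorm1 m * K * (cnorm1 m * cnorm1 (z x)) * (b - a))%:E).
      have h : leb.-integrable `[a, b]
          (fun x => ((cnorm1 m * K * cnorm1 m * (b - a))%:E * (cnorm1 (z x))%:E)%E).
        by apply: integrableZl => //; exact: measurable_itv.
      by move: h; congr (leb.-integrable _ _); apply/funext => x; rewrite -EFinM; congr EFin; ring.
    have := (integrable_mkcond (mu := leb) _ (measurable_itv _)).1 h; congr (leb.-integrable _ _).
    by apply/funext => x; rewrite patchE mem_setE in_itv/=; case: ifP.
  apply: le_lt_trans (integrable_lty measurableT i0).
  rewrite le_eqVlt; apply/orP; left; apply/eqP; apply: eq_integral => x _.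
  rewrite /g /=; case: (a <= x <= b); last by rewrite integral0.
  rewrite (_ : (fun y => _) = (EFin \o (fun=> cnorm1 m * K * (cnorm1 m * cnorm1 (z x)))) \_ `[a, b]); last first.
    by apply/funext => y; rewrite patchE mem_setE in_itv/=; case: ifP.
  rewrite -integral_mkcond/= integral_cst//= lebesgue_measure_itv/= lte_fin.
  by case: ltP => // ba; rewrite mule0 (_ : b = a) ?subrr ?mulr0//; apply/le_anti; rewrite ab ba.
have mkif (x t : R) : k (x, t) = if `[< [set` `[a, b]] x >] then
   (m * z x) * (if `[< [set` `[x, b]] t >] then m * e t else 0) else 0.
  rewrite !asbool_itvcc /k /=; have [ax|xa] //= := leP a x.
  have [xt|tx] /= := leP x t; last by rewrite mulr0; case: ifP.
  have [tb|bt] := leP t b; last by rewrite mulr0; case: ifP.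
  by rewrite (le_trans xt tb) mulrC.
have mkif2 (x t : R) : k (x, t) = if `[< [set` `[a, b]] t >] then
   (m * e t) * (if `[< [set` `[a, t]] x >] then m * z x else 0) else 0.
  rewrite !asbool_itvcc /k /=; have [ax|xa] //= := leP a x; last by rewrite mulr0; case: ifP.
  have [xt|tx] /= := leP x t; last by rewrite mulr0; case: ifP.
  by rewrite (le_trans ax xt) /=; case: ifP.
have ime (x : R) : cinteg setT (fun t => if `[< [set` `[x, b]] t >] then m * e t else 0).
  by apply: cinteg_mkcond => //; apply: cintegZ => //; exact: cinteg_cexp.
have imz (t : R) : cinteg setT (fun x => if `[< [set` `[a, t]] x >] then m * z x else 0).
  by apply: cinteg_mkcond => //; apply: cintegZ => //; exact: iz_itv.
have i1 x : cinteg setT (fun y => k (x, y)).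
  rewrite (_ : (fun y => _) = (fun t => (if `[< [set` `[a, b]] x >] then m * z x else 0) *
     (if `[< [set` `[x, b]] t >] then m * e t else 0))); first exact: cintegZ.
  by apply/funext => t; rewrite mkif; case: asboolP => _; rewrite ?mul0r.
have i2 y : cinteg setT (fun x => k (x, y)).
  rewrite (_ : (fun y => _) = (fun x => (if `[< [set` `[a, b]] y >] then m * e y else 0) *
     (if `[< [set` `[a, y]] x >] then m * z x else 0))); first exact: cintegZ.
  by apply/funext => t; rewrite mkif2; case: asboolP => _; rewrite ?mul0r.
have := cint_Fubini mk mg kg gfin i1 i2.
have -> : cint setT (fun x => cint setT (fun y => k (x, y))) =
    cint `[a, b] (fun x => (m * z x) * (e x - e b)).
  rewrite [RHS]cint_mkcond; apply: eq_cint => x _.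
  under eq_cint => y _ do rewrite mkif.
  case: asboolP => [xab|_]; last by rewrite cint0.
  have /andP[ax xb] : a <= x <= b by rewrite -asbool_itvcc; exact/asboolP.
  by rewrite cintZ// -cint_mkcond eE.
have -> : cint setT (fun y => cint setT (fun x => k (x, y))) =
    cint `[a, b] (fun t => (m * e t) * (z t - z a)).
  rewrite [RHS]cint_mkcond; apply: eq_cint => y _.
  under eq_cint => x _ do rewrite mkif2.
  case: asboolP => [yab|_]; last by rewrite cint0.
  have /andP[ay yb] : a <= y <= b by rewrite -asbool_itvcc; exact/asboolP.
  by rewrite cintZ// -cint_mkcond zE.
have iez : cinteg `[a, b] (fun t => m * (e t * z t)).
  apply: (cinteg_le _ _ (integrableZl _ (cnorm1 m * K) izn)) => //.
    by apply: (cmeasM (@cmeas_cst R _ _ m)); apply: cmeasM => //; exact: cmeas_cexp.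
  move=> x /=; rewrite in_itv/= => axb.
  rewrite (le_trans (cnorm1M _ _))// -mulrA ler_wpM2l ?cnorm1_ge0//.
  by rewrite (le_trans (cnorm1M _ _))// ler_wpM2r ?cnorm1_ge0//; exact: e_bound.
have -> : cint `[a, b] (fun x => (m * z x) * (e x - e b)) =
   cint `[a, b] (fun t => m * (e t * z t)) - e b * (z b - z a).
  rewrite zE// -cintZ//; last by apply: cintegZ => //; exact: iz_itv.
  rewrite -cintB//; last by apply: cintegZ => //; apply: cintegZ => //; exact: iz_itv.
  by apply: eq_cint => t _; ring.
have -> : cint `[a, b] (fun t => (m * e t) * (z t - z a)) =
   cint `[a, b] (fun t => m * (e t * z t)) - z a * (e a - e b).
  rewrite -eE// -cintZ//; last by apply: cintegZ => //; exact: cinteg_cexp.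
  rewrite -cintB//; last by apply: cintegZ => //; apply: cintegZ => //; exact: cinteg_cexp.
  by apply: eq_cint => t _; ring.
move=> /addrI/oppr_inj h.
have -> : e b * z b = e b * (z b - z a) + e b * z a by ring.
by rewrite h; ring.
Qed.

Let z_exp t : z t = cexp m t * z 0.
Proof.
have h : e t * z t = z 0.
  have e0 : e 0 * z 0 = z 0 by rewrite /e cexp0 mul1r.
  have [t0|t0] := leP 0 t; first by rewrite (ez_const t0).
  by rewrite -(ez_const (ltW t0)).
rewrite -h mulrA /e (_ : cexp m t * cexp (- m) t = 1) ?mul1r//.
rewrite -(cexpZ (- m)) (_ : cexp m t = cexp (toC t * m) 1) ?cexpZ//.
rewrite -(cexp0 m) -(subrr t) cexpD; congr (_ * _).
by case: m => a b; rewrite /cexp /= !mulrN !mulNr.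
Qed.

(** The solution is [cexp m t * z 0], whose modulus stays at least that of [z 0] on the half-line
    where [ReC m * t >= 0]; square integrability then forces [z 0 = 0]. *)
Lemma exp_ode_L2_zero t : z t = 0.
Proof.
suff z00 : z 0 = 0 by rewrite z_exp z00 mulr0.
apply: contrapT => z0n.
pose w := ReC (z 0) ^+ 2 + ImC (z 0) ^+ 2.
have w0 : 0 < w.
  rewrite lt_neqAle addr_ge0 ?sqr_ge0// andbT eq_sym; apply/negP => /eqP h.
  apply: z0n; move: h => /eqP; rewrite paddr_eq0 ?sqr_ge0// !sqrf_eq0 => /andP[/eqP h1 /eqP h2].
  exact: complex_ext.
have wE (x : R) : 0 <= ReC m * x -> w <= cnorm1 (z x) ^+ 2.
  move=> mx; apply: le_trans (sqr_cnorm1 _).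
  have -> : ReC (z x) ^+ 2 + ImC (z x) ^+ 2 = expR (ReC m * x) ^+ 2 * w.
    rewrite z_exp cReM cImM /= /w -[RHS]mulr1 -[X in _ = _ * X](cos2Dsin2 (ImC m * x)); ring.
  by rewrite ler_peMl ?(ltW w0)// exprn_ege1// -expR0 ler_expR.
have [I0 I0E] : exists I0 : R, (\int[leb]_x (cnorm1 (z x) ^+ 2)%:E)%E = I0%:E.
  by exists (fine (\int[leb]_x (cnorm1 (z x) ^+ 2)%:E)%E); rewrite fineK// integrable_fin_num.
(* On an interval of length [N] the integral would be at least [w * N = |I0| + w], more than the
   total [I0]. *)
pose N := `|I0| / w + 1.
have N0 : 0 < N by rewrite ltr_wpDl// divr_ge0// ltW.
have sub (a b : R) : a < b -> b - a = N -> (forall x, a <= x <= b -> 0 <= ReC m * x) -> False.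
  move=> ab baN abm.
  have h : ((w * N)%:E <= I0%:E)%E.
    rewrite -I0E.
    have -> : ((w * N)%:E = \int[leb]_(x in `[a, b]) (cst w%:E x))%E.
      by rewrite integral_cst//= lebesgue_measure_itv/= lte_fin ab -EFinB baN -EFinM.
    apply: (@le_trans _ _ (\int[leb]_(x in `[a, b]) (cnorm1 (z x) ^+ 2)%:E)%E).
      apply: ge0_le_integral => //.
      - by move=> x _; rewrite lee_fin ltW.
      - apply: (@measurable_funS _ _ _ _ setT) => //; exact: measurable_int iz.
      - by move=> x /=; rewrite in_itv/= => xab; rewrite lee_fin wE// abm.
    apply: ge0_subset_integral => //; first exact: measurable_int iz.
    by move=> x _; rewrite lee_fin sqr_ge0.
  rewrite lee_fin /N mulrDr mulr1 mulrCA divff ?gt_eqF// mulr1 in h.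
  by have := ler_norm I0; lra.
have [hm|hm] := leP 0 (ReC m).
  by apply: (sub 0 N) => //; [rewrite subr0|move=> x /andP[x0 _]; exact: mulr_ge0].
by apply: (sub (- N) 0); rewrite ?oppr_lt0 ?sub0r ?opprK// => x /andP[_ x0]; nra.
Qed.
End Uniqueness.
End Conv.

(** * Square-integrable vector functions *)

Section SqInt.
Variable R : realType.
Local Notation C := (R[i]).
Local Notation ReC := (@complex.Re R).
Local Notation ImC := (@complex.Im R).
Local Notation leb := (@lebesgue_measure R).

Definition sqint (g : R -> R) :=
  measurable_fun setT g /\ leb.-integrable setT (fun x => (g x ^+ 2)%:E).

Lemma sqint_le (f g : R -> R) : measurable_fun setT f -> sqint g ->
  (forall x, `|f x| <= g x) -> sqint f.
Proof.
move=> mf [mg ig] fg; split => //.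
apply: (le_integrable _ _ _ ig) => //.
  by apply/measurable_EFinP; exact: measurable_funX.
move=> x _; rewrite !abse_EFin lee_fin !normrX lerXn2r ?nnegrE//.
by rewrite (le_trans (fg x))// ler_norm.
Qed.

Lemma sqintD (f g : R -> R) : sqint f -> sqint g -> sqint (fun x => f x + g x).
Proof.
move=> [mf if_] [mg ig]; split; first exact: measurable_funD.
have h := integrableD measurableT (integrableZl measurableT 2 if_) (integrableZl measurableT 2 ig).
apply: (le_integrable _ _ _ h) => //.
  by apply/measurable_EFinP; apply: measurable_funX; exact: measurable_funD.
move=> x _; rewrite -!EFinM -EFinD !abse_EFin lee_fin (ger0_norm (sqr_ge0 _)).
rewrite ger0_norm; last by apply: addr_ge0; apply: mulr_ge0 => //; exact: sqr_ge0.
by have := sqr_ge0 (f x - g x); rewrite !expr2; lra.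
Qed.

Lemma sqintZ (f : R -> R) (k : R) : sqint f -> sqint (fun x => k * f x).
Proof.
move=> [mf if_]; split; first exact: measurable_funM.
have := integrableZl measurableT (k ^+ 2) if_; congr (leb.-integrable _ _).
by apply/funext => x; rewrite -EFinM exprMn.
Qed.

Lemma sqint0 : sqint (fun=> 0).
Proof.
split; first exact: measurable_cst.
by under eq_fun do rewrite expr0n; exact: integrable0.
Qed.

Lemma sqint_sum I (s : seq I) (F : I -> R -> R) : (forall i, sqint (F i)) ->
  sqint (fun x => \sum_(i <- s) F i x).
Proof.
move=> h; elim: s => [|i s ih].
  by under eq_fun do rewrite big_nil; exact: sqint0.
by under eq_fun do rewrite big_cons; exact: sqintD.
Qed.

Definition l2 (f : R -> C) := cmeas f /\ sqint (fun x => cnorm1 (f x)).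

Lemma l2_le (f : R -> C) (g : R -> R) : cmeas f -> sqint g ->
  (forall x, cnorm1 (f x) <= g x) -> l2 f.
Proof.
move=> mf sg fg; split => //; apply: (sqint_le (cmeas_cnorm1 mf) sg) => x.
by rewrite ger0_norm ?cnorm1_ge0.
Qed.

Lemma l2D f g : l2 f -> l2 g -> l2 (fun x => f x + g x).
Proof.
move=> [mf sf] [mg sg]; apply: (l2_le (cmeasD mf mg) (sqintD sf sg)) => x.
exact: cnorm1D.
Qed.

Lemma l2_sum I (s : seq I) (F : I -> R -> C) : (forall i, l2 (F i)) ->
  l2 (fun x => \sum_(i <- s) F i x).
Proof.
move=> h; apply: (l2_le _ (sqint_sum s (fun i => (h i).2))).
  by apply: cmeas_sum => i; case: (h i).
by move=> x; exact: cnorm1_sum.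
Qed.

Lemma l2M (f g : R -> C) (K : R) : cmeas f -> (forall x, cnorm1 (f x) <= K) -> l2 g ->
  l2 (fun x => f x * g x).
Proof.
move=> mf fK [mg sg]; apply: (l2_le (cmeasM mf mg) (sqintZ K sg)) => x.
by rewrite (le_trans (cnorm1M _ _))// ler_wpM2r// cnorm1_ge0.
Qed.

(** Passes from the sum of squared moduli in [L2] to [cnorm1] in each component, at the price of
    constants only. *)
Lemma L2P n (f : R -> 'cV[C]_n) : L2 f <-> forall i, l2 (fun x => f x i 0).
Proof.
split=> [[mf if_] i|h].
  split; first exact: mf.
  split; first exact: (cmeas_cnorm1 (mf i)).
  apply: (le_integrable _ _ _ (integrableZl measurableT 2 if_)) => //.
    by apply/measurable_EFinP; apply: measurable_funX; exact: (cmeas_cnorm1 (mf i)).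
  have s0 x : 0 <= \sum_i0 (ReC (f x i0 0) ^+ 2 + ImC (f x i0 0) ^+ 2).
    by apply: sumr_ge0 => j _; rewrite addr_ge0 ?sqr_ge0.
  move=> x _; rewrite -EFinM !abse_EFin lee_fin ger0_norm ?sqr_ge0//.
  rewrite ger0_norm ?mulr_ge0// (le_trans (cnorm1_sqr _))// ler_wpM2l//.
  rewrite (bigD1 i)//= lerDl; apply: sumr_ge0 => j _.
  by rewrite addr_ge0 ?sqr_ge0.
split; first by move=> i; case: (h i).
have ms : measurable_fun setT (fun x => \sum_i (ReC (f x i 0) ^+ 2 + ImC (f x i 0) ^+ 2)).
  by apply: measurable_sum => i; case: (h i) => -[m1 m2] _; apply: measurable_funD; exact: measurable_funX.
have is_ : leb.-integrable setT (fun x => (\sum_i (cnorm1 (f x i 0) ^+ 2)%:E)%E).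
  by apply: integrable_sum => // i _; case: (h i) => _ [].
apply: (le_integrable _ _ _ is_) => //; first exact/measurable_EFinP.
move=> x _; rewrite sumEFin !abse_EFin lee_fin.
have s0 : 0 <= \sum_i (ReC (f x i 0) ^+ 2 + ImC (f x i 0) ^+ 2).
  by apply: sumr_ge0 => j _; rewrite addr_ge0 ?sqr_ge0.
have s1 : 0 <= \sum_i cnorm1 (f x i 0) ^+ 2 by apply: sumr_ge0 => j _; exact: sqr_ge0.
by rewrite !ger0_norm//; apply: ler_sum => i _; exact: sqr_cnorm1.
Qed.

Lemma L2D n (f g : R -> 'cV[C]_n) : L2 f -> L2 g -> L2 (fun x => f x + g x).
Proof.
move=> /L2P hf /L2P hg; apply/L2P => i.
by under eq_fun do rewrite mxE; exact: l2D.
Qed.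

Lemma L2_mulmx p n (a : R -> 'M[C]_(p, n)) (f : R -> 'cV[C]_n) (K : R) :
  (forall i j, cmeas (fun x => a x i j)) -> (forall x i j, cnorm1 (a x i j) <= K) ->
  L2 f -> L2 (fun x => a x *m f x).
Proof.
move=> ma aK /L2P hf; apply/L2P => i.
under eq_fun do rewrite mxE.
by apply: l2_sum => j; apply: (@l2M (fun x => a x i j) _ K).
Qed.

Lemma L2_cmulmx p n (a : 'M[C]_(p, n)) (f : R -> 'cV[C]_n) :
  L2 f -> L2 (fun x => a *m f x).
Proof.
apply: (@L2_mulmx _ _ (fun=> a) _ (\sum_i \sum_j cnorm1 (a i j))) => [i j|_ i j].
  exact: cmeas_cst.
rewrite (bigD1 i)//= (bigD1 j)//= -addrA lerDl addr_ge0 ?sumr_ge0// => [k _|k _].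
  exact: cnorm1_ge0.
by apply: sumr_ge0 => l _; exact: cnorm1_ge0.
Qed.

Lemma L2N n (f : R -> 'cV[C]_n) : L2 f -> L2 (fun x => - f x).
Proof.
move=> h; have := L2_cmulmx (- 1%:M) h.
by under eq_fun do rewrite mulNmx mul1mx.
Qed.

Definition vnorm1 n (v : 'cV[C]_n) : R := \sum_i cnorm1 (v i 0).

Lemma sqint_vnorm1 n (f : R -> 'cV[C]_n) : L2 f -> sqint (fun x => vnorm1 (f x)).
Proof. by move=> /L2P h; apply: sqint_sum => i; case: (h i). Qed.

Lemma vnorm1_ge n (v : 'cV[C]_n) i : cnorm1 (v i 0) <= vnorm1 v.
Proof.
rewrite /vnorm1 (bigD1 i)//= lerDl; apply: sumr_ge0 => j _; exact: cnorm1_ge0.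
Qed.

Lemma vnorm1_ge0 n (v : 'cV[C]_n) : 0 <= vnorm1 v.
Proof. by apply: sumr_ge0 => j _; exact: cnorm1_ge0. Qed.

(** * Convolution for diagonal systems *)

Section VConv.
Variables (n : nat) (d : 'I_n -> C).
Hypothesis d0 : forall i, ReC (d i) != 0.

Definition vconv (r : R -> 'cV[C]_n) (x : R) : 'cV[C]_n :=
  \col_i sconv (d i) (fun y => r y i 0) x.

(** The reciprocal of one plus the sum of all [|Re d_i|^-1] lies below every [|Re d_i|]; the summand
    1 covers [n = 0]. *)
Lemma spectral_gap : exists c : R, 0 < c /\ forall i, c <= `|ReC (d i)|.
Proof.
pose s := \sum_i `|ReC (d i)|^-1 + 1.
have s0 : 0 < s by rewrite ltr_wpDl// sumr_ge0// => i _; rewrite invr_ge0.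
exists s^-1; split; first by rewrite invr_gt0.
move=> i; rewrite -[X in _ <= X]invrK lef_pV2 ?posrE ?invr_gt0 ?normr_gt0//.
rewrite /s (bigD1 i)//= -addrA lerDl addr_ge0 ?sumr_ge0//.
Qed.

(** One weight serves all components, since it is built from [vnorm1 r]. The rate [c] is left free
    below the gap: a rate strictly smaller than the decay of the kernel leaves room to absorb the
    Harnack factor. *)
Lemma L2_majorant (c : R) (r : R -> 'cV[C]_n) : 0 < c -> (forall i, c <= `|ReC (d i)|) -> L2 r ->
  exists H : R -> R, [/\ sqint H,
    forall x, expR (- c * `|x|) <= H x,
    forall x y, H y <= expR (c * `|x - y|) * H x,
    (forall i x, cinteg setT (fun y => green (d i) (x - y) * r y i 0)) &
    (forall x i, cnorm1 (vconv r x i 0) <= 2 * H x) /\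
    forall i a b, a <= b -> cinteg `[a, b] (fun x => r x i 0) /\
      vconv r b i 0 - vconv r a i 0 = cint `[a, b] (fun x => d i * vconv r x i 0 - r x i 0)].
Proof.
move=> c0 cd rL2; have [mrho irho] := sqint_vnorm1 rL2.
have [H [mH iH eH hH bH]] := exp_majorant c0 mrho (fun x => vnorm1_ge0 (r x)) irho.
have cdi i : 0 < c <= `|ReC (d i)| by rewrite c0 cd.
have mr i : cmeas (fun x => r x i 0) by have /L2P/(_ i)[] := rL2.
have ri i x : cnorm1 (r x i 0) <= vnorm1 (r x) := vnorm1_ge (r x) i.
exists H; split => //.
- by move=> i x; exact: (cinteg_sconv (cdi i) (mr i) (ri i) bH).
- split=> [x i|i a b ab]; first by rewrite mxE; exact: (cnorm1_sconv (cdi i) (mr i) (ri i) bH).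
  split; first exact: (cinteg_itv_dominated (cdi i) (mr i) (ri i) bH).
  rewrite !mxE (sconv_sub (cdi i) (mr i) (ri i) mrho hH bH ab).
  by apply: eq_cint => x _; rewrite mxE.
Qed.

Lemma vconv_L2 r : L2 r -> L2 (vconv r).
Proof.
move=> rL2; have [c [c0 cd]] := spectral_gap.
have [H [sH _ _ _ [bH _]]] := L2_majorant c0 cd rL2.
apply/L2P => i; apply: (l2_le _ (sqintZ 2 sH)); last by move=> x; exact: bH.
  under eq_fun do rewrite mxE; apply: cmeas_sconv.
  by have /L2P/(_ i)[] := rL2.
Qed.

Lemma vconv_integ r i x : L2 r -> cinteg setT (fun y => green (d i) (x - y) * r y i 0).
Proof.
move=> rL2; have [c [c0 cd]] := spectral_gap.
by have [H [_ _ _ h _]] := L2_majorant c0 cd rL2.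
Qed.

Lemma L2_cinteg_itv (r : R -> 'cV[C]_n) i a b : a <= b -> L2 r -> cinteg `[a, b] (fun x => r x i 0).
Proof.
move=> ab rL2; have [c [c0 cd]] := spectral_gap.
by have [H [_ _ _ _ [_ /(_ i a b ab)[]]]] := L2_majorant c0 cd rL2.
Qed.

Lemma vconv_sub r i a b : a <= b -> L2 r ->
  vconv r b i 0 - vconv r a i 0 = cint `[a, b] (fun x => d i * vconv r x i 0 - r x i 0).
Proof.
move=> ab rL2; have [c [c0 cd]] := spectral_gap.
by have [H [_ _ _ _ [_ /(_ i a b ab)[]]]] := L2_majorant c0 cd rL2.
Qed.

(** Each component of the difference of two solutions solves the homogeneous equation and is in L^2,
    so [exp_ode_L2_zero] applies. *)
Lemma vconv_unique r z : L2 r -> L2 z ->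
  (forall i a b, a <= b ->
    z b i 0 - z a i 0 = cint `[a, b] (fun x => d i * z x i 0 - r x i 0)) ->
  forall x, z x = vconv r x.
Proof.
move=> rL2 zL2 zE x; have wL2 := vconv_L2 rL2.
have dL2 : L2 (fun x => z x - vconv r x) by apply: L2D => //; exact: L2N.
apply/colP => i; apply/eqP; rewrite -subr_eq0; apply/eqP.
have /L2P/(_ i)[md [_ id_]] := dL2.
have e y : (z y - vconv r y) i 0 = z y i 0 - vconv r y i 0 by rewrite mxE [X in _ + X]mxE.
rewrite -e.
apply: (exp_ode_L2_zero (m := d i) (z := fun x => (z x - vconv r x) i 0) md id_ _ x) => a b ab.
transitivity ((z b i 0 - z a i 0) - (vconv r b i 0 - vconv r a i 0)).
  by rewrite !e; ring.
have ir := L2_cinteg_itv i ab rL2; have iz := L2_cinteg_itv i ab zL2.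
have iw := L2_cinteg_itv i ab wL2.
rewrite zE// vconv_sub// -cintB//; last 2 first.
- by apply: cintegB => //; exact: cintegZ.
- by apply: cintegB => //; exact: cintegZ.
by apply: eq_cint => y _; rewrite e; ring.
Qed.
End VConv.
End SqInt.

(** * The Fredholm alternative *)

Section Fredholm.
Variable R : realType.
Local Notation C := (R[i]).
Local Notation ReC := (@complex.Re R).
Local Notation ImC := (@complex.Im R).
Local Notation leb := (@lebesgue_measure R).

(** With [b k] the tail of the geometric majorant, the intervals of radius [b k] around [u k] are
    nested; the supremum of their left ends lies in all of them, which gives the limit together with
    its rate. *)
Lemma geometric_cauchy (u : nat -> R) (K : R) :
  (forall k, `|u k.+1 - u k| <= K * 2^-1 ^+ k) ->
  exists l, forall k, `|l - u k| <= 2 * K * 2^-1 ^+ k.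
Proof.
move=> h; pose b k : R := 2 * K * 2^-1 ^+ k.
have bS k : b k = K * 2^-1 ^+ k + b k.+1 by rewrite /b exprS; field.
have up j k : u (k + j)%N - b (k + j)%N >= u k - b k /\ u (k + j)%N + b (k + j)%N <= u k + b k.
  elim: j => [|j [ih1 ih2]]; first by rewrite addn0.
  have := h (k + j)%N; rewrite addnS ler_norml bS => /andP[h1 h2].
  have := bS (k + j)%N; have := bS k; split; lra.
have b0 k : 0 <= b k.
  have := le_trans (normr_ge0 _) (h 0%N); rewrite expr0 mulr1 => K0.
  by rewrite /b !mulr_ge0// exprn_ge0// invr_ge0.
have low j k : u j - b j <= u k + b k.
  have [jk|/ltnW kj] := leqP j k.
    by have [] := up (k - j)%N j; rewrite subnKC// => h1 _; have := b0 k; lra.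
  by have [_] := up (j - k)%N k; rewrite subnKC// => h1; have := b0 j; lra.
pose A := [set x | exists k, x = u k - b k].
have supA : has_sup A.
  split; first by exists (u 0%N - b 0%N); exists 0%N.
  by exists (u 0%N + b 0%N) => x [k ->]; exact: low.
exists (sup A) => k; rewrite ler_distl; apply/andP; split.
  by apply: sup_upper_bound => //; exists k.
by apply: sup_le_ub; [case: supA|move=> x [j ->]; exact: low].
Qed.

Lemma geometric_cvg (u : nat -> R) (l K : R) :
  (forall k, `|l - u k| <= K * 2^-1 ^+ k) -> u n @[n --> \oo] --> l.
Proof.
move=> h.
have g : K * 2^-1 ^+ n @[n --> \oo] --> (0 : R).
  rewrite -[X in _ --> X](mulr0 K); apply: cvgMr; apply: cvg_expr.
  by rewrite ger0_norm ?invr_ge0// invf_lt1// ltr1n.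
apply/cvgrPdist_le => e e0; move/cvgrPdist_le : g => /(_ e e0); apply: filterS => n.
rewrite sub0r normrN => hn; apply: (le_trans (h n)); apply: (le_trans (ler_norm _) hn).
Qed.

Lemma geometric_zero (z : C) (K : R) : (forall k, cnorm1 z <= K * 2^-1 ^+ k) -> z = 0.
Proof.
move=> h; apply: cnorm1_eq0.
have g : 0 @[n --> \oo] --> cnorm1 z.
  by apply: (@geometric_cvg (fun=> 0) _ K) => k; rewrite subr0 ger0_norm ?cnorm1_ge0.
by rewrite (cvg_unique _ (cvg_cst (0 : R)) g)//.
Qed.

Variables (n : nat) (d : 'I_n -> C).
Hypothesis d0 : forall i, ReC (d i) != 0.
Variable m : R -> 'M[C]_n.
Hypothesis mm : forall i j, cmeas (fun x => m x i j).

(** * Neumann series in a weighted sup norm *)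

Section Neumann.
Variables (H : R -> R) (kap : 'I_n -> R -> R -> C).
Hypothesis H0 : forall x, 0 <= H x.

Definition vmeas (w : R -> 'cV[C]_n) := forall i, cmeas (fun x => w x i 0).
Definition vbound (w : R -> 'cV[C]_n) (a : R) := forall x i, cnorm1 (w x i 0) <= a * H x.
Definition kop (w : R -> 'cV[C]_n) (x : R) : 'cV[C]_n :=
  \col_i cint setT (fun y => kap i x y * (m y *m w y) i 0).

Hypothesis kmeas : forall w, vmeas w -> vmeas (kop w).
Hypothesis kint : forall w a, vmeas w -> vbound w a ->
  forall i x, cinteg setT (fun y => kap i x y * (m y *m w y) i 0).
Hypothesis kbound : forall w a, vmeas w -> vbound w a -> vbound (kop w) (a / 2).

Lemma vmeasB u v : vmeas u -> vmeas v -> vmeas (fun x => u x - v x).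
Proof.
move=> hu hv i; rewrite (_ : (fun x => _) = (fun x => u x i 0 - v x i 0)).
  exact: cmeasB.
by apply/funext => x; rewrite mxE [X in _ + X]mxE.
Qed.

Lemma vboundB u v a b : vbound u a -> vbound v b -> vbound (fun x => u x - v x) (a + b).
Proof.
move=> hu hv x i; rewrite mxE [X in _ + X]mxE mulrDl (le_trans (cnorm1D _ _))//.
by rewrite cnorm1N lerD.
Qed.

Lemma kopB u v a b : vmeas u -> vmeas v -> vbound u a -> vbound v b ->
  forall x, kop (fun x => u x - v x) x = kop u x - kop v x.
Proof.
move=> mu mv bu bv x; apply/colP => i; rewrite mxE [RHS]mxE [X in X + _]mxE [X in _ + X]mxE [X in - X]mxE.
rewrite -cintB//; [|exact: (kint mu bu)|exact: (kint mv bv)].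
by apply: eq_cint => y _; rewrite mulmxBr -mulrBr; congr (_ * _); rewrite mxE [X in _ + X]mxE.
Qed.

(** Successive iterates differ by [a * 2^-k] in the weighted norm. [geometric_cauchy] doubles the
    constant, separately for real and imaginary parts, whence [4 * a]. *)
Lemma neumann h a : vmeas h -> vbound h a ->
  exists w, [/\ vmeas w, vbound w (4 * a) & forall x, w x + kop w x = h x].
Proof.
move=> mh bh.
pose W := fix W k := if k is k'.+1 then (fun x => h x - kop (W k') x) else (fun=> 0).
have mW k : vmeas (W k).
  elim: k => [i|k ih] /=; first by under eq_fun do rewrite mxE; exact: cmeas_cst.
  by apply: vmeasB => //; exact: kmeas.
have bW k : exists b, vbound (W k) b.
  elim: k => [|k [b ih]] /=.
    by exists 0 => x i; rewrite mxE cnorm10 mul0r.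
  by exists (a + b / 2); apply: vboundB => //; exact: kbound.
have dW k : vbound (fun x => W k.+1 x - W k x) (a * 2^-1 ^+ k).
  elim: k => [|k ih] /=.
    move=> x i; rewrite expr0 mulr1 subr0.
    rewrite (_ : kop _ x = 0) ?subr0; first exact: bh.
    apply/colP => j; rewrite !mxE -[RHS](@cint0 R setT); apply: eq_cint => y _.
    by rewrite mulmx0 mxE mulr0.
  have [b1 hb1] := bW k.+1; have [b0 hb0] := bW k.
  move=> x i.
  have -> : h x - kop (W k.+1) x - (h x - kop (W k) x) = - kop (fun x => W k.+1 x - W k x) x.
    by rewrite (kopB (mW _) (mW _) hb1 hb0); move: (kop _ x) (kop _ x) => u v; rewrite addrC !opprB addrA subrK.
  rewrite mxE cnorm1N.
  have := kbound (vmeasB (mW _) (mW _)) ih x i.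
  by rewrite exprSr mulrA.
have lim (p : R * 'I_n) : exists z : C, forall k, cnorm1 (z - W k p.1 p.2 0) <= 4 * a * H p.1 * 2^-1 ^+ k.
  case: p => x i /=.
  have cb k : cnorm1 (W k.+1 x i 0 - W k x i 0) <= a * H x * 2^-1 ^+ k.
    by have := dW k x i; rewrite mxE [X in _ + X]mxE mulrAC.
  have [k|zr hr] := @geometric_cauchy (fun k => ReC (W k x i 0)) (a * H x).
    by apply: le_trans (cb k); rewrite -cReN -cReD; exact: Re_cnorm1.
  have [k|zi hi] := @geometric_cauchy (fun k => ImC (W k x i 0)) (a * H x).
    by apply: le_trans (cb k); rewrite -cImN -cImD; exact: Im_cnorm1.
  exists (Complex zr zi) => k.
  by have := hr k; have := hi k; rewrite /cnorm1 cReD cImD cReN cImN /=; lra.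
have [f hf] := choice lim.
pose w x : 'cV[C]_n := \col_i f (x, i).
have wW k : vbound (fun x => w x - W k x) (4 * a * 2^-1 ^+ k).
  by move=> x i; rewrite mxE [X in X + _]mxE [X in _ + X]mxE mulrAC; exact: (hf (x, i) k).
have mw : vmeas w.
  move=> i; have cvgRe (x : R) : ReC (W k x i 0) @[k --> \oo] --> ReC (w x i 0).
    apply: (@geometric_cvg _ _ (4 * a * H x)) => k; rewrite -cReN -cReD mxE.
    exact: le_trans (Re_cnorm1 _) (hf (x, i) k).
  have cvgIm (x : R) : ImC (W k x i 0) @[k --> \oo] --> ImC (w x i 0).
    apply: (@geometric_cvg _ _ (4 * a * H x)) => k; rewrite -cImN -cImD mxE.
    exact: le_trans (Im_cnorm1 _) (hf (x, i) k).
  split.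
    apply: (measurable_fun_cvg (h := fun k x => ReC (W k x i 0))) => [k|x _]; first by case: (mW k i).
    exact: cvgRe.
  apply: (measurable_fun_cvg (h := fun k x => ImC (W k x i 0))) => [k|x _]; first by case: (mW k i).
  exact: cvgIm.
have bw : vbound w (4 * a).
  by move=> x i; have := wW 0%N x i; rewrite subr0 expr0 mulr1.
exists w; split => // x; apply/colP => i; apply/eqP; rewrite -subr_eq0; apply/eqP.
(* For every [k] the residual equals [(w - W k.+1) + kop (w - W k)], which is of order [2^-k], and
   hence vanishes. *)
apply: (@geometric_zero _ (4 * a * H x)) => k.
have [b hb] := bW k.
have -> : (w x + kop w x) i 0 - h x i 0 = (w x - W k.+1 x) i 0 + (kop (fun x => w x - W k x) x) i 0.
  rewrite (kopB mw (mW k) bw hb) /=; move: (kop w x) (kop (W k) x) (h x) (w x) => u v s t.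
  by rewrite !mxE; ring.
rewrite (le_trans (cnorm1D _ _))//.
have h1 := wW k.+1 x i; have h2 := kbound (vmeasB mw (mW k)) (wW k) x i.
apply: (le_trans (lerD h1 h2)); rewrite exprS.
by rewrite le_eqVlt; apply/orP; left; apply/eqP; field.
Qed.

Lemma kop_comb (g : R -> 'cV[C]_n) (W : 'I_n -> R -> 'cV[C]_n) (v : 'cV[C]_n) x :
  (forall i, cinteg setT (fun y => kap i x y * (m y *m g y) i 0)) ->
  (forall i j, cinteg setT (fun y => kap i x y * (m y *m W j y) i 0)) ->
  kop (fun x => g x - \sum_j v j 0 *: W j x) x = kop g x - \sum_j v j 0 *: kop (W j) x.
Proof.
move=> ig iW; apply/colP => i.
have -> : (kop g x - \sum_j v j 0 *: kop (W j) x) i 0 =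
    kop g x i 0 - \sum_j v j 0 * kop (W j) x i 0.
  rewrite mxE [X in _ + X]mxE summxE; congr (_ - _).
  by apply: eq_bigr => j _; rewrite mxE.
rewrite !mxE.
transitivity (cint setT (fun y => kap i x y * (m y *m g y) i 0 -
    \sum_j v j 0 * (kap i x y * (m y *m W j y) i 0))).
  apply: eq_cint => y _; rewrite mulmxBr mxE [X in _ + X]mxE mulmx_sumr summxE mulrBr mulr_sumr.
  by congr (_ - _); apply: eq_bigr => j _; rewrite -scalemxAr [X in _ * X]mxE mulrCA.
rewrite cintB//; last by apply: cinteg_sum => // j; exact: cintegZ.
rewrite cint_sum//; last by move=> j; exact: cintegZ.
by congr (_ - _); apply: eq_bigr => j _; rewrite cintZ// mxE.
Qed.
End Neumann.

Lemma cmeas_mulmx_col (w : R -> 'cV[C]_n) i : vmeas w -> cmeas (fun y => (m y *m w y) i 0).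
Proof.
move=> mw; under eq_fun do rewrite mxE.
by apply: cmeas_sum => j; apply: cmeasM.
Qed.

(** * Volterra part, small part and finite-rank part *)

Section Split.
Variables (Mb c L N : R) (H0 : R -> R).
Hypothesis mMb : forall x i j, cnorm1 (m x i j) <= Mb.
Hypothesis c0 : 0 < c.
Hypothesis cd : forall i, 2 * c <= `|ReC (d i)|.
Hypothesis dL : forall i, `|ReC (d i)| <= L.
Hypotheses (L0 : 0 <= L) (N0 : 0 <= N) (Mb0 : 0 <= Mb).
Hypothesis mN : forall x i j, N <= `|x| -> cnorm1 (m x i j) <= c / (16 * n.+1%:R).
Hypothesis H0pos : forall x, 0 < H0 x.
Hypothesis harnack : forall x y, H0 y <= expR (c * `|x - y|) * H0 x.

Let inN (x : R) := (- N <= x) && (x < N).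
(** The growth rate [k] of the weight has three shares: [L] pays for the growth of [cexp], [c] for
    the Harnack factor, and [kk] remains as decay. Its size makes the Volterra part contribute at
    most 1/4 to the contraction factor. *)
Let kk := 16 * n.+1%:R * (Mb + 1).
Let k := kk + L + c.
Let H x := (if inN x then expR (k * (N - x)) else 1) * H0 x.

(* On [-N, N[ a term of rank one in (x, y) is subtracted, which leaves a Volterra kernel
   there; outside, [m] is small. The factor of [H] growing to the left on [-N, N[ absorbs
   the Volterra part, so that the operator with kernel [vkern] is a contraction for [H]. *)
Definition vkern i (x y : R) : C :=
  green (d i) (x - y) - (if inN y then green (d i) (x + N) * cexp (d i) (- N - y) else 0).

Let kk0 : 0 < kk.
Proof. by rewrite /kk !mulr_gt0 ?ltr0n// ltr_wpDl. Qed.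

(** The subtracted product agrees with [green (d i) (x - y)] in its smooth exponential part, so only
    the difference of the two steps [x >= - N] and [x >= y] survives. The integration is thus over
    [y > x], the side on which the weight decreases. *)
Let vkern_in i x y : inN y -> vkern i x y =
  if (- N <= x) && (x < y) then cexp (d i) (x - y) else 0.
Proof.
rewrite /vkern => Ny; rewrite Ny; case/andP: Ny => Ny yN.
have e : cexp (d i) (x + N) * cexp (d i) (- N - y) = cexp (d i) (x - y).
  by rewrite -cexpD; congr cexp; ring.
rewrite /green mulrBl.
have -> : (if 0 < ReC (d i) then cexp (d i) (x + N) else 0) * cexp (d i) (- N - y) =
    (if 0 < ReC (d i) then cexp (d i) (x - y) else 0).
  by case: ifP => _; rewrite ?e ?mul0r.
have -> : (if 0 <= x + N then cexp (d i) (x + N) else 0) * cexp (d i) (- N - y) =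
    (if - N <= x then cexp (d i) (x - y) else 0).
  by rewrite -lerBlDr sub0r; case: ifP => _; rewrite ?e ?mul0r.
rewrite subr_ge0 (_ : forall s p q : C, s - p - (s - q) = q - p); last by move=> s p q; ring.
have [xy|yx] := ltP x y; first by rewrite andbT subr0.
by rewrite andbF (le_trans Ny yx) subrr.
Qed.

Let Hge x : H0 x <= H x.
Proof.
rewrite /H; case: ifPn => [/andP[h1 h2]|_]; last by rewrite mul1r.
rewrite ler_peMl ?(ltW (H0pos x))// -expR0 ler_expR mulr_ge0 ?subr_ge0 ?(ltW h2)//.
by rewrite /k addr_ge0 ?addr_ge0 ?(ltW kk0) ?(ltW c0).
Qed.

Let Hpos x : 0 < H x. Proof. exact: lt_le_trans (H0pos x) (Hge x). Qed.

Let k0 : 0 <= k. Proof. by rewrite /k addr_ge0 ?addr_ge0 ?(ltW kk0) ?(ltW c0). Qed.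

Let Hle x : H x <= expR (k * (2 * N)) * H0 x.
Proof.
rewrite /H ler_wpM2r ?(ltW (H0pos x))//; case: ifPn => [/andP[h1 h2]|_].
  by rewrite ler_expR ler_wpM2l//; lra.
by rewrite -expR0 ler_expR mulr_ge0// mulr_ge0.
Qed.

Let mw_bound w a y i : vbound H w a ->
  cnorm1 ((m y *m w y) i 0) <=
  n.+1%:R * (if inN y then Mb else c / (16 * n.+1%:R)) * (a * H y).
Proof.
move=> bw; set mb := (if _ then _ else _).
have aH0 : 0 <= a * H y by exact: le_trans (cnorm1_ge0 _) (bw y i).
have mbE j : cnorm1 (m y i j) <= mb.
  rewrite /mb; case: ifPn => [_|]; first exact: mMb.
  move=> nN; apply: mN; have [yN|Ny] := ltP y (- N).
    by rewrite ltr0_norm ?(lt_le_trans yN) ?oppr_le0// lerNr ltW.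
  have Ny2 : N <= y by rewrite leNgt; apply: contra nN => yN; rewrite /inN Ny.
  by rewrite ger0_norm// (le_trans N0).
have mb0 : 0 <= mb by exact: le_trans (cnorm1_ge0 _) (mbE i).
rewrite mxE (le_trans (cnorm1_sum _ _ _))//.
apply: (@le_trans _ _ (\sum_(j < n) (mb * (a * H y)))).
  apply: ler_sum => j _; rewrite (le_trans (cnorm1M _ _))//.
  by apply: ler_pM => //; rewrite ?cnorm1_ge0.
rewrite sumr_const card_ord -[leLHS]mulr_natl -[leRHS]mulrA; apply: ler_wpM2r; first exact: mulr_ge0.
by rewrite ler_nat.
Qed.

(** The two summands are the two regimes of [y]. Outside [-N, N[ the kernel decays at rate [2 * c],
    of which Harnack consumes [c]; inside, the steep weight turns the Volterra kernel into one
    decaying at rate [kk]. *)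
Let kern_bound w a i x y : vbound H w a ->
  cnorm1 (vkern i x y * (m y *m w y) i 0) <=
  a * H x * (c / 8 * expR (- c * `|x - y|) + 2 * n.+1%:R * Mb * expR (- kk * `|x - y|)).
Proof.
move=> bw.
have a0 : 0 <= a.
  by have := le_trans (cnorm1_ge0 _) (bw x i); rewrite pmulr_lge0.
have nn0 : (n.+1%:R : R) != 0 by rewrite pnatr_eq0.
have aH : 0 <= a * H x by rewrite mulr_ge0// ltW.
have e1 : 0 <= c / 8 * expR (- c * `|x - y|) by rewrite mulr_ge0 ?expR_ge0// divr_ge0// ltW.
have e2 : 0 <= 2 * n.+1%:R * Mb * expR (- kk * `|x - y|) by rewrite !mulr_ge0 ?expR_ge0.
rewrite mulrDr (le_trans (cnorm1M _ _))//.
have := mw_bound y i bw; case: (boolP (inN y)) => Ny hmw; last first.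
  rewrite /vkern (negbTE Ny) subr0.
  apply: (@le_trans _ _ (a * H x * (c / 8 * expR (- c * `|x - y|)))); last first.
    by rewrite lerDl mulr_ge0.
  have g := @cnorm1_green _ (d i) (2 * c) (x - y).
  have {}g : cnorm1 (green (d i) (x - y)) <= 2 * expR (- (2 * c) * `|x - y|).
    by apply: g; rewrite cd mulr_gt0.
  apply: (le_trans (ler_pM (cnorm1_ge0 _) (cnorm1_ge0 _) g hmw)).
  have -> : H y = H0 y by rewrite /H (negbTE Ny) mul1r.
  rewrite (_ : n.+1%:R * (c / (16 * n.+1%:R)) = c / 16); last first.
    by move: nn0; move: (n.+1%:R : R) => nn nn0; field.
  apply: (@le_trans _ _ (2 * expR (- (2 * c) * `|x - y|) * (c / 16 * (a * (expR (c * `|x - y|) * H x))))).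
    rewrite ler_wpM2l ?mulr_ge0 ?expR_ge0// ler_wpM2l ?divr_ge0 ?(ltW c0)// ler_wpM2l//.
    by rewrite (le_trans (harnack x y))// ler_wpM2l ?expR_ge0.
  rewrite le_eqVlt; apply/orP; left; apply/eqP.
  rewrite (_ : - c * `|x - y| = - (2 * c) * `|x - y| + c * `|x - y|); last by ring.
  by rewrite expRD; field.
rewrite vkern_in//; case: (boolP ((- N <= x) && (x < y))) => [/andP[Nx xy]|_]; last first.
  by rewrite cnorm10 mul0r addr_ge0// mulr_ge0.
apply: (@le_trans _ _ (a * H x * (2 * n.+1%:R * Mb * expR (- kk * `|x - y|)))); last first.
  by rewrite lerDr mulr_ge0.
have g : cnorm1 (cexp (d i) (x - y)) <= 2 * expR (L * `|x - y|).
  rewrite (le_trans (cnorm1_cexp _ _))// ler_wpM2l// ler_expR.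
  by rewrite (le_trans (ler_norm _))// normrM ler_wpM2r.
apply: (le_trans (ler_pM (cnorm1_ge0 _) (cnorm1_ge0 _) g hmw)).
have Nx' : inN x by rewrite /inN Nx (lt_trans xy)//; case/andP: Ny.
have -> : H y = expR (k * (N - y)) * H0 y by rewrite /H Ny.
have -> : H x = expR (k * (N - x)) * H0 x by rewrite /H Nx'.
apply: (@le_trans _ _ (2 * expR (L * `|x - y|) * (n.+1%:R * Mb * (a * (expR (k * (N - y)) * (expR (c * `|x - y|) * H0 x)))))).
  rewrite ler_wpM2l ?mulr_ge0 ?expR_ge0// ler_wpM2l ?mulr_ge0// ler_wpM2l//.
  by rewrite ler_wpM2l ?expR_ge0.
rewrite le_eqVlt; apply/orP; left; apply/eqP.
have -> : expR (k * (N - y)) = expR (k * (N - x)) * expR (- k * `|x - y|).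
  by rewrite -expRD; congr expR; rewrite distrC gtr0_norm ?subr_gt0//; ring.
have -> : expR (- kk * `|x - y|) = expR (L * `|x - y|) * expR (- k * `|x - y|) * expR (c * `|x - y|).
  by rewrite -!expRD; congr expR; rewrite /k; ring.
ring.
Qed.

Let mkern i : cmeas (fun p : R * R => vkern i p.1 p.2).
Proof.
have m1 : measurable_fun setT (@fst R R) by exact: measurable_fst.
have m2 : measurable_fun setT (@snd R R) by exact: measurable_snd.
apply: cmeasB; first exact: cmeas_green_dist.
apply: (cmeas_if _ _ (@cmeas_cst R _ _ 0)).
  apply: measurable_and; first exact: measurable_fun_ler.
  exact: measurable_fun_ltr.
apply: cmeasM.
  apply: (cmeas_comp (cmeas_green (d i))); exact: measurable_funD.
apply: (cmeas_comp (cmeas_cexp (d i))); exact: measurable_funB.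
Qed.

Let vkmeas w : vmeas w -> vmeas (kop vkern w).
Proof.
move=> mw i; under eq_fun do rewrite mxE.
apply: (@cmeas_cint_snd R (fun p => vkern i p.1 p.2 * (m p.2 *m w p.2) i 0)).
by apply: cmeasM; [exact: mkern|exact: (cmeas_snd (cmeas_mulmx_col i mw))].
Qed.

Let ibound x (a : R) : leb.-integrable setT (fun y => (a * H x *
  (c / 8 * expR (- c * `|x - y|) + 2 * n.+1%:R * Mb * expR (- kk * `|x - y|)))%:E).
Proof.
have h1 := integrableZl measurableT (c / 8) (integrable_expR_dist x c0).
have h2 := integrableZl measurableT (2 * n.+1%:R * Mb) (integrable_expR_dist x kk0).
have h3 := integrableZl measurableT (a * H x) (integrableD measurableT h1 h2).
by [].
Qed.

Let vkint w a : vmeas w -> vbound H w a ->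
  forall i x, cinteg setT (fun y => vkern i x y * (m y *m w y) i 0).
Proof.
move=> mw bw i x; apply: (cinteg_le measurableT _ (ibound x a)).
  apply: cmeasM; last exact: cmeas_mulmx_col.
  have [k1 k2] := mkern i.
  split; [exact: (measurableT_comp k1 (measurable_pair1 x))|exact: (measurableT_comp k2 (measurable_pair1 x))].
by move=> y _; exact: kern_bound.
Qed.

Let vkbound w a : vmeas w -> vbound H w a -> vbound H (kop vkern w) (a / 2).
Proof.
move=> mw bw x i; rewrite mxE.
have a0 : 0 <= a.
  by have := le_trans (cnorm1_ge0 _) (bw x i); rewrite pmulr_lge0.
apply: (le_trans (cnorm1_cint measurableT (vkint mw bw i x) (ibound x a) (fun y _ => kern_bound i x y bw))).
have i1 := integrable_expR_dist x c0.
have i2 := integrable_expR_dist x kk0.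
have h1 : leb.-integrable setT (EFin \o (fun y => c / 8 * expR (- c * `|x - y|))).
  exact: (integrableZl measurableT (c / 8) i1).
have h2 : leb.-integrable setT (EFin \o (fun y => 2 * n.+1%:R * Mb * expR (- kk * `|x - y|))).
  exact: (integrableZl measurableT (2 * n.+1%:R * Mb) i2).
rewrite RintegralZl//; last exact: (integrableD measurableT h1 h2).
rewrite (RintegralD measurableT h1 h2) (RintegralZl _ measurableT i1) (RintegralZl _ measurableT i2).
rewrite (_ : a / 2 * H x = a * H x * (1 / 2)); last by field.
have aH : 0 <= a * H x by rewrite mulr_ge0// ltW.
rewrite ler_wpM2l//.
have j1 := Rintegral_expR_dist x c0; have j2 := Rintegral_expR_dist x kk0.
(* The outer part gives exactly 1/4 and the inner part [1/4 * Mb / (Mb + 1)], together at most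
   1/2. *)
apply: (@le_trans _ _ (c / 8 * (2 / c) + 2 * n.+1%:R * Mb * (2 / kk))).
  have c8 : 0 <= c / 8 by rewrite divr_ge0// ltW.
  by apply: lerD; apply: ler_wpM2l => //; rewrite !mulr_ge0.
rewrite (_ : c / 8 * (2 / c) = 1 / 4); last by field; rewrite gt_eqF.
have nn0 : (n.+1%:R : R) != 0 by rewrite pnatr_eq0.
have b1 : Mb + 1 != 0 by rewrite gt_eqF// ltr_wpDl.
rewrite (_ : 2 * n.+1%:R * Mb * (2 / kk) = 1 / 4 * (Mb / (Mb + 1))); last first.
  rewrite /kk; move: nn0 b1; move: (n.+1%:R : R) Mb => nn M nn0 b1.
  by field; rewrite ?nn0 ?b1.
have : Mb / (Mb + 1) <= 1 by rewrite ler_pdivrMr ?mul1r ?lerDl// ltr_wpDl.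
lra.
Qed.

(** [kop vkern] being a contraction, [1 + kop vkern] can be inverted on [vconv d r] and on the
    profiles of the finite-rank remainder. Triviality of the kernel is used only through the
    resulting matrix, where injectivity implies surjectivity. *)
Lemma fredholm_split r : L2 r -> sqint H0 -> (forall x i, cnorm1 (vconv d r x i 0) <= 2 * H0 x) ->
  (forall x, expR (- c * `|x|) <= H0 x) ->
  (forall w, L2 w -> (forall x, w x + vconv d (fun y => m y *m w y) x = 0) -> forall x, w x = 0) ->
  exists w, L2 w /\ forall x, w x + vconv d (fun y => m y *m w y) x = vconv d r x.
Proof.
move=> rL2 sH0 rH0 eH0 ker0.
have boundL2 w a : vmeas w -> vbound H w a -> L2 w.
  move=> mw bw; apply/L2P => i; apply: (l2_le (mw i) (sqintZ (`|a| * expR (k * (2 * N))) sH0)) => x.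
  rewrite (le_trans (bw x i))// -mulrA; apply: (@le_trans _ _ (`|a| * H x)).
    by rewrite ler_wpM2r ?(ltW (Hpos x))// ler_norm.
  by rewrite ler_wpM2l.
(* The remainder [vconv d (m w) - kop vkern w] is always a combination of these [n] profiles. *)
pose phi j x : 'cV[C]_n := \col_i (if i == j then green (d j) (x + N) else 0).
have mphi j : vmeas (phi j).
  move=> i; under eq_fun do rewrite mxE.
  case: (i == j); last exact: cmeas_cst.
  by apply: (cmeas_comp (cmeas_green (d j))); exact: measurable_funD.
have bphi j : vbound H (phi j) (2 * expR (c * N)).
  move=> x i; rewrite mxE; case: ifP => _; last first.
    by rewrite cnorm10 mulr_ge0 ?(ltW (Hpos x))// mulr_ge0 ?expR_ge0.
  have g : cnorm1 (green (d j) (x + N)) <= 2 * expR (- c * `|x + N|).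
    by apply: cnorm1_green; rewrite c0 (le_trans _ (cd j))// mulrDl mul1r lerDl ltW.
  rewrite (le_trans g)// -mulrA ler_wpM2l//.
  (* Recentring from [- N] to 0 costs the factor [expR (c * N)]; the weight dominates
     [expR (- c * |x|)] by [eH0]. *)
  apply: (@le_trans _ _ (expR (c * N) * expR (- c * `|x|))).
    rewrite -expRD ler_expR.
    have := ler_normB (x + N) N; rewrite addrK (ger0_norm N0) => h.
    by have := ler_wpM2l (ltW c0) h; lra.
  by rewrite ler_wpM2l ?expR_ge0// (le_trans (eH0 x)).
have /choice[W hW] j := neumann vkmeas vkint vkbound (mphi j) (bphi j).
have mh : vmeas (vconv d r) by move=> i; have /L2P/(_ i)[] := vconv_L2 d0 rL2.
have bh : vbound H (vconv d r) 2.
  by move=> x i; rewrite (le_trans (rH0 x i))// ler_wpM2l.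
have [wh [mwh bwh whE]] := neumann vkmeas vkint vkbound mh bh.
have mW j : vmeas (W j) by case: (hW j).
have bW j : vbound H (W j) (4 * (2 * expR (c * N))) by case: (hW j).
have WE j x : W j x + kop vkern (W j) x = phi j x by case: (hW j).
pose ckern (i : 'I_n) (x y : R) : C := if inN y then cexp (d i) (- N - y) else 0.
(* [ckern] does not depend on its argument [x], so the evaluation point 0 is arbitrary and [cf w] is
   the coefficient vector of [w] in the remainder. *)
pose cf w := kop ckern w 0.
have mwL2 w a : vmeas w -> vbound H w a -> L2 (fun y => m y *m w y).
  by move=> mw bw; exact: (L2_mulmx mm mMb (boundL2 w a mw bw)).
have icf w a i x : vmeas w -> vbound H w a -> cinteg setT (fun y => ckern i x y * (m y *m w y) i 0).
  move=> mw bw.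
  have NN : - N <= N by rewrite (le_trans _ N0)// oppr_le0.
  have i1 := cinteg_cnorm1 (measurable_itv _) (L2_cinteg_itv d0 i NN (mwL2 w a mw bw)).
  have i2 : cinteg `[- N, N] (fun y => cexp (d i) (- N - y) * (m y *m w y) i 0).
    apply: (cinteg_le _ _ (integrableZl _ (2 * expR (L * (2 * N))) i1)) => //.
      apply: cmeasM; last exact: cmeas_mulmx_col.
      by apply: (cmeas_comp (cmeas_cexp (d i))); exact: measurable_funB.
    move=> y /=; rewrite in_itv /= => /andP[Ny yN].
    rewrite (le_trans (cnorm1M _ _))// ler_wpM2r ?cnorm1_ge0//.
    rewrite (le_trans (cnorm1_cexp _ _))// ler_wpM2l// ler_expR.
    rewrite (le_trans (ler_norm _))// normrM ler_pM// ler_norml; apply/andP; split; lra.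
  have i3 : cinteg `[- N, N[ (fun y => cexp (d i) (- N - y) * (m y *m w y) i 0).
    by apply: cintegS i2 => // y /=; rewrite !in_itv /= => /andP[-> /ltW ->].
  have := cinteg_mkcond (measurable_itv _) i3; congr (cinteg _ _).
  apply/funext => y; rewrite /ckern.
  have -> : `[< [set` `[- N, N[] y >] = inN y by apply/asboolP/idP; rewrite /= in_itv.
  by case: (inN y); rewrite ?mul0r.
have split w a : vmeas w -> vbound H w a -> forall x,
    vconv d (fun y => m y *m w y) x = kop vkern w x + \col_i (green (d i) (x + N) * cf w i 0).
  move=> mw bw x; apply/colP => i; rewrite mxE [RHS]mxE [X in _ = X + _]mxE [X in _ = _ + X]mxE.
  rewrite [X in _ * X]mxE -cintZ//; last exact: (icf w a).
  rewrite -cintD//; last 2 first.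
  - exact: (vkint mw bw).
  - by apply: cintegZ => //; exact: (icf w a).
  apply: eq_cint => y _; rewrite mulrA -mulrDl; congr (_ * _).
  by rewrite /vkern /ckern; case: (inN y); rewrite ?mulr0 ?subr0 ?addr0// subrK.
(* Corrected by the solutions [W j] for the data [phi j], the equation reduces to the
   [n x n] linear system with matrix [1 + Cm]. *)
pose Cm : 'M[C]_n := \matrix_(i, j) cf (W j) i 0.
pose comb (g : R -> 'cV[C]_n) (v : 'cV[C]_n) x := g x - \sum_j v j 0 *: W j x.
have mcomb g v : vmeas g -> vmeas (comb g v).
  move=> mg i; rewrite /comb (_ : (fun x => _) = (fun x => g x i 0 - \sum_j v j 0 * W j x i 0)).
    apply: cmeasB; first exact: mg.
    by apply: cmeas_sum => j; apply: (cmeasM (@cmeas_cst R _ _ _)); exact: mW.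
  apply/funext => x; rewrite mxE [X in _ + X]mxE summxE; congr (_ - _).
  by apply: eq_bigr => j _; rewrite mxE.
have bcomb g v b : vbound H g b -> exists b', vbound H (comb g v) b'.
  move=> bg; exists (b + \sum_j cnorm1 (v j 0) * (4 * (2 * expR (c * N)))); apply: vboundB => // x i.
  rewrite summxE (le_trans (cnorm1_sum _ _ _))// mulr_suml; apply: ler_sum => j _.
  rewrite mxE (le_trans (cnorm1M _ _))// -mulrA ler_wpM2l ?cnorm1_ge0//.
  exact: bW.
(* Subtracting the [W j] with coefficients [v] changes the coefficient of the profiles to
   [cf g - (v + Cm *m v)]; it must be made zero. *)
have combE g b hg v : vmeas g -> vbound H g b -> (forall x, g x + kop vkern g x = hg x) ->
    (forall x, comb g v x + vconv d (fun y => m y *m comb g v y) x =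
      hg x + \col_i (green (d i) (x + N) * (cf g - (v + Cm *m v)) i 0)) /\
    cf (comb g v) = cf g - Cm *m v.
  move=> mg bg gE.
  have cfE : cf (comb g v) = cf g - Cm *m v.
    rewrite /cf (kop_comb v); last 2 first.
    - by move=> i; exact: (icf g b).
    - by move=> i j; exact: (icf _ _ i 0 (mW j) (bW j)).
    congr (_ - _); apply/colP => i; rewrite summxE [RHS]mxE; apply: eq_bigr => j _.
    by rewrite mxE [in RHS]mxE mulrC.
  split=> // x; have [b' hb'] := bcomb g v b bg.
  rewrite (split _ _ (mcomb g v mg) hb') cfE (kop_comb v); last 2 first.
  - by move=> i; exact: (vkint mg bg).
  - by move=> i j; exact: (vkint (mW j) (bW j)).
  rewrite -(gE x) /comb.
  have sE : \sum_j v j 0 *: W j x + \sum_j v j 0 *: kop vkern (W j) x =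
      \col_i (green (d i) (x + N) * v i 0).
    rewrite -big_split /=; apply/colP => i; rewrite summxE [RHS]mxE (bigD1 i)//= big1 ?addr0.
      by rewrite -scalerDr WE !mxE eqxx mulrC.
    by move=> j ji; rewrite -scalerDr WE !mxE eq_sym (negbTE ji) mulr0.
  have -> : \col_i (green (d i) (x + N) * (cf g - (v + Cm *m v)) i 0) =
      \col_i (green (d i) (x + N) * (cf g - Cm *m v) i 0) - \col_i (green (d i) (x + N) * v i 0).
    have e (u s t : 'cV[C]_n) (G : 'I_n -> C) : \col_i (G i * (u - (s + t)) i 0) =
        \col_i (G i * (u - t) i 0) - \col_i (G i * s i 0).
      by apply/colP => i; rewrite !mxE; ring.
    exact: e.
  rewrite -sE; have e (s t u z y : 'cV[C]_n) : y - s + (z - t + u) = y + z + (u - (s + t)).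
    by apply/colP => i; rewrite !mxE; ring.
  exact: e.
have kop0 kap (w : R -> 'cV[C]_n) x : (forall y, w y = 0) -> kop kap w x = 0.
  move=> w0; apply/colP => i; rewrite !mxE -[RHS](@cint0 R setT); apply: eq_cint => y _.
  by rewrite w0 mulmx0 mxE mulr0.
(* A null vector [v] of [1 + Cm] makes [comb 0 v] a solution of the homogeneous equation, hence
   zero. Its coefficient vector [- Cm *m v] is then zero too, and [v = - Cm *m v]. *)
have inj (v : 'cV[C]_n) : v + Cm *m v = 0 -> v = 0.
  move=> v0; have m0 : vmeas (fun=> 0 : 'cV[C]_n).
    by move=> i; under eq_fun do rewrite mxE; exact: cmeas_cst.
  have b0 : vbound H (fun=> 0) 0 by move=> x i; rewrite mxE cnorm10 mul0r.
  have cf0 : cf (fun=> 0) = 0 by exact: kop0.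
  have [|E cE] := combE _ 0 (fun=> 0) v m0 b0; first by move=> x; rewrite kop0// addr0.
  have [b hb] := bcomb _ v 0 b0.
  have w0 : forall x, comb (fun=> 0) v x = 0.
    apply: ker0 => [|x]; first exact: (boundL2 _ b (mcomb _ v m0) hb).
    rewrite E v0 cf0 subr0 add0r; apply/colP => i; by rewrite !mxE mulr0.
  move: cE; rewrite cf0 {1}/cf kop0// sub0r => /eqP; rewrite eq_sym oppr_eq0 => /eqP Cv.
  by move: v0; rewrite Cv addr0.
have unit1 : 1%:M + Cm \in unitmx.
  rewrite unitmxE unitfE; apply/negP; rewrite -det_tr => /det0P[u un0 uC].
  move/negP: un0; apply; apply/eqP; apply: trmx_inj; rewrite trmx0; apply: inj.
  by rewrite -[X in X + _]mul1mx -mulmxDl; apply: trmx_inj; rewrite trmx_mul trmxK uC trmx0.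
pose v := invmx (1%:M + Cm) *m cf wh.
have vE : v + Cm *m v = cf wh by rewrite -[X in X + _]mul1mx -mulmxDl mulKVmx.
have [E _] := combE wh _ _ v mwh bwh whE.
have [b hb] := bcomb _ v _ bwh.
exists (comb wh v); split; first exact: (boundL2 _ b (mcomb _ v mwh) hb).
move=> x; rewrite E vE subrr -[RHS]addr0; congr (_ + _).
by apply/colP => i; rewrite !mxE mulr0.
Qed.
End Split.

Variable Mb : R.
Hypothesis mMb : forall x i j, cnorm1 (m x i j) <= Mb.
Hypothesis mvan : forall th, 0 < th -> exists N : R, forall x i j, N <= `|x| -> cnorm1 (m x i j) <= th.

(** The weight is taken at half the spectral gap [g], so the kernel decays twice as fast as the
    weight may vary; [N] is then chosen to make [m] small at that rate. *)
Theorem vconv_fredholm r : L2 r ->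
  (forall w, L2 w -> (forall x, w x + vconv d (fun y => m y *m w y) x = 0) -> forall x, w x = 0) ->
  exists w, L2 w /\ forall x, w x + vconv d (fun y => m y *m w y) x = vconv d r x.
Proof.
move=> rL2 ker0; have [g [g0 gd]] := spectral_gap d0.
have c0 : 0 < g / 2 by rewrite divr_gt0.
have cd i : 2 * (g / 2) <= `|ReC (d i)| by rewrite mulrC divfK.
have cd1 i : g / 2 <= `|ReC (d i)| by rewrite (le_trans _ (cd i))// mulrDl mul1r lerDl ltW.
have [H0 [sH0 eH0 hH0 _ [rH0 _]]] := L2_majorant c0 cd1 rL2.
have th0 : 0 < (g / 2) / (16 * n.+1%:R) by rewrite divr_gt0// mulr_gt0.
have [N hN] := mvan th0.
pose L := \sum_i `|ReC (d i)|.
have dL i : `|ReC (d i)| <= L by rewrite /L (bigD1 i)//= lerDl sumr_ge0.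
have L0 : 0 <= L by exact: sumr_ge0.
have mN x i j : `|N| <= `|x| -> cnorm1 (m x i j) <= g / 2 / (16 * n.+1%:R).
  by move=> Nx; apply: hN; apply: le_trans Nx; exact: ler_norm.
have H0pos x : 0 < H0 x by exact: lt_le_trans (expR_gt0 _) (eH0 x).
have Mb' x i j : cnorm1 (m x i j) <= `|Mb| by exact: le_trans (mMb x i j) (ler_norm _).
exact: (fredholm_split Mb' c0 cd dL L0 (normr_ge0 N) (normr_ge0 Mb) mN H0pos hH0 rL2 sH0 rH0 eH0 ker0).
Qed.
End Fredholm.

(** * Diagonalization of the asymptotic matrix *)

Section Diagonalization.
Variable R : realType.
Local Notation C := (R[i]).
Local Notation ReC := (@complex.Re R).
Local Notation ImC := (@complex.Im R).

(** The real part of [w * z] is a real combination of the real parts of [z] and [-i * z], which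
    removes the bound on [w] in [cvg_cexp_sum_Re]. *)
Lemma cvg_cexp_sum_mul (w m : C) :
  ReC (w * cexp_sum m n 1) @[n --> \oo] --> ReC (w * cexp m 1).
Proof.
have h1 : ReC (1 * cexp_sum m n 1) @[n --> \oo] --> ReC (1 * cexp m 1).
  by apply: cvg_cexp_sum_Re; rewrite /cnorm1 /= normr1 normr0 addr0.
have h2 : ReC (Complex 0 (-1) * cexp_sum m n 1) @[n --> \oo] --> ReC (Complex 0 (-1) * cexp m 1).
  by apply: cvg_cexp_sum_Re; rewrite /cnorm1 /= normrN normr1 normr0 add0r.
have e z : ReC (w * z) = ReC w * ReC (1 * z) - ImC w * ReC (Complex 0 (-1) * z).
  by rewrite mul1r !cReM /=; ring.
under eq_fun do rewrite e.
rewrite e; apply: cvgB; apply: cvgMr => //.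
Qed.

Lemma cvg_rsum I (s : seq I) (F : I -> nat -> R) (l : I -> R) :
  (forall i, F i n @[n --> \oo] --> l i) ->
  \sum_(i <- s) F i n @[n --> \oo] --> \sum_(i <- s) l i.
Proof.
move=> h; elim: s => [|i s ih].
  by rewrite big_nil; under eq_fun do rewrite big_nil; exact: cvg_cst.
by rewrite big_cons; under eq_fun do rewrite big_cons; exact: cvgD.
Qed.

Lemma toC_inv_nat (l : nat) : (l%:R^-1 : C) = toC (l%:R^-1).
Proof.
have h (r : R) : toC r = real_complex R r by [].
by rewrite h fmorphV rmorph_nat.
Qed.

Section General.
Variables (n : nat) (A P Pi : 'M[C]_n) (d : 'rV[C]_n).
Hypotheses (PPi : P *m Pi = 1%:M) (PiP : Pi *m P = 1%:M) (AP : A *m P = P *m diag_mx d).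

Lemma diagE : A = P *m diag_mx d *m Pi.
Proof. by rewrite -AP -mulmxA PPi mulmx1. Qed.

Lemma expmx_diag (x : R) :
  expmx (toC x *: A) = P *m diag_mx (\row_i cexp (d 0 i) x) *m Pi.
Proof.
have pw l : (toC x *: A) ^+ l = P *m diag_mx (\row_i (toC x * d 0 i) ^+ l) *m Pi.
  elim: l => [|l ih].
    rewrite expr0 (_ : diag_mx _ = 1%:M) ?mulmx1 ?PPi//.
    by apply/matrixP => i j; rewrite !mxE expr0.
  rewrite exprS ih (_ : (toC x *: A) * _ = (toC x *: A) *m (P *m diag_mx (\row_i (toC x * d 0 i) ^+ l) *m Pi))//.
  rewrite !mulmxA -scalemxAl AP scalemxAr; congr (_ *m _).
  rewrite -mulmxA; congr (_ *m _); apply/matrixP => i j.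
  rewrite -scalemxAl mul_diag_mx !mxE.
  by case: eqP => [->|_]; rewrite ?mulr1n ?mulr0n ?mulr0// exprS mulrA.
have sumE k : \sum_(l < k) (l`!%:R)^-1 *: (toC x *: A) ^+ l =
    P *m diag_mx (\row_i cexp_sum (toC x * d 0 i) k 1) *m Pi.
  under eq_bigr => l _ do rewrite pw scalemxAl scalemxAr.
  rewrite -mulmx_suml -mulmx_sumr; congr (_ *m _ *m _).
  apply/matrixP => i j; rewrite summxE !mxE.
  under eq_bigr => l _ do rewrite !mxE.
  case: eqP => [_|_]; last by rewrite big1// => l _; rewrite mulr0n mulr0.
  rewrite mulr1n; apply: eq_bigr => l _; rewrite mulr1n expr1n mul1r toC_inv_nat//.
have entE (f : 'I_n -> C) i j :
    (P *m diag_mx (\row_a f a) *m Pi) i j = \sum_a (P i a * Pi a j) * f a.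
  rewrite mxE; apply: eq_bigr => a _; rewrite mul_mx_diag !mxE; ring.
apply/matrixP => i j; rewrite mxE.
have lim (w : C) : ReC (w * (\sum_(l < k) (l`!%:R)^-1 *: (toC x *: A) ^+ l) i j) @[k --> \oo] -->
    ReC (w * (P *m diag_mx (\row_i cexp (d 0 i) x) *m Pi) i j).
  rewrite entE mulr_sumr cRe_sum.
  rewrite (_ : (fun k => _) = (fun k => \sum_a ReC (w * (P i a * Pi a j) * cexp_sum (toC x * d 0 a) k 1))); last first.
    apply/funext => k; rewrite sumE entE mulr_sumr cRe_sum.
    by apply: eq_bigr => a _; rewrite mulrA.
  under [X in _ --> X]eq_bigr => a _ do rewrite mulrA -cexpZ.
  by apply: cvg_rsum => a; exact: cvg_cexp_sum_mul.
apply: complex_ext => /=.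
  have := lim 1; rewrite mul1r => h; apply/cvg_lim => //.
  by move: h; under eq_fun do rewrite mul1r.
have e z : ReC (Complex 0 (-1) * z) = ImC z by rewrite cReM /=; ring.
have := lim (Complex 0 (-1)); rewrite e => h; apply/cvg_lim => //.
by move: h; under eq_fun do rewrite e.
Qed.

(** In diagonal coordinates a power of [A - z] multiplies the [i]-th coordinate by a power of the
    nonzero number [d 0 i - z]. *)
Lemma gen_eigvec_diag (z : C) (w : 'cV[C]_n) i : gen_eigvec A z w -> d 0 i != z ->
  (Pi *m w) i 0 = 0.
Proof.
move=> [k hk] dz.
have pw l : Pi *m (A - z%:M) ^+ l = diag_mx (\row_i (d 0 i - z) ^+ l) *m Pi.
  elim: l => [|l ih].
    rewrite expr0 mulmx1 (_ : diag_mx _ = 1%:M) ?mul1mx//.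
    by apply/matrixP => a b; rewrite !mxE expr0.
  rewrite exprS (_ : (A - z%:M) * _ = (A - z%:M) *m (A - z%:M) ^+ l)// mulmxA.
  have -> : Pi *m (A - z%:M) = diag_mx (\row_i (d 0 i - z)) *m Pi.
    rewrite mulmxBr diagE !mulmxA PiP mul1mx mul_mx_scalar -mul_scalar_mx -mulmxBl; congr (_ *m _).
    by apply/matrixP => a b; rewrite !mxE; case: eqP => _; rewrite ?mulr1n ?mulr0n ?subr0.
  rewrite -mulmxA ih mulmxA; congr (_ *m _).
  apply/matrixP => a b; rewrite mul_diag_mx !mxE.
  by case: eqP => [->|_]; rewrite ?mulr1n ?mulr0n ?mulr0// exprS.
have : (Pi *m ((A - z%:M) ^+ k *m w)) i 0 = 0 by rewrite hk mulmx0 mxE.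
rewrite mulmxA pw -mulmxA mul_diag_mx [X in X = _ -> _]mxE mxE => /eqP.
by rewrite mulf_eq0 expf_eq0 subr_eq0 (negbTE dz) andbF /= => /eqP.
Qed.

Hypothesis d0 : forall i, ReC (d 0 i) != 0.

Lemma in_gen_span_diag (S : C -> Prop) (v : 'cV[C]_n) i : in_gen_span A S v ->
  ~ S (d 0 i) -> (Pi *m v) i 0 = 0.
Proof.
move=> [k [z [w [hz ->]]]] nS; rewrite mulmx_sumr summxE big1// => j _.
have [Sz gw] := hz j; apply: (gen_eigvec_diag gw).
by apply/eqP => e; apply: nS; rewrite e.
Qed.

(** [Q] is known only through spans of generalized eigenvectors. By [in_gen_span_diag], [Q *m v] has
    no coordinates with nonnegative real part of the eigenvalue and [v - Q *m v] none with negative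
    one, which determines [Q]. *)
Lemma stable_proj_diag (Q : 'M[C]_n) : stable_proj A Q ->
  Q = P *m diag_mx (\row_i (if ReC (d 0 i) < 0 then 1 else 0)) *m Pi.
Proof.
move=> hQ.
suff h : Pi *m Q = diag_mx (\row_i (if ReC (d 0 i) < 0 then 1 else 0)) *m Pi.
  by rewrite -mulmxA -h mulmxA PPi mul1mx.
have hv (v : 'cV[C]_n) : Pi *m (Q *m v) = diag_mx (\row_i (if ReC (d 0 i) < 0 then 1 else 0)) *m (Pi *m v).
  have [h1 h2] := hQ v; apply/colP => i; rewrite mul_diag_mx [RHS]mxE [X in _ = X * _]mxE.
  case: ifPn => [di|]; last rewrite -leNgt => di.
    have /= := in_gen_span_diag (i := i) h2; rewrite mulmxBr mxE [X in _ + X]mxE mul1r.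
    move=> h; apply/esym/eqP; rewrite -subr_eq0; apply/eqP; apply: h.
    by move=> dn; have := lt_trans di dn; rewrite ltxx.
  rewrite mul0r; apply: (in_gen_span_diag h1) => dn.
  by have := lt_le_trans dn di; rewrite ltxx.
apply/matrixP => i j.
have := hv (delta_mx j 0); rewrite !mulmxA -!colE => /colP/(_ i).
by rewrite [X in X = _ -> _]mxE [X in _ = X -> _]mxE.
Qed.

Lemma green_diag (Q : 'M[C]_n) x : stable_proj A Q ->
  (if 0 <= x then - (expmx (toC x *: A) *m Q) else expmx (toC x *: A) *m (1%:M - Q)) =
  P *m diag_mx (\row_i green (d 0 i) x) *m Pi.
Proof.
move=> /stable_proj_diag ->; rewrite expmx_diag.
have e (u v : 'rV[C]_n) : P *m diag_mx u *m Pi *m (P *m diag_mx v *m Pi) =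
    P *m diag_mx (\row_i (u 0 i * v 0 i)) *m Pi.
  rewrite -!mulmxA (mulmxA Pi) PiP mul1mx; congr (_ *m _); rewrite mulmxA; congr (_ *m _).
  apply/matrixP => i j; rewrite mul_diag_mx !mxE.
  by case: eqP => [->|_]; rewrite ?mulr1n ?mulr0n ?mulr0.
case: ifPn => x0.
  rewrite e -mulNmx -mulmxN; congr (_ *m _ *m _).
  apply/matrixP => i j; rewrite !mxE greenE// x0.
  by case: eqP => [->|_]; rewrite ?mulr1n ?mulr0n ?oppr0//; case: ifP; rewrite ?mulr1 ?mulr0 ?oppr0.
rewrite mulmxBr mulmx1 e -mulmxBl -mulmxBr; congr (_ *m _ *m _).
apply/matrixP => i j; rewrite !mxE greenE// (negbTE x0).
by case: eqP => [->|_]; rewrite ?mulr1n ?mulr0n ?subr0//; case: ifP; rewrite ?mulr1 ?mulr0 ?subr0 ?subrr.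
Qed.
End General.
End Diagonalization.

(** * Eigenvalues and eigenvectors of the asymptotic matrix *)

Section CGLDiag.
Variable R : realType.
Local Notation C := (R[i]).
Local Notation ReC := (@complex.Re R).
Local Notation ImC := (@complex.Im R).
Variables (D beta delta alpha : R) (lam : C).
Hypothesis hDbeta : ~ (D = 0 /\ beta = 0).
Hypothesis hlam : ~ in_ess_spec D beta delta alpha lam.

Let bp : C := Complex beta (D / 2).
Let bm : C := Complex beta (- (D / 2)).
Let np : C := Complex delta alpha.
Let nm : C := Complex delta (- alpha).

(* The columns (1, -i), (1, i) diagonalize every matrix of the form [mx2 a (-b) b a]. *)
Let E : 'M[C]_2 := \matrix_(i < 2, j < 2)
  (if val i == 0%N then 1 else if val j == 0%N then Complex 0 (-1) else Complex 0 1).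
Let Ei : 'M[C]_2 := \matrix_(i < 2, j < 2)
  (if val j == 0%N then Complex (2^-1) 0
   else if val i == 0%N then Complex 0 (2^-1) else Complex 0 (- 2^-1)).
Let diag2 (a b : C) : 'M[C]_2 := diag_mx (\row_(i < 2) if val i == 0%N then a else b).

Let EEi : E *m Ei = 1%:M.
Proof.
apply/matrixP => -[[|[|//]] i] [[|[|//]] j]; rewrite !mxE !big_ord_recl big_ord0 !mxE /=;
  apply: complex_ext; rewrite ?cReD ?cImD ?cReM ?cImM /=; lra.
Qed.

Let EiE : Ei *m E = 1%:M.
Proof.
apply/matrixP => -[[|[|//]] i] [[|[|//]] j]; rewrite !mxE !big_ord_recl big_ord0 !mxE /=;
  apply: complex_ext; rewrite ?cReD ?cImD ?cReM ?cImM /=; lra.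
Qed.

Let rotE (a b : R) : mxC (mx2 a (- b) b a) *m E = E *m diag2 (Complex a b) (Complex a (- b)).
Proof.
apply/matrixP => -[[|[|//]] i] [[|[|//]] j]; rewrite mul_mx_diag !mxE !big_ord_recl big_ord0 !mxE /=;
  apply: complex_ext; rewrite ?cReD ?cImD ?cReM ?cImM /=; lra.
Qed.

Let bp0 : bp != 0.
Proof.
apply/negP => /eqP [h1 h2]; apply: hDbeta; split => //.
by move/eqP: h2; rewrite mulf_eq0 invr_eq0 pnatr_eq0 orbF => /eqP.
Qed.

Let bm0 : bm != 0.
Proof.
apply/negP => /eqP [h1 h2]; apply: hDbeta; split => //.
by move/eqP: h2; rewrite oppr_eq0 mulf_eq0 invr_eq0 pnatr_eq0 orbF => /eqP.
Qed.

Let mp := (lam - np) / bp.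
Let mm := (lam - nm) / bm.
Let kp := sqrtC mp.
Let km := sqrtC mm.

Lemma Re_neq0_sqr (k : C) : (forall s : R, k ^+ 2 != toC (- s ^+ 2)) -> ReC k != 0.
Proof.
move=> h; apply/negP => /eqP k0; have /negP := h (ImC k); apply.
apply/eqP; apply: complex_ext; rewrite expr2 ?cReM ?cImM k0 /=; ring.
Qed.

(** A purely imaginary root [i s] would give [(lam - np) / bp = - s^2], that is [lam = np - s^2 bp],
    a point of one branch of the essential spectrum. The other branch excludes the same for [km]. *)
Let kp_re : ReC kp != 0.
Proof.
apply: Re_neq0_sqr => s; rewrite sqrtCK; apply/negP => /eqP h; apply: hlam.
exists s; left; move: h => /(congr1 (fun z => z * bp)); rewrite divfK// => /eqP.
rewrite subr_eq => /eqP ->.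
by apply: complex_ext; rewrite ?cReD ?cImD ?cReM ?cImM /=; ring.
Qed.

Let km_re : ReC km != 0.
Proof.
apply: Re_neq0_sqr => s; rewrite sqrtCK; apply/negP => /eqP h; apply: hlam.
exists s; right; move: h => /(congr1 (fun z => z * bm)); rewrite divfK// => /eqP.
rewrite subr_eq => /eqP ->.
by apply: complex_ext; rewrite ?cReD ?cImD ?cReM ?cImM /=; ring.
Qed.

Let diag2M a b a' b' : diag2 a b *m diag2 a' b' = diag2 (a * a') (b * b').
Proof.
apply/matrixP => i j; rewrite mul_diag_mx !mxE.
by case: (@eqP _ i j) => [->|_]; rewrite ?mulr1n ?mulr0n ?mulr0//; case: ifP.
Qed.

Let diag2_1 a b : a = 1 -> b = 1 -> diag2 a b = 1%:M.
Proof. by move=> -> ->; apply/matrixP => i j; rewrite !mxE; case: ifP. Qed.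

Lemma Bmx_unit : mxC (Bmx D beta) \in unitmx.
Proof.
have : mxC (Bmx D beta) *m (E *m diag2 bp^-1 bm^-1 *m Ei) = 1%:M.
  rewrite !mulmxA rotE -(mulmxA E) diag2M diag2_1 ?mulfV// mulmx1; exact: EEi.
by move/mulmx1_unit => [].
Qed.

Let XE : invmx (mxC (Bmx D beta)) *m (lam%:M - mxC (N0mx delta alpha)) *m E =
  E *m (diag2 kp km *m diag2 kp km).
Proof.
rewrite diag2M -!expr2 !sqrtCK.
apply: (can_inj (mulKmx Bmx_unit)).
rewrite -!mulmxA mulKVmx ?Bmx_unit// mulmxA rotE -mulmxA diag2M !(mulrCA bp) !(mulrCA bm) !divff// !mulr1.
rewrite mulmxBl rotE mul_scalar_mx -mul_mx_scalar -mulmxBr; congr (_ *m _).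
apply/matrixP => i j; rewrite !mxE.
by case: eqP => [_|_]; rewrite ?mulr1n ?mulr0n ?subr0//; case: ifP.
Qed.

(** An eigenvector of the lower-left block with eigenvalue [k^2] yields the eigenvectors [(e, k e)]
    and [(e, - k e)] of the first-order matrix, with eigenvalues [k] and [- k]. The roots have
    nonzero real part, so they are invertible and [P] has the inverse [Pi]. *)
Lemma Ainf_diag : exists (P Pi : 'M[C]_(2 + 2)) (d : 'rV[C]_(2 + 2)),
  [/\ P *m Pi = 1%:M, Pi *m P = 1%:M, Ainf D beta delta alpha lam *m P = P *m diag_mx d &
      forall i, ReC (d 0 i) != 0].
Proof.
pose K := diag2 kp km; pose Ki := diag2 kp^-1 km^-1.
have kp0 : kp != 0 by apply: contra kp_re => /eqP ->.
have km0 : km != 0 by apply: contra km_re => /eqP ->.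
have KKi : K *m Ki = 1%:M by rewrite diag2M diag2_1 ?mulfV.
have KiK : Ki *m K = 1%:M by rewrite diag2M diag2_1 ?mulVf.
pose P : 'M[C]_(2 + 2) := block_mx E E (E *m K) (- (E *m K)).
pose h : C := 2^-1.
pose Pi : 'M[C]_(2 + 2) := block_mx (h *: Ei) (h *: (Ki *m Ei)) (h *: Ei) (- (h *: (Ki *m Ei))).
pose kr : 'rV[C]_2 := \row_(i < 2) if val i == 0%N then kp else km.
have hh : h + h = 1 by rewrite /h; field.
have hx (X : 'M[C]_2) : h *: X + h *: X = X by rewrite -scalerDl hh scale1r.
exists P, Pi, (row_mx kr (- kr)); split.
- apply: mulmx1C; rewrite /P /Pi mulmx_block -!scalemxAl ?mulNmx ?mulmxN -!scalemxAl.
  have e1 : Ki *m Ei *m (E *m K) = 1%:M by rewrite -mulmxA (mulmxA Ei) EiE mul1mx.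
  by rewrite !e1 EiE !scalerN ?opprK !hx !subrr -scalar_mx_block.
- rewrite /P /Pi mulmx_block -!scalemxAl ?mulNmx ?mulmxN -!scalemxAl.
  have e1 : Ki *m Ei *m (E *m K) = 1%:M by rewrite -mulmxA (mulmxA Ei) EiE mul1mx.
  by rewrite !e1 EiE !scalerN ?opprK !hx !subrr -scalar_mx_block.
- rewrite diag_mx_row (_ : diag_mx (- kr) = - K); last by rewrite raddfN.
  rewrite -/K /Ainf /P !mulmx_block !mul0mx !mulmx0 !mul1mx !add0r !addr0 !mulmxN ?mulNmx opprK XE.
  by rewrite !mulmxA.
- move=> i; rewrite mxE; case: split_ordP => j _; rewrite !mxE; case: ifP => _ //;
  by rewrite cReN oppr_eq0.
Qed.
End CGLDiag.

(** * The polar decomposition *)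

Section PsdSqrt.
Variable R : realType.
Local Notation C := (R[i]).
Local Notation ReC := (@complex.Re R).
Local Notation ImC := (@complex.Im R).

Definition mx2C (a b c d : C) : 'M[C]_2 :=
  \matrix_(i < 2, j < 2)
    (if val i == 0%N then (if val j == 0%N then a else b)
     else (if val j == 0%N then c else d)).

Definition herm (a b u v : R) : 'M[C]_2 :=
  mx2C (toC a) (Complex u v) (Complex u (- v)) (toC b).

Definition tr2 (X : 'M[C]_2) : R := ReC (X 0 0) + ReC (X 1 1).
Definition det2 (X : 'M[C]_2) : R :=
  ReC (X 0 0) * ReC (X 1 1) - (ReC (X 0 1) ^+ 2 + ImC (X 0 1) ^+ 2).

Lemma ord2P (i : 'I_2) : i = 0 \/ i = 1.
Proof. by case: i => [[|[|//]] hi]; [left|right]; exact: val_inj. Qed.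

Lemma mx2P (X Y : 'M[C]_2) : X 0 0 = Y 0 0 -> X 0 1 = Y 0 1 -> X 1 0 = Y 1 0 -> X 1 1 = Y 1 1 -> X = Y.
Proof.
move=> h00 h01 h10 h11; apply/matrixP => i j.
by case: (ord2P i) => ->; case: (ord2P j) => ->.
Qed.

Lemma mx2CE (a b c d : C) : (mx2C a b c d 0 0 = a) * (mx2C a b c d 0 1 = b) *
  (mx2C a b c d 1 0 = c) * (mx2C a b c d 1 1 = d).
Proof. by rewrite !mxE. Qed.

Lemma sum2 (F : 'I_2 -> C) : \sum_i F i = F 0 + F 1.
Proof.
by rewrite !big_ord_recl big_ord0 addr0; congr (_ + F _); apply: val_inj.
Qed.

Lemma mul2E p q (X : 'M[C]_(p, 2)) (Y : 'M[C]_(2, q)) i j : (X *m Y) i j = X i 0 * Y 0 j + X i 1 * Y 1 j.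
Proof. by rewrite mxE sum2. Qed.

Lemma psd_herm (X : 'M[C]_2) : psd_mx X ->
  exists a b u v, [/\ X = herm a b u v, 0 <= a, 0 <= b & 0 <= a * b - (u ^+ 2 + v ^+ 2)].
Proof.
move=> [aX pX].
have e i j : conjc (X j i) = X i j by rewrite -[in RHS]aX !mxE.
have X00 : X 0 0 = toC (ReC (X 0 0)).
  apply: complex_ext => //=; have := e 0 0; case: (X 0 0) => x y /= [] h; lra.
have X11 : X 1 1 = toC (ReC (X 1 1)).
  apply: complex_ext => //=; have := e 1 1; case: (X 1 1) => x y /= [] h; lra.
have XE : X = herm (ReC (X 0 0)) (ReC (X 1 1)) (ReC (X 0 1)) (ImC (X 0 1)).
  apply: mx2P; rewrite mx2CE//; first by case: (X 0 1).
  by rewrite -e; case: (X 0 1).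
move: XE; move: (ReC (X 0 0)) (ReC (X 1 1)) (ReC (X 0 1)) (ImC (X 0 1)) => a b u v XE.
have q (x1 y1 x2 y2 : R) : 0 <= a * (x1 ^+ 2 + y1 ^+ 2) + b * (x2 ^+ 2 + y2 ^+ 2)
      + 2 * (u * (x1 * x2 + y1 * y2) + v * (x2 * y1 - x1 * y2)).
  pose w : 'cV[C]_2 := \col_(i < 2) (if val i == 0%N then Complex x1 y1 else Complex x2 y2).
  have := pX w; rewrite XE; congr (_ <= _).
  rewrite !mul2E !mxE /=; ring.
have a0 : 0 <= a by have := q 1 0 0 0; lra.
have b0 : 0 <= b by have := q 0 0 1 0; lra.
exists a, b, u, v; split => //.
(* Test vectors giving [a] times the determinant, [b] times the determinant and, when both diagonal
   entries vanish, [- 2 * (u^2 + v^2)]. *)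
have h1 := q (- u) (- v) a 0.
have h2 := q b 0 (- u) v.
have h3 := q (- u) (- v) 1 0.
have [a1|a1] := ltP 0 a.
  by rewrite -(pmulr_rge0 _ a1); move: h1; congr (_ <= _); ring.
have [b1|b1] := ltP 0 b.
  by rewrite -(pmulr_rge0 _ b1); move: h2; congr (_ <= _); ring.
have ea : a = 0 by lra.
have eb : b = 0 by lra.
by move: h3; rewrite ea eb; have := sqr_ge0 u; have := sqr_ge0 v; rewrite !expr2; nra.
Qed.

Section Sqrt.
Variables (X : 'M[C]_2).
Hypothesis psdX : psd_mx X.
Let Y := X *m X.

Lemma psd_tr2_ge0 : 0 <= tr2 X.
Proof. by have [a [b [u [v [-> a0 b0 _]]]]] := psd_herm psdX; rewrite /tr2 !mx2CE /= addr_ge0. Qed.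

Lemma psd_det2_ge0 : 0 <= det2 X.
Proof. by have [a [b [u [v [-> _ _ h]]]]] := psd_herm psdX; rewrite /det2 !mx2CE. Qed.

(** Determinant and, below, trace of a positive root are functions of its square: the determinant is
    multiplicative, [tr^2 = tr (X^2) + 2 det], and positivity fixes the signs. *)
Lemma psd_det2E : det2 X = Num.sqrt (det2 Y).
Proof.
have -> : det2 Y = det2 X ^+ 2.
  rewrite /Y; have [a [b [u [v [-> _ _ _]]]]] := psd_herm psdX.
  by rewrite /det2 !mul2E !mx2CE !(cReD, cReM, cImD, cImM) /=; ring.
by rewrite sqrtr_sqr ger0_norm// psd_det2_ge0.
Qed.

Lemma psd_tr2_sqr : tr2 X ^+ 2 = tr2 Y + 2 * det2 X.
Proof.
rewrite /Y; have [a [b [u [v [-> _ _ _]]]]] := psd_herm psdX.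
by rewrite /det2 /tr2 !mul2E !mx2CE !(cReD, cReM, cImD, cImM) /=; ring.
Qed.

Lemma psd_tr2E : tr2 X = Num.sqrt (tr2 Y + 2 * det2 X).
Proof. by rewrite -psd_tr2_sqr sqrtr_sqr ger0_norm// psd_tr2_ge0. Qed.

Lemma psd_tr2_le : tr2 X ^+ 2 <= 2 * tr2 Y.
Proof.
rewrite psd_tr2_sqr; have [a [b [u [v [XE a0 b0 h]]]]] := psd_herm psdX.
have e := psd_tr2_sqr; move: e; rewrite /tr2 /det2 XE !mx2CE /=.
move: (ReC _ + _) => t; rewrite !expr2 => e.
have := sqr_ge0 (a - b); have := sqr_ge0 u; have := sqr_ge0 v; rewrite !expr2; nra.
Qed.

Lemma psd_entry_le i j : cnorm1 (X i j) <= 2 * tr2 X.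
Proof.
have [a [b [u [v [-> a0 b0 h]]]]] := psd_herm psdX.
have hu : `|u| <= a + b.
  by rewrite -ler_sqr ?nnegrE ?addr_ge0// real_normK ?num_real//; have := sqr_ge0 v; rewrite !expr2 in h *; nra.
have hv : `|v| <= a + b.
  by rewrite -ler_sqr ?nnegrE ?addr_ge0// real_normK ?num_real//; have := sqr_ge0 u; rewrite !expr2 in h *; nra.
rewrite /tr2 !mx2CE /= mxE /cnorm1.
by case: ifP => _; case: ifP => _ /=; rewrite ?normr0 ?normrN ?(ger0_norm a0) ?(ger0_norm b0); lra.
Qed.

Lemma psd_cayley : toC (tr2 X) *: X = Y + (toC (det2 X))%:M.
Proof.
rewrite /Y; have [a [b [u [v [-> _ _ _]]]]] := psd_herm psdX.
apply: mx2P; rewrite [RHS]mxE [X in _ + X]mxE mul2E mxE /det2 /tr2 !mx2CE /=;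
  apply: complex_ext; rewrite !(cReD, cReM, cImD, cImM) /=; ring.
Qed.

(* By Cayley-Hamilton the root is a rational function of its square and of the roots of
   scalar invariants; measurability of |M| and |M|^(1/2) comes from here. *)
Lemma psd_sqrtE : X = toC (tr2 X)^-1 *: (Y + (toC (det2 X))%:M).
Proof.
have [t0|t0] := eqVneq (tr2 X) 0; last first.
  rewrite -psd_cayley scalerA (_ : _ * _ = 1) ?scale1r//.
  by apply: complex_ext; rewrite !(cReM, cImM) /= ?mulVf//; ring.
rewrite t0 invr0 (_ : toC 0 = 0)// scale0r.
move: t0; have [a [b [u [v [-> a0 b0 h]]]]] := psd_herm psdX; rewrite /tr2 !mx2CE /= => t0.
have ea : a = 0 by lra.
have eb : b = 0 by lra.
rewrite ea eb mul0r sub0r in h.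
have eu : u = 0.
  by apply/eqP; rewrite -sqrf_eq0 eq_le sqr_ge0 andbT; have := sqr_ge0 v; lra.
have ev : v = 0.
  by apply/eqP; rewrite -sqrf_eq0 eq_le sqr_ge0 andbT; have := sqr_ge0 u; lra.
by rewrite ea eb eu ev; apply: mx2P; rewrite mx2CE mxE// oppr0.
Qed.

(** For a 2x2 matrix, trace minus matrix is the adjugate. *)
Lemma psd_adj : X *m ((toC (tr2 X))%:M - X) = (toC (det2 X))%:M.
Proof. by rewrite mulmxBr mul_mx_scalar psd_cayley addrC addKr. Qed.
End Sqrt.

Lemma measurable_sqrt d (T : measurableType d) (f : T -> R) : measurable_fun setT f ->
  measurable_fun setT (fun x => Num.sqrt (f x)).
Proof.
move=> mf.
exact: (measurableT_comp (continuous_measurable_fun (@sqrt_continuous R)) mf).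
Qed.

Lemma measurable_inv_ge0 d (T : measurableType d) (f : T -> R) : measurable_fun setT f ->
  (forall x, 0 <= f x) -> measurable_fun setT (fun x => (f x)^-1).
Proof.
move=> mf f0.
(* Writing the inverse through [ln] gives measurability away from zeros; at zeros the default
   inverse 0 is the other branch. *)
have -> : (fun x => (f x)^-1) = (fun x => if 0 < f x then expR (- ln (f x)) else 0).
  apply/funext => x; case: ltP => fx.
    by rewrite expRN lnK ?posrE.
  by rewrite (_ : f x = 0) ?invr0//; apply/le_anti; rewrite fx f0.
apply: measurable_fun_ifT => //; first exact: measurable_fun_ltr.
apply: measurableT_comp => //; apply: measurableT_comp => //.
by apply: (measurableT_comp (f := @ln R)) => //; exact: measurable_ln.
Qed.

Definition mxmeas (F : R -> 'M[C]_2) := forall i j, cmeas (fun x => F x i j).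

Lemma mxmeasD F G : mxmeas F -> mxmeas G -> mxmeas (fun x => F x + G x).
Proof. by move=> mF mG i j; under eq_fun do rewrite mxE; exact: cmeasD. Qed.

Lemma mxmeasN F : mxmeas F -> mxmeas (fun x => - F x).
Proof. by move=> mF i j; under eq_fun do rewrite mxE; exact: cmeasN. Qed.

Lemma mxmeasM F G : mxmeas F -> mxmeas G -> mxmeas (fun x => F x *m G x).
Proof.
by move=> mF mG i j; under eq_fun do rewrite mul2E; apply: cmeasD; exact: cmeasM.
Qed.

Lemma mxmeasZ (f : R -> R) F : measurable_fun setT f -> mxmeas F -> mxmeas (fun x => toC (f x) *: F x).
Proof.
by move=> mf mF i j; under eq_fun do rewrite mxE; apply: cmeasM => //; exact: cmeas_toC.
Qed.

Lemma mxmeas_scalar (f : R -> R) : measurable_fun setT f -> mxmeas (fun x => (toC (f x))%:M).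
Proof.
move=> mf i j; under eq_fun do rewrite mxE.
by case: (i == j); [exact: cmeas_toC|exact: cmeas_cst].
Qed.

Lemma mxmeas_adj F : mxmeas F -> mxmeas (fun x => adjmx (F x)).
Proof.
move=> mF i j; have [m1 m2] := mF j i; split.
  rewrite (_ : (fun x => _) = (fun x => ReC (F x j i)))//.
  by apply/funext => x; rewrite !mxE; case: (F x j i).
rewrite (_ : (fun x => _) = (fun x => - ImC (F x j i))); first exact: measurableT_comp.
by apply/funext => x; rewrite !mxE; case: (F x j i).
Qed.

Lemma measurable_tr2 F : mxmeas F -> measurable_fun setT (fun x => tr2 (F x)).
Proof.
by move=> mF; have [m1 _] := mF 0 0; have [m2 _] := mF 1 1; exact: measurable_funD.
Qed.

Lemma measurable_det2 F : mxmeas F -> measurable_fun setT (fun x => det2 (F x)).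
Proof.
move=> mF; have [m1 _] := mF 0 0; have [m2 _] := mF 1 1; have [m3 m4] := mF 0 1.
apply: measurable_funB; first exact: measurable_funM.
by apply: measurable_funD; exact: measurable_funX.
Qed.

Lemma measurable_det2_sqrt F : (forall x, psd_mx (F x)) -> mxmeas (fun x => F x *m F x) ->
  measurable_fun setT (fun x => det2 (F x)).
Proof.
move=> pF mF2; under eq_fun do rewrite psd_det2E//.
by apply: measurable_sqrt; exact: measurable_det2.
Qed.

Lemma measurable_tr2_sqrt F : (forall x, psd_mx (F x)) -> mxmeas (fun x => F x *m F x) ->
  measurable_fun setT (fun x => tr2 (F x)).
Proof.
move=> pF mF2; under eq_fun do rewrite psd_tr2E//.
apply: measurable_sqrt; apply: measurable_funD; first exact: measurable_tr2.
by apply: measurable_funM => //; exact: measurable_det2_sqrt.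
Qed.

Lemma mxmeas_sqrt F : (forall x, psd_mx (F x)) -> mxmeas (fun x => F x *m F x) -> mxmeas F.
Proof.
move=> pF mF2.
have -> : F = (fun x => toC (tr2 (F x))^-1 *: (F x *m F x + (toC (det2 (F x)))%:M)).
  by apply/funext => x; rewrite -psd_sqrtE.
apply: mxmeasZ.
  apply: measurable_inv_ge0; first exact: measurable_tr2_sqrt.
  by move=> x; exact: psd_tr2_ge0.
by apply: mxmeasD => //; apply: mxmeas_scalar; exact: measurable_det2_sqrt.
Qed.

(** * Measurability and bounds of the polar factors *)

Section Polar.
Variables (M V Mabs Mh : R -> 'M[C]_2) (K : R).
Hypothesis hMabs : forall x, psd_mx (Mabs x) /\ Mabs x *m Mabs x = adjmx (M x) *m M x.
Hypothesis hMh : forall x, psd_mx (Mh x) /\ Mh x *m Mh x = Mabs x.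
Hypothesis hV : forall x, unitary_mx (V x) /\ M x = V x *m Mabs x.
Hypothesis mM : mxmeas M.
Hypothesis MK : forall x i j, cnorm1 (M x i j) <= K.

Let pMabs x : psd_mx (Mabs x). Proof. by case: (hMabs x). Qed.

Let pMh x : psd_mx (Mh x). Proof. by case: (hMh x). Qed.

Lemma polar_mxmeas_abs : mxmeas Mabs.
Proof.
apply: mxmeas_sqrt => //.
have -> : (fun x => Mabs x *m Mabs x) = (fun x => adjmx (M x) *m M x).
  by apply/funext => x; case: (hMabs x).
by apply: mxmeasM => //; exact: mxmeas_adj.
Qed.

Lemma polar_mxmeas_half : mxmeas Mh.
Proof.
apply: mxmeas_sqrt => //.
have -> : (fun x => Mh x *m Mh x) = Mabs by apply/funext => x; case: (hMh x).
exact: polar_mxmeas_abs.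
Qed.

(* [V] itself need not be measurable where [M] is singular; the product is
   expressed through [M] and [Mabs] alone, junk inverses of 0 included. *)
Let VMhE x : V x *m Mh x = toC (tr2 (Mh x))^-1 *:
  (M x + toC (det2 (Mh x) * (det2 (Mabs x))^-1) *: (M x *m ((toC (tr2 (Mabs x)))%:M - Mabs x))).
Proof.
have [_ hh] := hMh x; have [_ ->] := hV x.
(* [M] times the adjugate of [Mabs] is [det2 (Mabs x)] times [V]; rescaling it gives the term
   [det2 (Mh x)] times [V] required by [psd_sqrtE]. In the singular case [det2 (Mh x)] is zero as
   well. *)
rewrite -mulmxA (psd_adj (pMabs x)) {1}(psd_sqrtE (pMh x)) hh -scalemxAr; congr (_ *: _).
rewrite mulmxDr !mul_mx_scalar; congr (_ + _).
rewrite scalerA; congr (_ *: _).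
have := psd_det2E (pMh x); rewrite hh => dE.
have [d0|d0] := eqVneq (det2 (Mabs x)) 0.
  by rewrite dE d0 sqrtr0 mul0r; apply: complex_ext; rewrite !(cReM, cImM) /=; ring.
by apply: complex_ext; rewrite !(cReM, cImM) /= ?divfK// ?mulr0 ?mul0r ?subr0 ?addr0 ?divfK.
Qed.

Lemma polar_mxmeas_VMh : mxmeas (fun x => V x *m Mh x).
Proof.
have mA := polar_mxmeas_abs; have mH := polar_mxmeas_half.
rewrite (_ : (fun x => _) = (fun x => toC (tr2 (Mh x))^-1 *: (M x +
   toC (det2 (Mh x) * (det2 (Mabs x))^-1) *: (M x *m ((toC (tr2 (Mabs x)))%:M - Mabs x))))); last first.
  by apply/funext => x; exact: VMhE.
apply: mxmeasZ.
  by apply: measurable_inv_ge0; [exact: measurable_tr2|move=> x; exact: psd_tr2_ge0].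
apply: mxmeasD => //; apply: mxmeasZ.
  apply: measurable_funM; first exact: measurable_det2.
  by apply: measurable_inv_ge0; [exact: measurable_det2|move=> x; exact: psd_det2_ge0].
apply: mxmeasM => //; apply: mxmeasD; last exact: mxmeasN.
by apply: mxmeas_scalar; exact: measurable_tr2.
Qed.

Lemma polar_bound_half : exists K', forall x i j, cnorm1 (Mh x i j) <= K'.
Proof.
have K0 : 0 <= K by exact: le_trans (cnorm1_ge0 _) (MK 0 0 0).
(* The trace of M^* M is at most [4 * K^2], so that of [Mabs] is at most [3 * K] and the squared
   trace of [Mh] at most [6 * K <= (6 * K + 1)^2]; entries are bounded by twice the trace. *)
exists (2 * (6 * K + 1)) => x i j.
apply: (le_trans (psd_entry_le (pMh x) i j)); rewrite ler_wpM2l//.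
have t1 := psd_tr2_le (pMabs x); have t2 := psd_tr2_le (pMh x).
have [_ e1] := hMabs x; have [_ e2] := hMh x; rewrite e1 in t1; rewrite e2 in t2.
have p1 := psd_tr2_ge0 (pMabs x); have p2 := psd_tr2_ge0 (pMh x).
have sq a b : ReC (M x a b) ^+ 2 + ImC (M x a b) ^+ 2 <= K ^+ 2.
  by apply: (le_trans (sqr_cnorm1 _)); rewrite lerXn2r ?nnegrE ?cnorm1_ge0.
have t3 : tr2 (adjmx (M x) *m M x) <= 4 * K ^+ 2.
  have := sq 0 0; have := sq 0 1; have := sq 1 0; have := sq 1 1.
  rewrite /tr2 !mul2E !mxE; case: (M x 0 0) (M x 0 1) (M x 1 0) (M x 1 1) => [a b] [a1 b1] [a2 b2] [a3 b3].
  by rewrite /= !expr2; lra.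
have t4 : tr2 (Mabs x) <= 3 * K.
  rewrite -ler_sqr ?nnegrE ?mulr_ge0//; apply: (le_trans t1); rewrite exprMn.
  by have := sqr_ge0 K; lra.
have b0 : 0 <= 6 * K + 1 by lra.
rewrite -ler_sqr ?nnegrE//; apply: (le_trans t2).
by have := sqr_ge0 K; rewrite !expr2; nra.
Qed.

Lemma unitary_entry_le (U : 'M[C]_2) i j : unitary_mx U -> cnorm1 (U i j) <= 2.
Proof.
move=> hU; have := congr1 (fun A : 'M[C]_2 => ReC (A j j)) hU.
rewrite mul2E !mxE eqxx /= => h.
have h2 : ReC (U 0 j) ^+ 2 + ImC (U 0 j) ^+ 2 + (ReC (U 1 j) ^+ 2 + ImC (U 1 j) ^+ 2) = 1.
  by rewrite -h; case: (U 0 j) (U 1 j) => [a b] [a1 b1] /=; ring.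
rewrite -ler_sqr ?nnegrE ?cnorm1_ge0//; apply: (le_trans (cnorm1_sqr _)).
have := sqr_ge0 (ReC (U 0 j)); have := sqr_ge0 (ImC (U 0 j)).
have := sqr_ge0 (ReC (U 1 j)); have := sqr_ge0 (ImC (U 1 j)).
by case: (ord2P i) => ->; rewrite (expr2 2); lra.
Qed.

Lemma polar_bound_VMh : exists K', forall x i j, cnorm1 ((V x *m Mh x) i j) <= K'.
Proof.
have [K' hK] := polar_bound_half; exists (2 * K' + 2 * K') => x i j.
have hU a b := unitary_entry_le a b (proj1 (hV x)).
rewrite mul2E (le_trans (cnorm1D _ _))//; apply: lerD.
  by rewrite (le_trans (cnorm1M _ _))// ler_pM ?cnorm1_ge0.
by rewrite (le_trans (cnorm1M _ _))// ler_pM ?cnorm1_ge0.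
Qed.
End Polar.
End PsdSqrt.

(** * The potential *)

Section Potential.
Variable R : realType.
Variables (eps gam mu nu : R) (p q : R -> R).
Hypotheses (cp : continuous p) (cq : continuous q).
Hypothesis hdecay_p : Num.sqrt (p x ^+ 2 + q x ^+ 2) @[x --> +oo] --> 0.
Hypothesis hdecay_m : Num.sqrt (p x ^+ 2 + q x ^+ 2) @[x --> -oo] --> 0.

Let n2 x := p x ^+ 2 + q x ^+ 2.

Let n2_ge0 x : 0 <= n2 x. Proof. by rewrite addr_ge0 ?sqr_ge0. Qed.

Let cn2 : continuous n2.
Proof. by move=> x; apply: cvgD; rewrite /GRing.exp /=; apply: cvgM; (exact: cp || exact: cq). Qed.

Lemma n2_vanish th : 0 < th -> exists N : R, forall x, N <= `|x| -> n2 x <= th.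
Proof.
move=> th0.
have s0 : 0 < Num.sqrt th by rewrite sqrtr_gt0.
have imp x : `|0 - Num.sqrt (n2 x)| <= Num.sqrt th -> n2 x <= th.
  by rewrite sub0r normrN ger0_norm ?sqrtr_ge0// ler_sqrt// ltW.
move/cvgrPdist_le : hdecay_p => /(_ _ s0) [N1 [_ h1]].
move/cvgrPdist_le : hdecay_m => /(_ _ s0) [N2 [_ h2]].
exists (`|N1| + `|N2| + 1) => x hx; apply: imp.
have := ler_norm N1; have := ler_norm (- N2); rewrite normrN => l2 l1.
have [x0|x0] := leP 0 x.
  apply: h1; rewrite (ger0_norm x0) in hx; have := normr_ge0 N2; lra.
apply: h2; rewrite (ltr0_norm x0) in hx; have := normr_ge0 N1; lra.
Qed.

Lemma n2_bounded : exists K : R, forall x, n2 x <= K.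
Proof.
have [N hN] := n2_vanish ltr01.
have NN : - `|N| <= `|N| by rewrite (le_trans _ (normr_ge0 N))// oppr_le0.
have [c _ hc] := EVT_max NN (continuous_subspaceT cn2).
exists (n2 c + 1) => x; have [xN|Nx] := leP `|x| `|N|.
  rewrite (le_trans (hc x _)) ?lerDl// in_itv /=.
  by rewrite -ler_norml.
rewrite (le_trans (hN x _)) ?lerDr//.
by rewrite (le_trans (ler_norm N))// ltW.
Qed.

Let rot_entry (a b : R) i j : `|mx2 a (- b) b a i j| <= `|a| + `|b|.
Proof. by rewrite mxE; case: ifP => _; case: ifP => _; rewrite ?normrN ?lerDl ?lerDr. Qed.

Let vv_entry x i j : `|(vec2 (p x) (q x) *m (vec2 (p x) (q x))^T) i j| <= n2 x.
Proof.
have h (a b : R) : `|a * b| <= a ^+ 2 + b ^+ 2.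
  rewrite normrM -[a ^+ 2]real_normK ?num_real// -[b ^+ 2]real_normK ?num_real//.
  by have := sqr_ge0 (`|a| - `|b|); have := sqr_ge0 (`|a| + `|b|); rewrite !expr2; lra.
have h2 (a : R) : `|a * a| = a ^+ 2 by rewrite -expr2 ger0_norm ?sqr_ge0.
rewrite mxE big_ord1 !mxE; case: ifP => _; case: ifP => _; rewrite ?h2 /n2 ?h//.
- by rewrite lerDl sqr_ge0.
- by rewrite mulrC h.
- by rewrite lerDr sqr_ge0.
Qed.

Let rsum2 (F : 'I_2 -> R) : \sum_i F i = F 0 + F 1.
Proof. by rewrite !big_ord_recl big_ord0 addr0; congr (_ + F _); apply: val_inj. Qed.

Let MmxE x i j : Mmx eps gam mu nu p q x i j =
  N1mx eps gam i j * n2 x + N2mx mu nu i j * n2 x ^+ 2 +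
  ((N1mx eps gam i 0 *+ 2 + N2mx mu nu i 0 * (4 * n2 x)) * (vec2 (p x) (q x) *m (vec2 (p x) (q x))^T) 0 j +
   (N1mx eps gam i 1 *+ 2 + N2mx mu nu i 1 * (4 * n2 x)) * (vec2 (p x) (q x) *m (vec2 (p x) (q x))^T) 1 j).
Proof.
have sc (A : 'M[R]_2) (r : R) k l : (A * r%:M) k l = A k l * r.
  by rewrite -mulmxE mul_mx_scalar mxE mulrC.
have ad (A B : 'M[R]_2) k l : (A + B) k l = A k l + B k l by rewrite mxE.
by rewrite /Mmx ad [X in _ + X]mxE rsum2 !ad !sc !mulr2n.
Qed.

Lemma Mmx_le : exists K : R, forall x i j,
  `|Mmx eps gam mu nu p q x i j| <= K * (n2 x + n2 x ^+ 2).
Proof.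
pose c1 : R := `|eps| + `|gam|; pose c2 : R := `|mu| + `|nu|.
have c10 : 0 <= c1 by rewrite addr_ge0.
have c20 : 0 <= c2 by rewrite addr_ge0.
(* The scalar terms contribute [c1] and [c2]; the product with the rank-one matrix has two summands,
   each contributing [2 * c1] and [4 * c2]. *)
exists (5 * c1 + 9 * c2) => x i j; rewrite MmxE.
have t0 := n2_ge0 x; have tt := sqr_ge0 (n2 x).
have b1 k l : `|N1mx eps gam k l| <= c1 := rot_entry eps gam k l.
have b2 k l : `|N2mx mu nu k l| <= c2 := rot_entry mu nu k l.
have h1 : `|N1mx eps gam i j * n2 x| <= c1 * n2 x by rewrite normrM (ger0_norm t0) ler_wpM2r.
have h2 : `|N2mx mu nu i j * n2 x ^+ 2| <= c2 * n2 x ^+ 2 by rewrite normrM (ger0_norm tt) ler_wpM2r.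
have h3 k : `|(N1mx eps gam i k *+ 2 + N2mx mu nu i k * (4 * n2 x)) *
    (vec2 (p x) (q x) *m (vec2 (p x) (q x))^T) k j| <= (2 * c1 + 4 * c2 * n2 x) * n2 x.
  rewrite normrM ler_pM ?normr_ge0 ?vv_entry// (le_trans (ler_normD _ _))// lerD//.
    by rewrite mulr2n (le_trans (ler_normD _ _))// mulrDl mul1r lerD.
  by rewrite normrM (ger0_norm (_ : 0 <= 4 * n2 x)) ?mulr_ge0// (mulrC 4 c2) -mulrA ler_wpM2r ?mulr_ge0.
apply: (le_trans (ler_normD _ _)); apply: (le_trans (lerD (ler_normD _ _) (ler_normD _ _))).
have := h3 0; have := h3 1; move: h1 h2.
have := mulr_ge0 c10 tt; have := mulr_ge0 c20 t0; rewrite !expr2.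
set A1 := `|_|; set A2 := `|_|; set A3 := `|_|; set A4 := `|_|.
lra.
Qed.

Lemma cnorm1_toC (r : R) : cnorm1 (toC r) = `|r|.
Proof. by rewrite /cnorm1 /= normr0 addr0. Qed.

Lemma Mmx_bounded : exists K : R, forall x i j, cnorm1 (mxC (Mmx eps gam mu nu p q x) i j) <= K.
Proof.
have [K hK] := Mmx_le; have [n hn] := n2_bounded.
exists (`|K| * (n + n ^+ 2)) => x i j; rewrite mxE cnorm1_toC (le_trans (hK x i j))//.
have t0 := n2_ge0 x; have tn := hn x.
apply: (@le_trans _ _ (`|K| * (n2 x + n2 x ^+ 2))).
  by rewrite ler_wpM2r ?addr_ge0 ?sqr_ge0// ler_norm.
by rewrite ler_wpM2l// lerD// lerXn2r// nnegrE (le_trans t0).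
Qed.

Lemma Mmx_vanish th : 0 < th -> exists N : R, forall x i j, N <= `|x| ->
  cnorm1 (mxC (Mmx eps gam mu nu p q x) i j) <= th.
Proof.
move=> th0; have [K hK] := Mmx_le.
(* [t <= 1] gives [n2^2 <= n2], so the bound is at most [2 * |K| * n2]; the second argument makes
   this at most [th]. *)
pose t := Num.min 1 (th / (2 * (`|K| + 1))).
have K1 : 0 < `|K| + 1 by rewrite ltr_wpDl.
have t0 : 0 < t by rewrite lt_min ltr01 divr_gt0// mulr_gt0.
have [N hN] := n2_vanish t0; exists N => x i j Nx.
rewrite mxE cnorm1_toC (le_trans (hK x i j))//.
have n0 := n2_ge0 x; have := hN x Nx; rewrite le_min => /andP[n1 nt].
apply: (@le_trans _ _ (`|K| * (n2 x + n2 x ^+ 2))).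
  by rewrite ler_wpM2r ?addr_ge0 ?sqr_ge0// ler_norm.
rewrite ler_pdivlMr ?mulr_gt0// in nt; apply: le_trans nt.
rewrite mulrA (mulrC (_ * 2)); apply: ler_pM => //; first by rewrite addr_ge0 ?sqr_ge0.
  by rewrite lerDl.
by rewrite expr2; nra.
Qed.

Lemma Mmx_meas : mxmeas (fun x => mxC (Mmx eps gam mu nu p q x)).
Proof.
have mp : measurable_fun setT p by exact: continuous_measurable_fun.
have mq : measurable_fun setT q by exact: continuous_measurable_fun.
have mn : measurable_fun setT n2 by exact: continuous_measurable_fun.
have mv i j : measurable_fun setT (fun x => (vec2 (p x) (q x) *m (vec2 (p x) (q x))^T) i j).
  under eq_fun do rewrite mxE big_ord1 !mxE.
  by apply: measurable_funM; case: (val _ == 0%N).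
move=> i j; under eq_fun do rewrite mxE.
apply: cmeas_toC; under eq_fun do rewrite MmxE.
have m1 k : measurable_fun setT (fun x => N1mx eps gam i k *+ 2 + N2mx mu nu i k * (4 * n2 x)).
  by apply: measurable_funD => //; apply: measurable_funM => //; apply: measurable_funM.
apply: measurable_funD.
  apply: measurable_funD; apply: measurable_funM => //; exact: measurable_funX.
by apply: measurable_funD; apply: measurable_funM.
Qed.
End Potential.

(** * The resolvent of the first-order operator *)

Section Resolvent.
Variable R : realType.
Local Notation C := (R[i]).
Local Notation ReC := (@complex.Re R).
Local Notation leb := (@lebesgue_measure R).

Lemma cvint_mulmx p n (a : 'M[C]_(p, n)) (B : set R) (F : R -> 'cV[C]_n) : measurable B ->
  (forall i, cinteg B (fun x => F x i 0)) -> cvint B (fun x => a *m F x) = a *m cvint B F.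
Proof.
move=> mB iF; apply/colP => i; rewrite !mxE.
under eq_cint => x _ do rewrite mxE.
rewrite cint_sum//; last by move=> j; exact: cintegZ.
by apply: eq_bigr => j _; rewrite mxE cintZ.
Qed.

Lemma eq_cvint n (B : set R) (F G : R -> 'cV[C]_n) : (forall x, B x -> F x = G x) ->
  cvint B F = cvint B G.
Proof. by move=> h; apply/colP => i; rewrite !mxE; apply: eq_cint => x /h ->. Qed.

Lemma cvint_ae n (B : set R) (F G : R -> 'cV[C]_n) : measurable B -> L2 F -> L2 G -> Defs.ae_eq F G ->
  cvint B F = cvint B G.
Proof.
move=> mB /L2P F2 /L2P G2 FG; apply/colP => i; rewrite !mxE; apply: cint_ae => //.
- by case: (F2 i).
- by case: (G2 i).
- by apply: (@filterS _ _ (ae_filter_ringOfSetsType leb) _ _ _ FG) => x ->.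
Qed.

(** The constant is independent of the middle factor, so boundedness and decay of a potential
    survive multiplication by fixed matrices. *)
Lemma cnorm1_mulmx_le p n k m (a : 'M[C]_(p, n)) (b : 'M[C]_(k, m)) : exists2 c : R, 0 <= c &
  forall (F : 'M[C]_(n, k)) K, 0 <= K -> (forall i j, cnorm1 (F i j) <= K) ->
  forall i j, cnorm1 ((a *m F *m b) i j) <= c * K.
Proof.
have nn r s (x : 'M[C]_(r, s)) i : 0 <= \sum_j cnorm1 (x i j).
  by apply: sumr_ge0 => j _; exact: cnorm1_ge0.
pose ca := \sum_i \sum_j cnorm1 (a i j); pose cb := \sum_i \sum_j cnorm1 (b i j).
have ca0 : 0 <= ca by apply: sumr_ge0 => i _; exact: nn.
have cb0 : 0 <= cb by apply: sumr_ge0 => i _; exact: nn.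
exists (ca * cb); first exact: mulr_ge0.
move=> F K K0 hF i j; rewrite mxE (le_trans (cnorm1_sum _ _ _))//.
rewrite mulrAC /cb mulr_sumr; apply: ler_sum => l _.
rewrite (le_trans (cnorm1M _ _))//; apply: ler_pM; rewrite ?cnorm1_ge0//; last first.
  by rewrite (bigD1 j)//= lerDl; apply: sumr_ge0 => t _; exact: cnorm1_ge0.
rewrite mxE (le_trans (cnorm1_sum _ _ _))//.
apply: (@le_trans _ _ (\sum_s cnorm1 (a i s) * K)).
  by apply: ler_sum => s _; rewrite (le_trans (cnorm1M _ _))// ler_wpM2l ?cnorm1_ge0.
rewrite -mulr_suml ler_wpM2r// /ca (bigD1 i)//= lerDl.
by apply: sumr_ge0 => t _; exact: nn.
Qed.

Variables (n : nat) (A P Pi : 'M[C]_n) (d : 'rV[C]_n).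
Hypotheses (PPi : P *m Pi = 1%:M) (PiP : Pi *m P = 1%:M) (AP : A *m P = P *m diag_mx d).
Hypothesis d0 : forall i, ReC (d 0 i) != 0.

Let vc := vconv (fun i => d 0 i).
Definition resolv (r : R -> 'cV[C]_n) (x : R) : 'cV[C]_n := P *m vc (fun y => Pi *m r y) x.

Lemma resolv_L2 r : L2 r -> L2 (resolv r).
Proof. by move=> h; apply: L2_cmulmx; apply: (vconv_L2 d0); exact: L2_cmulmx. Qed.

Lemma resolv_sub r a b : a <= b -> L2 r ->
  resolv r b - resolv r a = cvint `[a, b] (fun x => A *m resolv r x - r x).
Proof.
move=> ab r2; have pr2 := L2_cmulmx Pi r2; have v2 := vconv_L2 d0 pr2.
have e x : A *m resolv r x - r x = P *m (diag_mx d *m vc (fun y => Pi *m r y) x - Pi *m r x).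
  by rewrite /resolv mulmxA AP mulmxBr !mulmxA PPi mul1mx.
under eq_cvint => x _ do rewrite e.
rewrite cvint_mulmx//; last first.
  move=> i; apply: (L2_cinteg_itv d0 i ab); apply: L2D; last exact: L2N.
  exact: L2_cmulmx.
rewrite /resolv -mulmxBr; congr (_ *m _); apply/colP => i.
rewrite !mxE -[X in X - _](_ : vc (fun y => Pi *m r y) b i 0 = _) ?mxE//.
have := vconv_sub d0 i ab pr2; rewrite !mxE => ->.
by apply: eq_cint => x _; rewrite mul_diag_mx [RHS]mxE [X in _ = X + _]mxE [X in _ = _ + X]mxE.
Qed.

(** Multiplication by [Pi] decouples the system, and [vconv_unique] applies to the scalar
    equations. *)
Lemma resolv_unique r w : L2 r -> L2 w ->
  (forall a b, a <= b -> w b - w a = cvint `[a, b] (fun x => A *m w x - r x)) ->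
  forall x, w x = resolv r x.
Proof.
move=> r2 w2 hw x; have PiA : Pi *m A = diag_mx d *m Pi.
  by rewrite (diagE PPi AP) !mulmxA PiP mul1mx.
suff h : Pi *m w x = vc (fun y => Pi *m r y) x by rewrite /resolv -h mulmxA PPi mul1mx.
apply: (vconv_unique d0 (z := fun x => Pi *m w x) (L2_cmulmx Pi r2) (L2_cmulmx Pi w2)) => i a b ab.
transitivity ((Pi *m (w b - w a)) i 0); first by rewrite mulmxBr [RHS]mxE [X in _ = _ + X]mxE.
rewrite hw// -cvint_mulmx//; last first.
  move=> j; apply: (L2_cinteg_itv d0 j ab); apply: L2D; last exact: L2N.
  exact: L2_cmulmx.
rewrite mxE; apply: eq_cint => y _.
by rewrite mulmxBr mulmxA PiA -mulmxA mul_diag_mx [LHS]mxE [X in X + _ = _]mxE [X in _ + X = _]mxE.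
Qed.

(** Integrated equations do not see null sets, so both sides solve the same one; uniqueness upgrades
    almost everywhere to everywhere. *)
Lemma resolv_ae r1 r2 : L2 r1 -> L2 r2 -> Defs.ae_eq r1 r2 -> resolv r1 = resolv r2.
Proof.
move=> r12 r22 r12E; apply/funext => x; apply: resolv_unique => //; first exact: resolv_L2.
move=> a b ab; rewrite resolv_sub//; apply: cvint_ae => //.
- by apply: L2D; [apply: L2_cmulmx; exact: resolv_L2|exact: L2N].
- by apply: L2D; [apply: L2_cmulmx; exact: resolv_L2|exact: L2N].
- by apply: (@filterS _ _ (ae_filter_ringOfSetsType leb) _ _ _ r12E) => y ->.
Qed.

Lemma resolvD r1 r2 x : L2 r1 -> L2 r2 ->
  resolv (fun y => r1 y + r2 y) x = resolv r1 x + resolv r2 x.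
Proof.
move=> r12 r22; rewrite /resolv -mulmxDr; congr (_ *m _); apply/colP => i.
rewrite !mxE -cintD//.
- by apply: eq_cint => y _; rewrite mulmxDr mxE mulrDr.
- exact: (vconv_integ d0 i x (L2_cmulmx Pi r12)).
- exact: (vconv_integ d0 i x (L2_cmulmx Pi r22)).
Qed.

Lemma resolvN r x : L2 r -> resolv (fun y => - r y) x = - resolv r x.
Proof.
move=> r2; apply/eqP; rewrite -addr_eq0 -resolvD//; last exact: L2N.
rewrite /resolv (_ : vc _ x = 0) ?mulmx0//; apply/colP => i.
rewrite !mxE -[RHS](cint0 setT); apply: eq_cint => y _.
by rewrite addNr mulmx0 mxE mulr0.
Qed.

Lemma resolv0 x : resolv (fun=> 0) x = 0.
Proof.
rewrite /resolv (_ : vc _ x = 0) ?mulmx0//; apply/colP => i.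
rewrite !mxE -[RHS](cint0 setT); apply: eq_cint => y _.
by rewrite mulr0.
Qed.

Lemma cvint_green (Q : 'M[C]_n) r x : stable_proj A Q -> L2 r ->
  cvint setT (fun y => (if 0 <= x - y then - (expmx (toC (x - y) *: A) *m Q)
     else expmx (toC (x - y) *: A) *m (1%:M - Q)) *m r y) = resolv r x.
Proof.
move=> hQ r2; under eq_cvint => y _ do rewrite (green_diag PPi PiP AP d0 _ hQ) -!mulmxA.
have e y i : (diag_mx (\row_j green (d 0 j) (x - y)) *m (Pi *m r y)) i 0 =
  green (d 0 i) (x - y) * (Pi *m r y) i 0 by rewrite mul_diag_mx mxE mxE.
rewrite cvint_mulmx//; last first.
  move=> i; under eq_fun do rewrite e.
  exact: (vconv_integ d0 i x (L2_cmulmx Pi r2)).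
rewrite /resolv; congr (_ *m _); apply/colP => i; rewrite !mxE.
by apply: eq_cint => y _; rewrite e.
Qed.

(** The diagonal case for the conjugated potential [Pi *m N y *m P], with unknown [Pi *m w]. *)
Lemma resolv_fredholm (N : R -> 'M[C]_n) (K : R) r :
  (forall i j, cmeas (fun x => N x i j)) ->
  (forall x i j, cnorm1 (N x i j) <= K) -> 0 <= K ->
  (forall th, 0 < th -> exists X : R, forall x i j, X <= `|x| -> cnorm1 (N x i j) <= th) ->
  L2 r ->
  (forall w, L2 w -> (forall x, w x + resolv (fun y => N y *m w y) x = 0) -> forall x, w x = 0) ->
  exists w, L2 w /\ forall x, w x + resolv (fun y => N y *m w y) x = resolv r x.
Proof.
move=> mN NK K0 Nvan r2 ker0.
have [c c0 hc] := cnorm1_mulmx_le Pi P.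
have PiE (u v : 'cV[C]_n) : P *m u = v -> u = Pi *m v by move=> <-; rewrite mulmxA PiP mul1mx.
have vE w x : P *m (w x + vc (fun y => (Pi *m N y *m P) *m w y) x) =
    P *m w x + resolv (fun y => N y *m (P *m w y)) x.
  rewrite mulmxDr /resolv; congr (_ + _ *m vc _ x).
  by apply/funext => y; rewrite !mulmxA.
have [i j||th th0|w w2 hw x|w [w2 hw]] := @vconv_fredholm R n _ d0 (fun y => Pi *m N y *m P) _
   (c * K) _ _ _ (L2_cmulmx Pi r2) _.
- under eq_fun do rewrite mxE; apply: cmeas_sum => k; apply: cmeasM; last exact: cmeas_cst.
  under eq_fun do rewrite mxE; apply: cmeas_sum => l; apply: cmeasM => //; exact: cmeas_cst.
- by move=> x; apply: hc.
- have c1 : 0 < c + 1 by rewrite ltr_wpDl.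
  have [X hX] := Nvan (th / (c + 1)) (divr_gt0 th0 c1).
  exists X => x i j Xx; apply: (@le_trans _ _ (c * (th / (c + 1)))).
    apply: hc => [|k l]; [by rewrite divr_ge0// ltW|exact: hX].
  by rewrite mulrCA ler_piMr ?ltW// ltr_pdivrMr// mul1r ltrDl.
- have : P *m w x = 0.
    apply: (ker0 (fun y => P *m w y)); first exact: L2_cmulmx.
    by move=> y; rewrite -vE hw mulmx0.
  by move/PiE; rewrite mulmx0.
- exists (fun y => P *m w y); split; first exact: L2_cmulmx.
  by move=> x; rewrite -vE hw.
Qed.
End Resolvent.

(** * The Birman-Schwinger operator *)

Section BirmanSchwinger.
Variable R : realType.
Local Notation C := (R[i]).
Local Notation ReC := (@complex.Re R).
Local Notation leb := (@lebesgue_measure R).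

Lemma L2_col_mx n1 n2 (f : R -> 'cV[C]_n1) (g : R -> 'cV[C]_n2) : L2 f -> L2 g ->
  L2 (fun x => col_mx (f x) (g x)).
Proof.
move=> /L2P f2 /L2P g2; apply/L2P => i; under eq_fun do rewrite mxE.
by case: (fintype.split i).
Qed.

Lemma L2_usubmx n1 n2 (f : R -> 'cV[C]_(n1 + n2)) : L2 f -> L2 (fun x => usubmx (f x)).
Proof. by move=> /L2P f2; apply/L2P => i; under eq_fun do rewrite mxE. Qed.

Lemma L2_dsubmx n1 n2 (f : R -> 'cV[C]_(n1 + n2)) : L2 f -> L2 (fun x => dsubmx (f x)).
Proof. by move=> /L2P f2; apply/L2P => i; under eq_fun do rewrite mxE. Qed.

Lemma L2_0 n : L2 (fun=> 0 : 'cV[C]_n).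
Proof.
apply/L2P => i; under eq_fun do rewrite mxE.
by apply: (l2_le _ (@sqint0 R)) => [|x]; [exact: cmeas_cst|rewrite cnorm10].
Qed.

Lemma cvint_usubmx n1 n2 (B : set R) (f : R -> 'cV[C]_(n1 + n2)) :
  usubmx (cvint B f) = cvint B (fun x => usubmx (f x)).
Proof. by apply/colP => i; rewrite !mxE; apply: eq_cint => x _; rewrite mxE. Qed.

Lemma cvint_dsubmx n1 n2 (B : set R) (f : R -> 'cV[C]_(n1 + n2)) :
  dsubmx (cvint B f) = cvint B (fun x => dsubmx (f x)).
Proof. by apply/colP => i; rewrite !mxE; apply: eq_cint => x _; rewrite mxE. Qed.

Lemma ae_eqP n m (f g : R -> 'cV[C]_n) (h k : R -> 'cV[C]_m) : Defs.ae_eq f g -> (forall x, f x = g x -> h x = k x) ->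
  Defs.ae_eq h k.
Proof. by move=> fg hk; apply: (@filterS _ _ (ae_filter_ringOfSetsType leb) _ _ _ fg) => x; exact: hk. Qed.

Variables (B N0 : 'M[C]_2) (M S Mh : R -> 'M[C]_2) (lam : C).
Hypothesis uB : B \in unitmx.
Let A : 'M[C]_(2 + 2) := block_mx 0 1%:M (invmx B *m (lam%:M - N0)) 0.
Variables (P Pi : 'M[C]_(2 + 2)) (d : 'rV[C]_(2 + 2)).
Hypotheses (PPi : P *m Pi = 1%:M) (PiP : Pi *m P = 1%:M) (AP : A *m P = P *m diag_mx d).
Hypothesis d0 : forall i, ReC (d 0 i) != 0.
Let W := resolv P Pi d.
Hypothesis mM : mxmeas M.
Hypothesis bM : exists K : R, forall x i j, cnorm1 (M x i j) <= K.
Hypothesis vanM : forall th, 0 < th -> exists X : R, forall x i j, X <= `|x| -> cnorm1 (M x i j) <= th.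
Hypothesis mS : mxmeas S.
Hypothesis bS : exists K : R, forall x i j, cnorm1 (S x i j) <= K.
Hypothesis mMh : mxmeas Mh.
Hypothesis bMh : exists K : R, forall x i j, cnorm1 (Mh x i j) <= K.
Hypothesis SM : forall x, S x *m Mh x = M x.

Let eqW r1 r2 x : (forall y, r1 y = r2 y) -> resolv P Pi d r1 x = resolv P Pi d r2 x.
Proof. by move=> /funext ->. Qed.

(* [w' = A w - forcing v] is the first-order form of [B u'' = (lam - N0) u + v]. *)
Definition forcing (v : 'cV[C]_2) : 'cV[C]_(2 + 2) := col_mx 0 (- (invmx B *m v)).

Let forcingE v : forcing v = col_mx 0 (- invmx B) *m v.
Proof. by rewrite mul_col_mx mul0mx mulNmx. Qed.

Let L2_forcing s : L2 s -> L2 (fun x => forcing (s x)).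
Proof. by move=> s2; under eq_fun do rewrite forcingE; exact: L2_cmulmx. Qed.

Let L2_M u : L2 u -> L2 (fun x => M x *m u x).
Proof. by move=> u2; have [K hK] := bM; exact: L2_mulmx mM hK u2. Qed.

Let L2_S u : L2 u -> L2 (fun x => S x *m u x).
Proof. by move=> u2; have [K hK] := bS; exact: L2_mulmx mS hK u2. Qed.

Let L2_Mh u : L2 u -> L2 (fun x => Mh x *m u x).
Proof. by move=> u2; have [K hK] := bMh; exact: L2_mulmx mMh hK u2. Qed.

Definition L2_eigenfunction := exists u u1 u2 : R -> 'cV[C]_2,
    H2 u u1 u2 /\ ~ Defs.ae_eq u (fun _ => 0) /\
    Defs.ae_eq (fun x => B *m u2 x + (N0 + M x) *m u x) (fun x => lam *: u x).

Let A_forcing (w : 'cV[C]_(2 + 2)) v : A *m w - forcing v =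
  col_mx (dsubmx w) (invmx B *m (lam%:M - N0) *m usubmx w + invmx B *m v).
Proof.
rewrite -{1}[w]vsubmxK mul_block_col !mul0mx mul1mx add0r addr0 opp_col_mx add_col_mx.
by rewrite subr0 opprK.
Qed.

(** The second derivative is written with [s], so the integrated identities hold exactly; the almost
    everywhere relation [s = - M u] enters only in the eigenvalue equation. *)
Lemma eigenfunction_of_forcing s : L2 s ->
  Defs.ae_eq s (fun x => - (M x *m usubmx (W (fun y => forcing (s y)) x))) ->
  ~ Defs.ae_eq (fun x => usubmx (W (fun y => forcing (s y)) x)) (fun=> 0) -> L2_eigenfunction.
Proof.
move=> s2 hs nz; set w := W _ in hs nz; have w2 : L2 w by apply: resolv_L2 => //; exact: L2_forcing.
have u2 := L2_usubmx w2.
exists (fun x => usubmx (w x)), (fun x => dsubmx (w x)),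
  (fun x => invmx B *m (lam%:M - N0) *m usubmx (w x) + invmx B *m s x).
have wE a b : a <= b -> w b - w a = cvint `[a, b] (fun x =>
    col_mx (dsubmx (w x)) (invmx B *m (lam%:M - N0) *m usubmx (w x) + invmx B *m s x)).
  move=> ab; rewrite /w /W (resolv_sub PPi AP d0 ab (L2_forcing s2)).
  by apply: eq_cvint => x _; rewrite A_forcing.
split; last split => //.
  split=> //; split; first exact: L2_dsubmx.
  split; first by apply: L2D; exact: L2_cmulmx.
  split=> a b ab.
    rewrite -linearB /= wE// cvint_usubmx; apply: eq_cvint => x _; exact: col_mxKu.
  rewrite -linearB /= wE// cvint_dsubmx; apply: eq_cvint => x _; exact: col_mxKd.
apply: (ae_eqP hs) => x ->.
rewrite mulmxDr !mulmxA mulmxV// !mul1mx mulmxBl mul_scalar_mx mulmxDl.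
by rewrite addrACA [X in _ + X = _]addNr addr0 subrK.
Qed.

(** The eigenvalue equation is used under an integral sign, where almost everywhere suffices;
    [resolv_unique] then gives a pointwise fixed-point equation for the pair [(u, u1)]. *)
Lemma forcing_of_eigenfunction : L2_eigenfunction -> exists w,
  [/\ L2 w, forall x, w x = W (fun y => forcing (- (M y *m usubmx (w y)))) x &
     ~ Defs.ae_eq (fun x => usubmx (w x)) (fun=> 0)].
Proof.
move=> [u [u1 [u2 [[uL [u1L [u2L [uE u1E]]]] [nz ueq]]]]].
exists (fun x => col_mx (u x) (u1 x)); split; first exact: L2_col_mx.
  have sL : L2 (fun y => - (M y *m usubmx (col_mx (u y) (u1 y)))).
    by under eq_fun do rewrite col_mxKu; apply: L2N; exact: L2_M.
  apply: (resolv_unique PPi PiP AP d0 (L2_forcing sL)); first exact: L2_col_mx.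
  move=> a b ab; under eq_cvint => x _ do rewrite A_forcing !(col_mxKu, col_mxKd).
  rewrite opp_col_mx add_col_mx uE// u1E//; rewrite -[RHS]vsubmxK cvint_usubmx cvint_dsubmx.
  congr col_mx; first by apply: eq_cvint => x _; rewrite col_mxKu.
  under [RHS]eq_cvint => x _ do rewrite col_mxKd.
  apply: cvint_ae => //.
    apply: L2D; apply: L2_cmulmx => //; apply: L2N; exact: L2_M.
  apply: (ae_eqP ueq) => x e.
  have -> : u2 x = invmx B *m (lam *: u x - (N0 + M x) *m u x).
    by rewrite -e addrK mulmxA mulVmx// mul1mx.
  by rewrite -mulmxA -mulmxDr mulmxBl mulmxDl mul_scalar_mx opprD addrA.
by under [X in Defs.ae_eq X]eq_fun do rewrite col_mxKu.
Qed.

(* [R_r G_A R_l], with [S = V |M|^(1/2)] and [W] the convolution with [G_A]. *)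
Definition birman (f : R -> 'cV[C]_(2 + 2)) (x : R) : 'cV[C]_(2 + 2) :=
  col_mx (Mh x *m usubmx (W (fun y => forcing (S y *m usubmx (f y))) x)) 0.

(** A kernel element satisfies [f = - R_r w] with [w = G_A R_l f], so the forcing is [- M u] and [u]
    would be an eigenfunction unless it vanishes; in that case [f] vanishes too. *)
Lemma birman_injective : ~ L2_eigenfunction -> forall f, L2 f ->
  Defs.ae_eq (fun x => f x + birman f x) (fun=> 0) -> Defs.ae_eq f (fun=> 0).
Proof.
move=> ne f f2 hf; set w := W (fun y => forcing (S y *m usubmx (f y))).
have s2 := L2_S (L2_usubmx f2).
have u0 : Defs.ae_eq (fun x => usubmx (w x)) (fun=> 0).
  apply: contrapT => nz; apply: ne; apply: (eigenfunction_of_forcing s2 _ nz).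
  apply: (ae_eqP hf) => x /eqP; rewrite addr_eq0 => /eqP e.
  by rewrite {1}e linearN /= col_mxKu mulmxN mulmxA SM.
apply: (@filterS2 _ _ (ae_filter_ringOfSetsType leb) _ _ _ _ hf u0) => x.
by rewrite /birman -/w => /[swap] ->; rewrite mulmx0 col_mx0 addr0.
Qed.

(** If [w + G_A N w = G_A R_l g] with [N = R_l R_r], then [f = g - R_r w] satisfies [G_A R_l f = w],
    hence [f + R_r G_A R_l f = g]. A homogeneous solution [w] gives an eigenfunction unless its
    upper half vanishes, and then its forcing, and so [w], vanish. *)
Lemma birman_surjective : ~ L2_eigenfunction -> forall g, L2 g ->
  exists f, L2 f /\ forall x, f x + birman f x = g x.
Proof.
move=> ne g g2.
pose NN x : 'M[C]_(2 + 2) := col_mx 0 (- invmx B) *m M x *m row_mx 1%:M 0.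
have NE x w : NN x *m w = forcing (M x *m usubmx w).
  rewrite /NN forcingE -{1}[w]vsubmxK -!mulmxA mul_row_col mul1mx mul0mx addr0//.
have [c c0 hc] := cnorm1_mulmx_le (col_mx 0 (- invmx B) : 'M[C]_(2 + 2, 2)) (row_mx 1%:M 0 : 'M[C]_(2, 2 + 2)).
have [K hK] := bM; have K0 : 0 <= K := le_trans (cnorm1_ge0 _) (hK 0 0 0).
have rg2 := L2_forcing (L2_S (L2_usubmx g2)).
have [i j|x i j||th th0|w w2 hw x|w [w2 hw]] :=
  @resolv_fredholm R _ P Pi d PiP d0 NN (c * K) _ _ _ _ _ rg2 _.
- under eq_fun do rewrite mxE; apply: cmeas_sum => k; apply: cmeasM; last exact: cmeas_cst.
  under eq_fun do rewrite mxE; apply: cmeas_sum => l; apply: cmeasM => //; exact: cmeas_cst.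
- exact: hc.
- exact: mulr_ge0.
- have c1 : 0 < c + 1 by rewrite ltr_wpDl.
  have th1 : 0 < th / (c + 1) by rewrite divr_gt0.
  have [X hX] := vanM th1.
  exists X => x i j Xx; apply: (@le_trans _ _ (c * (th / (c + 1)))).
    by apply: hc => [|k l]; [exact: ltW|exact: hX].
  by rewrite mulrCA ler_piMr ?ltW// ltr_pdivrMr// mul1r ltrDl.
- have s2 : L2 (fun y => - (M y *m usubmx (w y))) by apply: L2N; exact/L2_M/L2_usubmx.
  have hw' y : w y = W (fun y => forcing (- (M y *m usubmx (w y)))) y.
    apply/eqP; rewrite -subr_eq0 -(hw y); apply/eqP; congr (_ + _).
    rewrite -[LHS](resolvN P Pi d0 y (L2_forcing s2)).
    apply: eqW => z.
    by rewrite NE !forcingE mulmxN opprK.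
  have u0 : Defs.ae_eq (fun x => usubmx (w x)) (fun=> 0).
    apply: contrapT => nz; apply: ne; apply: (eigenfunction_of_forcing s2).
      by rewrite -(funext hw'); exact: aeW.
    by rewrite -(funext hw').
  rewrite hw' /W (resolv_ae PPi PiP AP d0 (r2 := fun=> 0)).
  + exact: resolv0.
  + exact: L2_forcing.
  + exact: L2_0.
  + by apply: (ae_eqP u0) => y ->; rewrite mulmx0 oppr0 forcingE mulmx0.
- exists (fun x => g x - col_mx (Mh x *m usubmx (w x)) 0); split.
    apply: L2D => //; apply: L2N; apply: L2_col_mx; last exact: L2_0.
    exact/L2_Mh/L2_usubmx.
  move=> x; rewrite /birman -addrA -[RHS]addr0; congr (_ + _).
  apply/eqP; rewrite addrC subr_eq0; apply/eqP; congr (col_mx (_ *m usubmx _) _).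
  have wE : w x = W (fun y => forcing (S y *m usubmx (g y))) x - W (fun y => NN y *m w y) x.
    by rewrite /W -hw addrK.
  have nw2 : L2 (fun y => NN y *m w y).
    under eq_fun do rewrite NE; exact/L2_forcing/L2_M/L2_usubmx.
  rewrite [RHS]wE /W -[X in _ = _ + X](resolvN P Pi d0 x nw2).
  rewrite -[RHS](resolvD P Pi d0 x rg2 (L2N nw2)).
  apply: eqW => y.
  by rewrite NE !forcingE -mulmxBr linearB /= col_mxKu (mulmxBr (S y)) (mulmxA (S y)) SM.
Qed.

(** The kernel element is [R_r w]. It is nonzero: [|M|^(1/2) u = 0] would give [M u = 0], so [w]
    would be the response to zero forcing. *)
Lemma birman_not_injective : L2_eigenfunction -> exists f,
  [/\ L2 f, forall x, f x + birman f x = 0 & ~ Defs.ae_eq f (fun=> 0)].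
Proof.
move=> /forcing_of_eigenfunction[w [w2 hw nz]].
exists (fun x => col_mx (Mh x *m usubmx (w x)) 0); split.
- by apply: L2_col_mx; [exact/L2_Mh/L2_usubmx|exact: L2_0].
- move=> x; rewrite /birman add_col_mx addr0 -mulmxDr.
  have -> : (fun y => forcing (S y *m usubmx (col_mx (Mh y *m usubmx (w y)) 0 : 'cV[C]_(2 + 2)))) =
      (fun y => - forcing (- (M y *m usubmx (w y)))).
    by apply/funext => y; rewrite col_mxKu mulmxA SM !forcingE mulmxN opprK.
  rewrite /W (resolvN P Pi d0); last by apply: L2_forcing; apply: L2N; exact/L2_M/L2_usubmx.
  by rewrite {1}hw linearN /= subrr mulmx0 col_mx0.
- move=> f0; apply: nz.
  have r0 : Defs.ae_eq (fun y => forcing (- (M y *m usubmx (w y)))) (fun=> 0).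
    apply: (ae_eqP f0) => x /eqP; rewrite col_mx_eq0 => /andP[/eqP e _].
    by rewrite -SM -mulmxA e mulmx0 oppr0 forcingE mulmx0.
  have w0 x : w x = 0.
    rewrite hw /W (resolv_ae PPi PiP AP d0 (r2 := fun=> 0)) ?resolv0//; last exact: L2_0.
    by apply: L2_forcing; apply: L2N; exact/L2_M/L2_usubmx.
  by apply: aeW => x; rewrite w0 linear0.
Qed.
End BirmanSchwinger.

(** * Identification with the integral operator of the statement *)

Section KopBirman.
Variable R : realType.
Local Notation C := (R[i]).
Variables (D beta delta alpha : R) (lam : C) (V Mh : R -> 'M[C]_2) (Q P Pi : 'M[C]_(2 + 2)) (d : 'rV[C]_(2 + 2)).
Hypotheses (PPi : P *m Pi = 1%:M) (PiP : Pi *m P = 1%:M).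
Hypothesis AP : Ainf D beta delta alpha lam *m P = P *m diag_mx d.
Hypothesis d0 : forall i, complex.Re (d 0 i) != 0.
Hypothesis hQ : stable_proj (Ainf D beta delta alpha lam) Q.
Hypothesis mS : mxmeas (fun x => V x *m Mh x).
Hypothesis bS : exists K : R, forall x i j, cnorm1 ((V x *m Mh x) i j) <= K.

(** [R_l f] is the forcing of [V |M|^(1/2)] applied to the upper half of [f], and [cvint_green]
    identifies the integral against [GA] with the resolvent. *)
Lemma Kop_birman f x : L2 f -> Kop D beta delta alpha lam Q V Mh f x =
  birman (mxC (Bmx D beta)) (fun y => V y *m Mh y) Mh P Pi d f x.
Proof.
move=> f2; have [K hK] := bS.
have s2 : L2 (fun y => forcing (mxC (Bmx D beta)) ((V y *m Mh y) *m usubmx (f y))).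
  have -> : (fun y => forcing (mxC (Bmx D beta)) ((V y *m Mh y) *m usubmx (f y))) =
      (fun y => col_mx 0 (- invmx (mxC (Bmx D beta))) *m ((V y *m Mh y) *m usubmx (f y))).
    by apply/funext => y; rewrite mul_col_mx mul0mx mulNmx.
  by apply: L2_cmulmx; apply: (L2_mulmx mS hK); exact: L2_usubmx.
rewrite /Kop /birman -(cvint_green PPi PiP AP d0 x hQ s2).
have -> : (fun y => GA D beta delta alpha lam Q (x - y) *m Rl D beta V Mh y *m f y) =
    (fun y => GA D beta delta alpha lam Q (x - y) *m
       forcing (mxC (Bmx D beta)) ((V y *m Mh y) *m usubmx (f y))).
  apply/funext => y; rewrite -mulmxA; congr (_ *m _).
  by rewrite /Rl /forcing -{1}[f y]vsubmxK mul_block_col !mul0mx !addr0 mulNmx !mulmxA.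
by rewrite /Rr -{1}[cvint _ _]vsubmxK mul_block_col !mul0mx !addr0.
Qed.
End KopBirman.

Unset Implicit Arguments.

Theorem theorem5p2 (R : realType) (D beta delta alpha eps gam mu nu : R)
  (hbeta : 0 <= beta) (hDbeta : ~ (D = 0 /\ beta = 0))
  (p q : R -> R)
  (hpulse : stationary_pulse D beta delta alpha eps gam mu nu p q)
  (hdecay_p : Num.sqrt (p x ^+ 2 + q x ^+ 2) @[x --> +oo] --> 0)
  (hdecay_m : Num.sqrt (p x ^+ 2 + q x ^+ 2) @[x --> -oo] --> 0)
  (V Mabs Mh : R -> 'M[R[i]]_2)
  (hMabs : forall x, psd_mx (Mabs x) /\
     Mabs x *m Mabs x = adjmx (mxC (Mmx eps gam mu nu p q x)) *m mxC (Mmx eps gam mu nu p q x))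
  (hMh : forall x, psd_mx (Mh x) /\ Mh x *m Mh x = Mabs x)
  (hV : forall x, unitary_mx (V x) /\ mxC (Mmx eps gam mu nu p q x) = V x *m Mabs x)
  (lam : R[i]) (hlam : ~ in_ess_spec D beta delta alpha lam)
  (Q : 'M[R[i]]_(2 + 2)) (hQ : stable_proj (Ainf D beta delta alpha lam) Q) :
  in_point_spec D beta delta alpha eps gam mu nu p q lam <->
  ~ IpK_invertible D beta delta alpha lam Q V Mh.
Proof.
have cp : continuous p.
  by move=> x; apply: differentiable_continuous; apply/derivable1_diffP; case: (hpulse.1 x).
have cq : continuous q.
  by move=> x; apply: differentiable_continuous; apply/derivable1_diffP; case: (hpulse.1 x) => _ [_ []].
pose M x := mxC (Mmx eps gam mu nu p q x).
have mM : mxmeas M := Mmx_meas eps gam mu nu cp cq.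
have [K MK] := Mmx_bounded eps gam mu nu cp cq hdecay_p hdecay_m.
have mMh := polar_mxmeas_half hMabs hMh mM.
have bMh := polar_bound_half hMabs hMh MK.
have mS := polar_mxmeas_VMh hMabs hMh hV mM.
have bS := polar_bound_VMh hMabs hMh hV MK.
have SM x : V x *m Mh x *m Mh x = M x by rewrite -mulmxA (hMh x).2 -(hV x).2.
have bM : exists K, forall x i j, cnorm1 (M x i j) <= K by exists K.
have vanM := Mmx_vanish eps gam mu nu hdecay_p hdecay_m.
have uB := Bmx_unit hDbeta.
have [P [Pi [d [PPi PiP AP d0]]]] := Ainf_diag hDbeta hlam.
have KE := Kop_birman PPi PiP AP d0 hQ mS bS.
split=> [ps [inj _]|ninv].
  have [f [f2 hf nz]] := birman_not_injective uB PPi PiP AP d0 mM bM mMh bMh SM ps.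
  apply: nz; apply: inj => //; apply: aeW => x; by rewrite KE.
(* Without an eigenfunction both halves of invertibility hold. Surjectivity is even obtained
   pointwise and then weakened to almost everywhere. *)
apply: contrapT => nps; apply: ninv; split=> [f f2 hf|g g2].
  apply: (birman_injective uB PPi AP d0 mS bS SM nps f2).
  by apply: (ae_eqP hf) => x <-; rewrite KE.
have [f [f2 hf]] := birman_surjective uB PPi PiP AP d0 mM bM vanM mS bS mMh bMh SM nps g2.
by exists f; split => //; apply: aeW => x; rewrite KE.
Qed.
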